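(* Let $b\ge2$ be an integer, $\sigma\in(0,\sqrt{2\log b})$, and let $\mathscr W_\sigma(t)=\exp\big(\sigma B(t)-\frac{\sigma^2}{2}t\big)$, $t\in[0,1]$, where $B$ is a standard Brownian motion started from $0$. Then the generalized Mandelbrot cascade measure $\mathrm{MC}_{\mathscr W_\sigma}^b$ on $[0,1]$ is non-degenerate (i.e. non-zero with positive probability) and has polynomial Fourier decay almost surely. Moreover, almost surely on $\{\mathrm{MC}_{\mathscr W_\sigma}^b\ne0\}$, $$\dim_F(\mathrm{MC}_{\mathscr W_\sigma}^b)\ge D_\sigma:=\begin{cases}1-\dfrac{\sigma^2}{\log b}&\text{if }0<\sigma<\dfrac{\sqrt{2\log b}}2,\\[2mm]\Big(\sqrt2-\dfrac{\sigma}{\sqrt{\log b}}\Big)^2&\text{if }\dfrac{\sqrt{2\log b}}2\le\sigma<\sqrt{2\log b}.\end{cases}$$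
   Context: Construction of $\mathrm{MC}_{\mathscr W}^b$ for a non-negative process $\mathscr W$ on $[0,1]$ with mean $1$: let $\mathscr D_m^b$ be the family of intervals $I=[\frac{h-1}{b^m},\frac{h}{b^m})$, $h\in\{1,\dots,b^m\}$, with left end-point $\ell_I$. Let $\{\mathscr W_I:I\in\bigsqcup_{m\ge1}\mathscr D_m^b\}$ be jointly independent processes such that for $I\in\mathscr D_m^b$, $\{\mathscr W_I(t):t\in I\}$ has the same distribution as $\{\mathscr W(b^m(t-\ell_I)):t\in I\}$. Put $P_0\equiv1$ and $P_m(t)=\sum_{I\in\mathscr D_m^b}\mathscr W_I(t)\mathbf 1_I(t)$ for $m\ge1$. $\mathrm{MC}_{\mathscr W}^b$ is the almost sure weak limit as $m\to\infty$ of $\big[\prod_{j=0}^mP_j(t)\big]dt$ on $[0,1]$. For a finite Borel measure $\nu$ on $[0,1]$, $\widehat\nu(x)=\int e^{-2\pi ixt}\nu(dt)$ and $\dim_F(\nu)=\sup\{D\in[0,1):|\widehat\nu(x)|^2=O(|x|^{-D})\text{ as }|x|\to\infty\}$. A non-zero $\nu$ has polynomial Fourier decay if $|\widehat\nu(x)|^2=O(|x|^{-D})$ for some $D>0$. *)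

(* Defs.v *)
From mathcomp Require Import all_boot all_order all_algebra.
From mathcomp Require Import all_classical all_reals all_analysis.
From mathcomp Require Import complex.

Set Implicit Arguments.
Unset Strict Implicit.
Unset Printing Implicit Defensive.

Import Order.TTheory GRing.Theory Num.Theory.
Import numFieldNormedType.Exports.

Local Open Scope classical_set_scope.
Local Open Scope ring_scope.

(* A real-valued process indexed by a set T of reals is a total function
   X : R -> Omega -> R of which only the values X t with t in T matter. *)

(* The product sigma-algebra of the path space R^T, pulled back to R -> R. *)
Definition path_sigma (R : realType) (T : set R) : set (set (R -> R)) :=
  <<s \bigcup_(t in T)
        preimage_set_system [set: R -> R] (fun f : R -> R => f t)
          (@measurable _ R) >>.

Definition process_sigma (R : realType) (Omega : Type) (T : set R)
    (X : R -> Omega -> R) : set (set Omega) :=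
  preimage_set_system [set: Omega] (fun w => X ^~ w) (path_sigma T).

Definition same_law (R : realType) (T : set R)
    (d d' : measure_display) (Omega : measurableType d)
    (Omega' : measurableType d') (P : probability Omega R)
    (P' : probability Omega' R)
    (X : R -> Omega -> R) (Y : R -> Omega' -> R) : Prop :=
  forall A, path_sigma T A ->
    P [set w | A (X ^~ w)] = P' [set w | A (Y ^~ w)].

Definition mutually_independent (R : realType) (d : measure_display)
    (Omega : measurableType d) (P : probability Omega R) (I : eqType)
    (F : I -> set (set Omega)) : Prop :=
  forall (s : seq I) (E : I -> set Omega),
    uniq s -> (forall i, i \in s -> F i (E i)) ->
    P (\big[setI/setT]_(i <- s) E i) = (\prod_(i <- s) P (E i))%E.

Record brownian_motion01 (R : realType) (d : measure_display)
    (Omega : measurableType d) (P : probability Omega R)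
    (B : R -> Omega -> R) : Prop := {
  bm_measurable : forall t, t \in `[0, 1] -> measurable_fun setT (B t) ;
  bm_start : {ae P, forall w, B 0 w = 0} ;
  bm_continuous : {ae P, forall w, {within `[0, 1], continuous (B ^~ w)}} ;
  bm_gaussian : forall s t, 0 <= s -> s < t -> t <= 1 ->
    forall A : set R, measurable A ->
    P [set w | A (B t w - B s w)] = normal_prob 0 (Num.sqrt (t - s)) A ;
  bm_independent : forall t : nat -> R,
    {homo t : i j / (i <= j)%N >-> i <= j} -> (forall i, t i \in `[0, 1]) ->
    mutually_independent P (fun i : nat =>
      preimage_set_system [set: Omega] (fun w => B (t i.+1) w - B (t i) w)
        (@measurable _ R)) }.

Definition geometric_bm (R : realType) (Omega : Type) (sigma : R)
    (B : R -> Omega -> R) (t : R) (w : Omega) : R :=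
  expR (sigma * B t w - sigma ^+ 2 / 2 * t).

(* The index Tagged _ k at tag m stands for the b-adic interval
   [k / b^(m+1), (k+1) / b^(m+1)[ of level m+1, so that levels start at 1. *)
Definition cascade_index (b : nat) : eqType := {m : nat & 'I_(b ^ m.+1)}.

Definition left_end (R : realType) (b : nat) (I : cascade_index b) : R :=
  (tagged I)%:R / b%:R ^+ (tag I).+1.

Definition right_end (R : realType) (b : nat) (I : cascade_index b) : R :=
  (tagged I).+1%:R / b%:R ^+ (tag I).+1.

Definition badic_interval (R : realType) (b : nat) (I : cascade_index b)
    : set R :=
  `[left_end R I, right_end R I[.
Arguments badic_interval R {b} I.

(* Processes with continuous paths are compared as random continuous
   functions, hence a copy is also required to have continuous paths; equality
   of the laws on the product sigma-algebra would not see path regularity. *)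
Record cascade_family (R : realType) (d d' : measure_display)
    (Omega : measurableType d) (Omega' : measurableType d')
    (P : probability Omega R) (P' : probability Omega' R) (b : nat)
    (W : R -> Omega' -> R) (WI : cascade_index b -> R -> Omega -> R)
    : Prop := {
  cf_measurable : forall I t, badic_interval R I t ->
    measurable_fun setT (WI I t) ;
  cf_continuous : forall I,
    {ae P, forall w, {within badic_interval R I, continuous (WI I ^~ w)}} ;
  cf_law : forall I, same_law (badic_interval R I) P P' (WI I)
    (fun t => W (b%:R ^+ (tag I).+1 * (t - left_end R I))) ;
  cf_independent : mutually_independent P
    (fun I => process_sigma (badic_interval R I) (WI I)) }.

Definition cascade_level (R : realType) (Omega : Type) (b : nat)
    (WI : cascade_index b -> R -> Omega -> R) (m : nat) (w : Omega) (t : R)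
    : R :=
  if m is n.+1 then
    \sum_(k < b ^ n.+1)
      let I : cascade_index b := Tagged (fun n => 'I_(b ^ n.+1)) k in
      WI I t w * \1_(badic_interval R I) t
  else 1.

Definition cascade_density (R : realType) (Omega : Type) (b : nat)
    (WI : cascade_index b -> R -> Omega -> R) (m : nat) (w : Omega) (t : R)
    : R :=
  \prod_(j < m.+1) cascade_level WI j w t.

(* Finite Borel measures on [0, 1] are finite Borel measures on R that give no
   mass to the complement of [0, 1]. *)
Definition weak_limit01 (R : realType) (f : nat -> R -> R)
    (nu : {finite_measure set (measurableTypeR R) -> \bar R}) : Prop :=
  nu (~` `[0, 1]) = 0%E /\
  forall phi : R -> R, {within `[0, 1], continuous phi} ->
    (fun m => \int[lebesgue_measure]_(t in `[0%R, 1%R]) (phi t * f m t)%:E)%E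
      @ \oo --> (\int[nu]_(t in `[0%R, 1%R]) (phi t)%:E)%E.

Definition is_cascade_measure (R : realType) (d : measure_display)
    (Omega : measurableType d) (P : probability Omega R) (b : nat)
    (WI : cascade_index b -> R -> Omega -> R)
    (MC : Omega -> {finite_measure set (measurableTypeR R) -> \bar R}) : Prop :=
  {ae P, forall w, weak_limit01 (fun m => cascade_density WI m w) (MC w)}.

Definition nonzero_measure (R : realType)
    (nu : {finite_measure set (measurableTypeR R) -> \bar R}) : Prop :=
  nu setT != 0%E.

(* {MC <> 0} is only measurable for the completion of P, whence the measurable
   subset A. *)
Definition non_degenerate (R : realType) (d : measure_display)
    (Omega : measurableType d) (P : probability Omega R)
    (MC : Omega -> {finite_measure set (measurableTypeR R) -> \bar R}) : Prop :=
  exists A : set Omega,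
    [/\ measurable A, A `<=` [set w | nonzero_measure (MC w)]
      & (0 < P A)%E].

(* The integral of e^(-2 i pi x t), by real and imaginary parts. *)
Definition fourier (R : realType)
    (nu : {finite_measure set (measurableTypeR R) -> \bar R}) (x : R) : R[i] :=
  Complex (\int[nu]_(t in `[0, 1]) cos (2 * pi * x * t))
          (- \int[nu]_(t in `[0, 1]) sin (2 * pi * x * t)).

Definition fourier_decay (R : realType)
    (nu : {finite_measure set (measurableTypeR R) -> \bar R}) (D : R) : Prop :=
  exists C X : R, forall x : R, X <= `|x| ->
    ComplexField.Normc.normc (fourier nu x) ^+ 2 <= C * `|x| `^ (- D).

(* Holds trivially for the zero measure, so that "almost surely" and "almost
   surely on {nu <> 0}" mean the same for this property. *)
Definition polynomial_fourier_decay (R : realType)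
    (nu : {finite_measure set (measurableTypeR R) -> \bar R}) : Prop :=
  exists2 D : R, 0 < D & fourier_decay nu D.

Definition fourier_dim (R : realType)
    (nu : {finite_measure set (measurableTypeR R) -> \bar R}) : R :=
  sup [set D : R | 0 <= D < 1 /\ fourier_decay nu D].

Definition D_sigma (R : realType) (b : nat) (sigma : R) : R :=
  if sigma < Num.sqrt (2 * ln b%:R) / 2 then 1 - sigma ^+ 2 / ln b%:R
  else (Num.sqrt 2 - sigma / Num.sqrt (ln b%:R)) ^+ 2.

(* Main.v *)
(** Let 1 < p <= 2. The process W = W_sigma is a log-normal
  martingale with E W(t)^p <= exp (p (p - 1) sigma^2 / 2) =: kappa, and its
  increments over a distance h have L^p norm of order h^(1/2). Everything is
  read off Riemann sums over the grid j / b^n, where the level-m density is a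
  product of m independent values of mean 1.

  The level-m increment of the Fourier transform at frequency x is a sum over
  the b^m blocks of level m of terms which are independent and centered given
  the past. For finitely many frequencies x_1, ..., x_N at once, the p-smoothness
  of the l^q norm, q large and even, bounds the p-th moment of its l^q norm by
  the sum of the p-th moments of the blocks, that is by a constant times
  N^(p/q) beta^m with beta = b^(1-p) kappa. If b^k <= |x| <= b^(k+1) with k > m,
  shifting the grid by a fraction of a period shows moreover that the block sums
  are controlled by the variation of the density at scale b^-k, which gains the
  factor b^(-(k-m)p/2). For the best p one has beta = b^(-pD/2) with D = D_sigma,
  and b^(2k+1) frequencies in [b^k, b^(k+1)] cost only b^((2k+1)p/q): letting n tend
  to infinity by Fatou's lemma and summing over k and m, the transform is almost
  surely O(b^(-kD'/2)) on this set for every D' < D. Since it is Lipschitz and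
  the set has mesh b^-k, this extends to all frequencies.

  At frequency 0 the same moments bound the total mass in L^p uniformly; as its
  mean is 1, it cannot tend to 0 almost surely. *)

Require Import Defs.
From HB Require Import structures.
From mathcomp Require Import all_boot all_order all_algebra.
From mathcomp Require Import all_classical all_reals all_analysis.
From mathcomp Require Import measurable_realfun complex ring lra zify.

Set Implicit Arguments.
Unset Strict Implicit.
Unset Printing Implicit Defensive.

Import Order.TTheory GRing.Theory Num.Theory.
Import numFieldNormedType.Exports.

Local Open Scope classical_set_scope.
Local Open Scope ring_scope.

(** [MC] is tied to the cascade only by an almost sure weak limit and is not given as a measurable
    map, so expectations are taken only of finite sums over the grid and of their lower limits; all
    other limits are taken for a fixed outcome. Conditional expectations are avoided too: centering
    is the vanishing of E[X (Y - 1)] when Y is independent of all that X depends on. A union bound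
    over the frequencies would lose b^(2k+1), more than the decay b^(-pDk/2) can repay; with the l^q
    norm the loss is as small as desired. The bound beta^m alone suffices for levels m >= k. At
    coarser levels the kernel oscillates inside a block, and the gain b^(-(k-m)p/2) supplies the
    missing factor because D <= 1. The gap D - D' is shared: one half pays for the sum over levels,
    the other for the number of frequencies. The copies of W are continuous on half-open intervals
    only, so their boundedness, needed for the convergence of Riemann sums, does not follow from
    compactness; it is transferred from W through the law on the countable set of grid points. *)

(** * Convexity inequalities for real powers *)

Section Convexity.
Variable R : realType.
Implicit Types (a u p : R).

(** Young's inequality for a and u^(p-1) with exponents p and p / (p - 1); it covers u = 0, where no
    derivative has to be taken. *)
Lemma powR_tangent a u p : 0 <= a -> 0 <= u -> 1 < p ->
  u `^ p + p * u `^ (p - 1) * (a - u) <= a `^ p.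
Proof.
move=> a0 u0 p1; have p0 : 0 < p by apply: lt_trans p1.
have q0 : 0 < p / (p - 1) by rewrite divr_gt0 ?subr_gt0.
have := conjugate_powR a0 (powR_ge0 u (p - 1)) p0 q0 _.
have p10 : p - 1 != 0 by rewrite subr_eq0 gt_eqF.
rewrite invf_div -powRrM.
have -> : (p - 1) * (p / (p - 1)) = p by field.
have -> : p^-1 + (p - 1) / p = 1 by field; rewrite gt_eqF.
move=> /(_ erefl) h.
have e : p * u `^ (p - 1) * u = p * u `^ p.
  by rewrite -mulrA [_ * u]mulrC mulr_powRB1.
rewrite mulrBr e.
have -> : a `^ p = p * (a `^ p / p) by rewrite mulrC divfK ?gt_eqF.
have : p * (u `^ (p - 1) * a) <= p * (a `^ p / p + u `^ p * ((p - 1) / p)).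
  by rewrite ler_pM2l// mulrC.
have -> : p * (a `^ p / p + u `^ p * ((p - 1) / p))
   = p * (a `^ p / p) + (p - 1) * u `^ p by field; rewrite gt_eqF.
rewrite !mulrA; lra.
Qed.

(** Jensen's inequality: the tangents at the mean are summed and their linear parts cancel. *)
Lemma powR_sum_le n (F : 'I_n -> R) p : (forall i, 0 <= F i) -> 1 < p ->
  (\sum_(i < n) F i) `^ p <= n%:R `^ (p - 1) * \sum_(i < n) F i `^ p.
Proof.
move=> F0 p1; case: n F F0 => [|n] F F0.
  by rewrite !big_ord0 mulr0 powR0// gt_eqF// (lt_trans _ p1).
have n0 : 0 < n.+1%:R :> R by rewrite ltr0n.
set S := \sum_(i < _) F i; have S0 : 0 <= S by apply: sumr_ge0.
pose u := S / n.+1%:R; have u0 : 0 <= u by rewrite divr_ge0// ltW.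
have : \sum_(i < n.+1) (u `^ p + p * u `^ (p - 1) * (F i - u))
    <= \sum_(i < n.+1) F i `^ p.
  by apply: ler_sum => i _; exact: powR_tangent.
rewrite big_split/= -mulr_sumr sumrB !sumr_const card_ord -/S.
have -> : u *+ n.+1 = S by rewrite -mulr_natr divfK ?gt_eqF.
rewrite subrr mulr0 addr0 => h.
have -> : S = u * n.+1%:R by rewrite divfK ?gt_eqF.
rewrite (powRM _ u0 (ltW n0)) -(mulr_powRB1 (ltW n0) (lt_trans ltr01 p1)).
rewrite mulrCA mulrA mulrC ler_wpM2l ?powR_ge0//.
by rewrite mulr_natl.
Qed.

(** Jensen's inequality at the points a / t and c / (1 - t) with weights t and 1 - t. The free
    weight lets the recursion for increments over the levels contract; equal weights would fail at p
    = 2 and b = 2. *)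
Lemma powR_add_le (a c p t : R) : 0 <= a -> 0 <= c -> 1 < p -> 0 < t -> t < 1 ->
  (a + c) `^ p <= t `^ (1 - p) * a `^ p + (1 - t) `^ (1 - p) * c `^ p.
Proof.
move=> a0 c0 p1 t0 t1; set u := a + c.
have u0 : 0 <= u by exact: addr_ge0.
have t10 : 0 < 1 - t by rewrite subr_gt0.
have aux (s x : R) : 0 < s -> 0 <= x ->
    s * (u `^ p + p * u `^ (p - 1) * (x / s - u)) <= s `^ (1 - p) * x `^ p.
  move=> s0 x0.
  have := powR_tangent (divr_ge0 x0 (ltW s0)) u0 p1.
  rewrite -(ler_pM2l s0) => /le_trans; apply.
  rewrite powRM ?invr_ge0 ?(ltW s0)// -powR_inv1 ?(ltW s0)// -powRrM.
  rewrite -{1}[s]powRr1 ?(ltW s0)// mulrCA -powRD ?(gt_eqF s0) ?implybT//.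
  by rewrite mulN1r mulrC.
apply: le_trans (lerD (aux t a t0 a0) (aux _ c t10 c0)).
rewrite le_eqVlt; apply/orP; left; apply/eqP.
have -> : t * (u `^ p + p * u `^ (p - 1) * (a / t - u)) +
  (1 - t) * (u `^ p + p * u `^ (p - 1) * (c / (1 - t) - u)) =
  u `^ p + p * u `^ (p - 1) * (a + c - u).
  by field; rewrite !gt_eqF.
by rewrite -/u subrr mulr0 addr0.
Qed.

End Convexity.

(** * The l^q norm of a finite family *)

Section LqNorm.
Variable R : realType.

Definition lqnorm (q n : nat) (x : 'I_n -> R) : R :=
  (\sum_(i < n) `|x i| ^+ q) `^ q%:R^-1.

Variables (q n : nat).
Hypothesis q0 : (0 < q)%N.
Implicit Types x y : 'I_n -> R.

Lemma lqnorm_ge0 x : 0 <= lqnorm q x. Proof. exact: powR_ge0. Qed.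

Lemma lqnormX x : lqnorm q x ^+ q = \sum_(i < n) `|x i| ^+ q.
Proof.
have S0 : 0 <= \sum_(i < n) `|x i| ^+ q by apply: sumr_ge0 => i _; rewrite exprn_ge0.
rewrite -powR_mulrn ?powR_ge0// -powRrM mulVf ?powRr1//.
by rewrite pnatr_eq0 -lt0n.
Qed.

Lemma ler_lqnorm x i : `|x i| <= lqnorm q x.
Proof.
rewrite -(ler_pXn2r q0) ?nnegrE ?lqnorm_ge0// lqnormX (bigD1 i)//=.
by rewrite lerDl sumr_ge0// => j _; rewrite exprn_ge0.
Qed.

Lemma lqnorm_eq0 x : lqnorm q x = 0 -> forall i, x i = 0.
Proof.
by move=> x0 i; apply/eqP; rewrite -normr_le0 -x0 ler_lqnorm.
Qed.

(** This is where the number of frequencies enters, with the exponent 1 / q that a large q makes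
    harmless. *)
Lemma lqnorm_le x (A : R) : (forall i, `|x i| <= A) ->
  lqnorm q x <= n%:R `^ q%:R^-1 * A.
Proof.
move=> xA; have qV0 : q%:R^-1 != 0 :> R by rewrite invr_eq0 pnatr_eq0 -lt0n.
have [n0|n0] := posnP n.
  rewrite /lqnorm big1 => [|[i i_lt] _]; last by exfalso; rewrite n0 in i_lt.
  by rewrite n0 !powR0// mul0r.
have A0 : 0 <= A by apply: le_trans (xA (Ordinal n0)).
rewrite -(ler_pXn2r q0) ?nnegrE ?lqnorm_ge0 ?mulr_ge0 ?powR_ge0//.
rewrite lqnormX exprMn -[(_ `^ _) ^+ q]powR_mulrn ?powR_ge0// -powRrM mulVf; last first.
  by rewrite pnatr_eq0 -lt0n.
rewrite powRr1 ?ler0n// mulr_natl -[in leRHS](card_ord n) -sumr_const.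
by apply: ler_sum => i _; rewrite lerXn2r ?nnegrE.
Qed.

(** After division by the two norms each term is at most u^q + v^q, since one of u and v is the
    larger; this costs the factor 2 against Hoelder's inequality. *)
Lemma lqnorm_pairing x y k : (0 < k < q)%N ->
  \sum_(i < n) `|x i| ^+ (q - k) * `|y i| ^+ k
    <= 2 * lqnorm q x ^+ (q - k) * lqnorm q y ^+ k.
Proof.
move=> /andP[k0 kq]; set a := lqnorm q x; set c := lqnorm q y.
have [a0|a0] := eqVneq a 0.
  rewrite big1 ?mulr_ge0 ?exprn_ge0 ?lqnorm_ge0// => i _.
  by rewrite (lqnorm_eq0 a0) normr0 expr0n subn_eq0 leqNgt kq mul0r.
have [c0|c0] := eqVneq c 0.
  rewrite big1 ?mulr_ge0 ?exprn_ge0 ?lqnorm_ge0// => i _.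
  by rewrite (lqnorm_eq0 c0) normr0 expr0n eqn0Ngt k0 mulr0.
have {}a0 : 0 < a by rewrite lt_neqAle eq_sym a0 lqnorm_ge0.
have {}c0 : 0 < c by rewrite lt_neqAle eq_sym c0 lqnorm_ge0.
have key (u v : R) : 0 <= u -> 0 <= v -> u ^+ (q - k) * v ^+ k <= u ^+ q + v ^+ q.
  move=> u0 v0; have [uv|vu] := leP u v.
    rewrite (le_trans (y := v ^+ q))// ?lerDr ?exprn_ge0//.
    rewrite -[in leRHS](subnK (ltnW kq)) exprD ler_wpM2r ?exprn_ge0//.
    by rewrite lerXn2r ?nnegrE.
  rewrite (le_trans (y := u ^+ q))// ?lerDl ?exprn_ge0//.
  rewrite -[in leRHS](subnK (ltnW kq)) exprD ler_wpM2l ?exprn_ge0//.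
  by rewrite lerXn2r ?nnegrE// ltW.
have -> : 2 * a ^+ (q - k) * c ^+ k =
  \sum_(i < n) a ^+ (q - k) * c ^+ k *
     ((`|x i| / a) ^+ q + (`|y i| / c) ^+ q).
  rewrite -mulr_sumr big_split/=.
  under eq_bigr do rewrite expr_div_n.
  under [X in _ + X]eq_bigr do rewrite expr_div_n.
  rewrite -!mulr_suml -!lqnormX -/a -/c !divff ?gt_eqF ?exprn_gt0//.
  by rewrite -mulrA mulrC.
apply: ler_sum => i _.
have -> : `|x i| ^+ (q - k) * `|y i| ^+ k =
   a ^+ (q - k) * c ^+ k * ((`|x i| / a) ^+ (q - k) * (`|y i| / c) ^+ k).
  rewrite !expr_div_n; field; by rewrite !gt_eqF ?exprn_gt0.
by rewrite ler_pM2l ?mulr_gt0 ?exprn_gt0// key// divr_ge0// ltW.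
Qed.

End LqNorm.

(** * p-smoothness of the l^q norm *)

Section Smoothness.
Variable R : realType.

(** A binomial term of order at least 2 in y is at most |y|^q if |x| <= |y|, and at most |x|^(q-2)
    |y|^2 otherwise; the coefficients add up to at most 2^q. *)
Lemma exprD_even_le (q : nat) (x y : R) : (1 < q)%N -> ~~ odd q ->
  (x + y) ^+ q <= x ^+ q + q%:R * (x ^+ q.-1 * y)
                  + 2 ^+ q * (`|x| ^+ (q - 2) * `|y| ^+ 2 + `|y| ^+ q).
Proof.
case: q => [//|[//|q]] _ _.
rewrite exprDn big_ord_recl big_ord_recl/= !subn0 !expr0 !mulr1 bin0 mulr1n.
rewrite /bump/= !add1n subSS subn0 expr1 bin1 -[X in _ + (X + _) <= _]mulr_natl.
rewrite addrA lerD2l !subSS subn0.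
set B := `|x| ^+ _ * `|y| ^+ 2 + _.
have B0 : 0 <= B.
  rewrite /B; apply: addr_ge0; first by apply: mulr_ge0; apply: exprn_ge0.
  by apply: exprn_ge0.
apply: (@le_trans _ _ (\sum_(i < q.+1) B *+ 'C(q.+2, i.+2))).
  apply: ler_sum => i _; rewrite !add1n; apply: ler_wMn2r.
  rewrite (le_trans (ler_norm _))// normrM !normrX.
  have iq : (i <= q)%N by rewrite -ltnS.
  rewrite !subSS; have [xy|yx] := leP `|x| `|y|.
    rewrite (le_trans (y := `|y| ^+ q.+2))// ?lerDr ?mulr_ge0 ?exprn_ge0//.
    have -> : q.+2 = ((q - i) + i.+2)%N by lia.
    by rewrite exprD ler_wpM2r ?exprn_ge0// lerXn2r ?nnegrE.
  rewrite (le_trans (y := `|x| ^+ q * `|y| ^+ 2))// ?lerDl ?exprn_ge0//.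
  have e : `|x| ^+ q = `|x| ^+ (q - i) * `|x| ^+ i by rewrite -exprD subnK.
  rewrite e -[i.+2](addn2 i) !exprD -mulrA ler_wpM2l ?exprn_ge0//.
  by rewrite ler_wpM2r ?exprn_ge0// lerXn2r ?nnegrE// ltW.
rewrite sumrMnr -[B in B *+ _]mulr1 -mulrnAr mulrC ler_wpM2r//.
rewrite -natrX ler_nat -[2%N in leqRHS]/(1 + 1)%N expnDn.
rewrite big_ord_recl big_ord_recl /=.
rewrite !addnA -[leqLHS]add0n leq_add//.
by apply: leq_sum => i _; rewrite !exp1n !muln1 /bump/= !add1n.
Qed.

(** The part 3 2^q serves when the norm c of y is at most the norm a of x. In the opposite case 20 =
    16 + 4 absorbs z^p <= 16 c^p and p L >= - 4 c^p. *)
Definition lqconst (q : nat) : R := 3 * 2 ^+ q + 20.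

(** Scalar core of [lqnorm_smooth]: [a], [c], [z] stand for the norms of x, y and x + y, and [p * L]
    for the first-order term. If c <= a, the expansion of z^q is turned into one of z^p by concavity
    of the power p / q; if a < c, the power c^p dominates everything. *)
Lemma smooth_power_le (q : nat) (p a c z L S : R) :
  (2 < q)%N -> 1 < p -> p <= 2 -> 0 <= a -> 0 <= c -> 0 <= z ->
  `|L| <= 2 * (a `^ (p - 1) * c) -> L = a `^ (p - q%:R) * S ->
  z ^+ q <= 2 ^+ q * (a ^+ q + c ^+ q) ->
  z ^+ q <= a ^+ q + q%:R * S + 2 ^+ q * (2 * a ^+ (q - 2) * c ^+ 2 + c ^+ q) ->
  z `^ p <= a `^ p + p * L + lqconst q * c `^ p.
Proof.
move=> q3 p1 p2 a0 c0 z0 HL LS zq2 zq3.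
have q0 : (0 < q)%N by exact: ltn_trans q3.
have p0 : 0 < p by apply: lt_trans p1.
have q2 : 2 < q%:R :> R by rewrite ltr_nat.
have pq : p < q%:R by apply: le_lt_trans q2.
have [ac|ca] := ltP a c.
  have Lc : `|L| <= 2 * c `^ p.
    apply: le_trans HL _; rewrite ler_pM2l//.
    rewrite -(mulr_powRB1 c0 p0) mulrC ler_wpM2l//.
    by apply: ge0_ler_powR; rewrite ?nnegrE// ?subr_ge0 ltW.
  have pL : - (4 * c `^ p) <= p * L.
    have : `|p * L| <= 4 * c `^ p.
      rewrite normrM (gtr0_norm p0) (_ : 4 * _ = 2 * (2 * c `^ p)); last by ring.
      exact: ler_pM (ltW p0) (normr_ge0 _) p2 Lc.
    by rewrite ler_norml => /andP[].
  have zc : z <= 4 * c.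
    rewrite -(ler_pXn2r q0) ?nnegrE ?mulr_ge0//; apply: le_trans zq2 _.
    rewrite (_ : 4 * c = 2 * (2 * c)); last by ring.
    rewrite [leRHS]exprMn ler_wpM2l ?exprn_ge0// exprMn.
    rewrite (le_trans (y := 2 * c ^+ q))//.
      by rewrite mulr_natl mulr2n lerD2r lerXn2r ?nnegrE// ltW.
    by rewrite ler_wpM2r ?exprn_ge0// ler_eXnr// ler1n.
  have zp : z `^ p <= 16 * c `^ p.
    apply: (@le_trans _ _ ((4 * c) `^ p)).
      by rewrite ge0_ler_powR ?nnegrE ?mulr_ge0// ltW.
    rewrite powRM// ler_wpM2r ?powR_ge0// (le_trans (y := 4 `^ 2%:R))//.
      by rewrite ler_powR// ler1n.
    by rewrite powR_mulrn//; lra.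
  have a_p : 0 <= a `^ p by exact: powR_ge0.
  have c_p : 0 <= 3 * 2 ^+ q * c `^ p by rewrite !mulr_ge0 ?powR_ge0 ?exprn_ge0.
  rewrite /lqconst; lra.
have [a_eq0|a_neq0] := eqVneq a 0.
  have c_eq0 : c = 0 by apply/eqP; rewrite eq_le c0 andbT -a_eq0.
  have z_eq0 : z = 0.
    have : z ^+ q == 0.
      rewrite eq_le exprn_ge0// andbT; move: zq2.
      by rewrite a_eq0 c_eq0 !expr0n eqn0Ngt q0 addr0 mulr0.
    by rewrite expf_eq0 q0 => /eqP.
  have L_eq0 : L = 0.
    by apply/eqP; rewrite -normr_le0; move: HL; rewrite c_eq0 !mulr0.
  by rewrite z_eq0 a_eq0 c_eq0 L_eq0 powR0 ?gt_eqF// !mulr0 !addr0.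
have {}a_neq0 : 0 < a by rewrite lt_neqAle eq_sym a_neq0.
(* As c <= a, c^q <= a^(q-2) c^2 and the two remainders merge. *)
have zq : z ^+ q <= a ^+ q + q%:R * S + 3 * 2 ^+ q * (a ^+ (q - 2) * c ^+ 2).
  apply: le_trans zq3 _; rewrite lerD2l.
  have -> : 3 * 2 ^+ q * (a ^+ (q - 2) * c ^+ 2) =
     2 ^+ q * (2 * a ^+ (q - 2) * c ^+ 2 + a ^+ (q - 2) * c ^+ 2) by ring.
  rewrite ler_pM2l ?exprn_gt0// lerD2l -{1}(@subnK 2 q)// ?(ltnW q3)// exprD.
  by rewrite ler_wpM2r ?exprn_ge0// lerXn2r ?nnegrE.
have q_gt0 : 0 < q%:R :> R by rewrite ltr0n.
have qp0 : 0 < q%:R - p by rewrite subr_gt0.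
(* Young's inequality with exponents q/p and q/(q-p) *)
have young : z `^ p * a `^ (q%:R - p) <=
    p / q%:R * z ^+ q + (1 - p / q%:R) * a ^+ q.
  have := @conjugate_powR _ (z `^ p) (a `^ (q%:R - p)) (q%:R / p)
    (q%:R / (q%:R - p)) (powR_ge0 _ _) (powR_ge0 _ _) _ _ _.
  rewrite !divr_gt0//.
  rewrite !invf_div -mulrDl addrC subrK divff ?gt_eqF// => /(_ isT isT erefl).
  rewrite -!powRrM.
  have -> : p * (q%:R / p) = q%:R by field; rewrite gt_eqF.
  have -> : (q%:R - p) * (q%:R / (q%:R - p)) = q%:R by field; rewrite gt_eqF.
  rewrite !powR_mulrn// => /le_trans; apply.
  rewrite le_eqVlt; apply/orP; left; apply/eqP.
  by field; rewrite gt_eqF.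
have aqp : 0 < a `^ (q%:R - p) by rewrite powR_gt0.
have apE : a `^ p * a `^ (q%:R - p) = a ^+ q.
  by rewrite -powRD ?(gt_eqF a_neq0) ?implybT// addrC subrK powR_mulrn.
have LE : L * a `^ (q%:R - p) = S.
  rewrite LS mulrAC -powRD ?(gt_eqF a_neq0) ?implybT//.
  by rewrite -(opprB q%:R p) addNr powRr0 mul1r.
(* As p <= 2 and c <= a, c^(2-p) <= a^(2-p). *)
have rest : a ^+ (q - 2) * c ^+ 2 <= c `^ p * a `^ (q%:R - p).
  have [c_eq0|c_neq0] := eqVneq c 0.
    by rewrite c_eq0 expr0n mulr0 mulr_ge0 ?powR_ge0.
  have {}c_neq0 : 0 < c by rewrite lt_neqAle eq_sym c_neq0.
  rewrite -!powR_mulrn// natrB ?(ltnW q3)//.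
  have -> : q%:R - p = (q%:R - 2%:R) + (2%:R - p) by ring.
  rewrite (@powRD _ a (q%:R - 2%:R)) ?(gt_eqF a_neq0) ?implybT// mulrCA ler_wpM2l ?powR_ge0//.
  have {1}-> : 2%:R = p + (2%:R - p) by ring.
  rewrite (@powRD _ c p) ?(gt_eqF c_neq0) ?implybT// ler_wpM2l ?powR_ge0//.
  by rewrite ge0_ler_powR ?nnegrE ?subr_ge0.
rewrite -(ler_pM2r aqp); apply: le_trans young _.
apply: (@le_trans _ _ (p / q%:R * (a ^+ q + q%:R * S +
    3 * 2 ^+ q * (a ^+ (q - 2) * c ^+ 2)) + (1 - p / q%:R) * a ^+ q)).
  by rewrite lerD2r ler_wpM2l// divr_ge0// ltW.
have -> : p / q%:R * (a ^+ q + q%:R * S +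
    3 * 2 ^+ q * (a ^+ (q - 2) * c ^+ 2)) + (1 - p / q%:R) * a ^+ q =
  a ^+ q + p * S + p / q%:R * (3 * 2 ^+ q * (a ^+ (q - 2) * c ^+ 2)).
  by field; rewrite gt_eqF.
have -> : (a `^ p + p * L + lqconst q * c `^ p) * a `^ (q%:R - p) =
    a `^ p * a `^ (q%:R - p) + p * (L * a `^ (q%:R - p))
    + lqconst q * (c `^ p * a `^ (q%:R - p)) by ring.
rewrite apE LE lerD2l.
apply: (@le_trans _ _ (1 * (3 * 2 ^+ q * (c `^ p * a `^ (q%:R - p))))).
  apply: ler_pM.
  - by rewrite divr_ge0// ltW.
  - by rewrite mulr_ge0// mulr_ge0 ?exprn_ge0.
  - by rewrite ltW// ltr_pdivrMr// mul1r.
  - by rewrite ler_pM2l// mulr_gt0// exprn_gt0.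
rewrite mul1r ler_wpM2r ?mulr_ge0 ?powR_ge0//.
by rewrite /lqconst lerDl.
Qed.

Variables (q n : nat).
Hypotheses (q3 : (2 < q)%N) (qeven : ~~ odd q).
Implicit Types x y : 'I_n -> R.

Let q0 : (0 < q)%N. Proof. exact: ltn_trans q3. Qed.

(** For even q, the gradient of the p-th power of the l^q norm, divided by p; it is 0 at x = 0,
    where 0 to the power p - q is 0. *)
Definition lqgrad (p : R) x (i : 'I_n) : R :=
  lqnorm q x `^ (p - q%:R) * x i ^+ q.-1.

Lemma lqnormD_le x y : lqnorm q (x \+ y) ^+ q <= lqnorm q x ^+ q
    + q%:R * (\sum_(i < n) x i ^+ q.-1 * y i)
    + 2 ^+ q * (2 * lqnorm q x ^+ (q - 2) * lqnorm q y ^+ 2 + lqnorm q y ^+ q).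
Proof.
rewrite !lqnormX// mulr_sumr -big_split/=.
apply: (@le_trans _ _ (\sum_(i < n) (x i ^+ q + q%:R * (x i ^+ q.-1 * y i)
                  + 2 ^+ q * (`|x i| ^+ (q - 2) * `|y i| ^+ 2 + `|y i| ^+ q)))).
  apply: ler_sum => i _; rewrite -normrX ger0_norm ?exprn_even_ge0//.
  by apply: exprD_even_le => //; apply: ltn_trans q3.
rewrite big_split/= lerD//.
  apply: ler_sum => i _; rewrite -normrX [in leRHS]ger0_norm ?exprn_even_ge0//.
rewrite -mulr_sumr big_split/= ler_wpM2l ?exprn_ge0// lerD2r.
by apply: lqnorm_pairing => //; rewrite q3.
Qed.

Lemma lqgrad_pairing p x y : 1 < p -> p <= 2 ->
  `|\sum_(i < n) lqgrad p x i * y i| <= 2 * (lqnorm q x `^ (p - 1) * lqnorm q y).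
Proof.
move=> p1 p2; rewrite /lqgrad.
under eq_bigr do rewrite -mulrA.
rewrite -mulr_sumr normrM (ger0_norm (powR_ge0 _ _)).
have [a0|a0] := eqVneq (lqnorm q x) 0.
  rewrite a0 powR0 ?mul0r ?mulr_ge0 ?powR_ge0 ?lqnorm_ge0//.
  rewrite subr_eq0 lt_eqF// (le_lt_trans p2)// ltr_nat//.
have -> : p - 1 = (p - q%:R) + (q - 1)%:R by rewrite natrB//; ring.
rewrite (@powRD _ _ (p - q%:R)) ?a0 ?implybT// powR_mulrn ?lqnorm_ge0//.
rewrite mulrCA -!mulrA ler_wpM2l ?powR_ge0// mulrA.
have q1 : (0 < 1 < q)%N by rewrite /= (ltn_trans _ q3).
rewrite [_ * 2]mulrC.
apply: le_trans (lqnorm_pairing q0 x y q1).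
apply: le_trans (ler_norm_sum _ _ _) _.
by apply: ler_sum => i _; rewrite normrM normrX subn1 expr1.
Qed.

(* The space l^q is p-smooth for p <= 2 < q: the l^q-norm to the power p
   admits a first-order expansion with remainder of order |y|^p. *)
Lemma lqnorm_smooth p x y : 1 < p -> p <= 2 ->
  lqnorm q (x \+ y) `^ p <= lqnorm q x `^ p
    + p * (\sum_(i < n) lqgrad p x i * y i) + lqconst q * lqnorm q y `^ p.
Proof.
move=> p1 p2; apply: (@smooth_power_le q p _ _ _ _ (\sum_(i < n) x i ^+ q.-1 * y i));
  rewrite ?lqnorm_ge0//.
- exact: lqgrad_pairing.
- by rewrite mulr_sumr; apply: eq_bigr => i _; rewrite /lqgrad mulrA.
- rewrite !lqnormX// -big_split mulr_sumr; apply: ler_sum => i _ /=.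
  rewrite (le_trans (y := (2 * Num.max `|x i| `|y i|) ^+ q))//.
    rewrite lerXn2r ?nnegrE ?mulr_ge0 ?le_max ?normr_ge0//.
    rewrite (le_trans (ler_normD _ _))// mulr_natl mulr2n.
    by rewrite lerD// le_max lexx ?orbT.
  rewrite exprMn ler_wpM2l ?exprn_ge0//.
  by rewrite maxEle; case: ifP => _; rewrite ?lerDr ?lerDl; apply: exprn_ge0.
- exact: lqnormD_le.
Qed.

End Smoothness.

(** * Oscillatory sums and variation *)

Section Oscillation.
Variable R : realType.

(** What a summation by parts over a shift of h points leaves: the h-increments of g inside and h
    values at each end. *)
Definition variation_bound (L h : nat) (g : nat -> R) : R :=
  \sum_(j < L - h) `|g j - g (j + h)%N| + \sum_(j < h) `|g j|
  + \sum_(j < h) `|g (L - h + j)%N|.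

Lemma shifted_sum_le (L h : nat) (g c : nat -> R) : (h <= L)%N ->
  (forall j, `|c j| <= 1) ->
  `|\sum_(j < L) g j * c (j + h)%N - \sum_(j < L) g j * c j|
    <= variation_bound L h g.
Proof.
move=> hL c1.
have e1 : \sum_(j < L) g j * c (j + h)%N =
    \sum_(j < L - h) g j * c (j + h)%N
    + \sum_(j < h) g (L - h + j)%N * c (L - h + j + h)%N.
  by rewrite -(big_mkord xpredT (fun j => g j * c (j + h)%N))
     -(subnK hL) big_mkord big_split_ord/= addnK.
have e2 : \sum_(j < L) g j * c j =
    \sum_(j < h) g j * c j + \sum_(j < L - h) g (j + h)%N * c (j + h)%N.
  rewrite -(big_mkord xpredT (fun j => g j * c j)) -{1}(subnKC hL) big_mkord.
  by rewrite big_split_ord/=; congr (_ + _); apply: eq_bigr => i _; rewrite addnC.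
rewrite e1 e2.
have -> : forall A B C D : R, A + B - (C + D) = (A - D) - C + B by move=> *; ring.
have term (i : nat) (u : R) : `|u * c i| <= `|u|.
  by rewrite normrM ler_piMr// c1.
rewrite -sumrB /variation_bound.
rewrite (le_trans (ler_normD _ _))// lerD//; last first.
  by rewrite (le_trans (ler_norm_sum _ _ _))// ler_sum.
rewrite (le_trans (ler_normB _ _))// lerD//; last first.
  by rewrite (le_trans (ler_norm_sum _ _ _))// ler_sum.
rewrite (le_trans (ler_norm_sum _ _ _))// ler_sum// => i _.
by rewrite -mulrBl term.
Qed.

(* The sums T shifted by h satisfy T_0 + T_2h = 2 cos(phi) T_h, where phi is
   the phase increment over h points, while T_0, T_h and T_2h differ by the
   variation of g: this bounds T_h unless cos(phi) is close to 1. *)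
Lemma oscillatory_sum_le (L h : nat) (g : nat -> R) (theta delta : R) :
  (h <= L)%N ->
  (1 - cos (h%:R * delta)) * `|\sum_(j < L) g j * cos (theta + j%:R * delta)|
    <= variation_bound L h g.
Proof.
move=> hL; set phi := h%:R * delta.
pose T (a : R) := \sum_(j < L) g j * cos (a + j%:R * delta).
have shift (a : R) : `|T (a + phi) - T a| <= variation_bound L h g.
  have := @shifted_sum_le L h g (fun j => cos (a + j%:R * delta)) hL _.
  rewrite /T; under eq_bigr do rewrite natrD mulrDl addrA addrAC.
  apply => j; exact: cos_max.
have -> : theta = (theta - phi) + phi by rewrite subrK.
rewrite -/(T _); set a := theta - phi.
have three : T (a + phi + phi) + T a = 2 * cos phi * T (a + phi).
  rewrite /T -big_split mulr_sumr; apply: eq_bigr => i _ /=.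
  have -> : a + phi + phi + i%:R * delta = (a + phi + i%:R * delta) + phi by ring.
  have -> : a + i%:R * delta = (a + phi + i%:R * delta) - phi by ring.
  rewrite cosD cosB; ring.
have cos1 : 0 <= 1 - cos phi by rewrite subr_ge0 cos_le1.
rewrite -{1}(ger0_norm cos1) -normrM.
have -> : (1 - cos phi) * T (a + phi) =
    2^-1 * ((T (a + phi) - T a) - (T (a + phi + phi) - T (a + phi))).
  by have -> : T (a + phi + phi) = 2 * cos phi * T (a + phi) - T a;
    [rewrite -three addrK | field].
rewrite normrM gtr0_norm ?invr_gt0//.
have := le_trans (ler_normB _ _) (lerD (shift a) (shift (a + phi))); lra.
Qed.

End Oscillation.

(** * Means of products of independent variables *)

Section IndependentVariables.
Context d (T : measurableType d) (R : realType) (P : probability T R).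
Implicit Types X Y : T -> R.

Definition indep_rv X Y := forall A B : set R, measurable A -> measurable B ->
  (P (X @^-1` A `&` Y @^-1` B) = P (X @^-1` A) * P (Y @^-1` B))%E.

Lemma indep_rv_comp X Y (f g : R -> R) :
  measurable_fun setT f -> measurable_fun setT g ->
  indep_rv X Y -> indep_rv (f \o X) (g \o Y).
Proof.
move=> mf mg XY A B mA mB; apply: (XY (f @^-1` A) (g @^-1` B)).
  by rewrite -[_ @^-1` _]setTI; exact: mf.
by rewrite -[_ @^-1` _]setTI; exact: mg.
Qed.

(** The law of the pair is the product of the two laws, as they agree on rectangles, and Tonelli's
    theorem splits the integral. *)
Lemma ge0_integral_indepM X Y :
  measurable_fun setT X -> measurable_fun setT Y ->
  (forall w, 0 <= X w) -> (forall w, 0 <= Y w) -> indep_rv X Y ->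
  (\int[P]_w (X w * Y w)%:E = \int[P]_w (X w)%:E * \int[P]_w (Y w)%:E)%E.
Proof.
move=> mX mY X0 Y0 XY.
pose X' : {mfun T >-> R} := HB.pack X (isMeasurableFun.Build _ _ _ _ X mX).
pose Y' : {mfun T >-> R} := HB.pack Y (isMeasurableFun.Build _ _ _ _ Y mY).
have mXY : measurable_fun setT (fun w => (X w, Y w)).
  exact: measurable_fun_pair.
pose XY' : {mfun T >-> (R * R)%type} :=
  HB.pack (fun w => (X w, Y w)) (isMeasurableFun.Build _ _ _ _ _ mXY).
(* Positive parts make the integrand non-negative on the whole plane and do not change it on the
   values of X and Y. *)
pose pos (x : R) : R := Num.max x 0.
have pos0 x : 0 <= pos x by rewrite /pos le_max lexx orbT.
have mpos : measurable_fun setT pos by exact: measurable_funrpos.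
have posX w : pos (X w) = X w by apply/max_idPl.
have posY w : pos (Y w) = Y w by apply/max_idPl.
pose h (z : R * R) := (pos z.1 * pos z.2)%:E.
have mh : measurable_fun setT h.
  apply/measurable_EFinP/measurable_funM.
    by apply: measurableT_comp => //; exact: measurable_fst.
  by apply: measurableT_comp => //; exact: measurable_snd.
have h0 z : (0 <= h z)%E by rewrite lee_fin mulr_ge0.
transitivity (\int[distribution P XY']_z h z)%E.
  rewrite ge0_integral_distribution//.
  by apply: eq_integral => w _; rewrite /h /= posX posY.
transitivity (\int[(distribution P X') \x (distribution P Y')]_z h z)%E.
  apply: eq_measure_integral => A mA _.
  by apply/esym; apply: product_measure_unique => // B C mB mC; exact: XY.
rewrite fubini_tonelli1// /fubini_F /h /=.
have mposE : measurable_fun setT (EFin \o pos) by exact/measurable_EFinP.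
have posE0 x : (0 <= (EFin \o pos) x)%E by rewrite lee_fin.
transitivity (\int[distribution P X']_x
    ((pos x)%:E * \int[distribution P Y']_y (pos y)%:E))%E.
  apply: eq_integral => x _; rewrite /fubini_F /h /=.
  under eq_integral do rewrite EFinM.
  by apply: ge0_integralZl_EFin => // y _; exact: posE0.
rewrite ge0_integralZr//; first last.
- by apply: integral_ge0 => y _; exact: posE0.
- by move=> x _; exact: posE0.
rewrite (ge0_integral_distribution X' mposE posE0) (ge0_integral_distribution Y' mposE posE0).
by congr (_ * _)%E; apply: eq_integral => w _ /=; rewrite ?posX ?posY.
Qed.

(** Integrability is part of the notion, so that means can be added and subtracted without side
    conditions. *)
Definition has_mean X (r : R) :=
  P.-integrable setT (EFin \o X) /\ (\int[P]_w (X w)%:E = r%:E)%E.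

Lemma integrable_has_mean X : P.-integrable setT (EFin \o X) ->
  exists r, has_mean X r.
Proof.
move=> iX; exists (fine (\int[P]_w (X w)%:E)); split=> //.
by rewrite fineK//; exact: integrable_fin_num iX.
Qed.

Lemma has_mean_measurable X r : has_mean X r -> measurable_fun setT X.
Proof. by move=> [/measurable_int/measurable_EFinP]. Qed.

Lemma has_meanZ (k r : R) X : has_mean X r -> has_mean (fun w => k * X w) (k * r).
Proof.
move=> [iX X0]; split.
  have -> : EFin \o (fun w => k * X w) = (fun w => k%:E * (EFin \o X) w)%E.
    by apply/funext => w.
  exact: integrableZl.
by under eq_integral do rewrite EFinM; rewrite integralZl// X0.
Qed.

Lemma has_meanD X Y r s : has_mean X r -> has_mean Y s ->
  has_mean (fun w => X w + Y w) (r + s).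
Proof.
move=> [iX Xr] [iY Ys]; split.
  have -> : EFin \o (fun w => X w + Y w) = ((EFin \o X) \+ (EFin \o Y))%E.
    by apply/funext => w.
  exact: integrableD.
by under eq_integral do rewrite EFinD; rewrite integralD// Xr Ys.
Qed.

Lemma has_meanB X Y r s : has_mean X r -> has_mean Y s ->
  has_mean (fun w => X w - Y w) (r - s).
Proof.
move=> hX /(has_meanZ (-1)) hY; have := has_meanD hX hY.
by under eq_fun do rewrite mulN1r; rewrite mulN1r.
Qed.

Lemma has_mean_sum n (X : 'I_n -> T -> R) (r : 'I_n -> R) :
  (forall i, has_mean (X i) (r i)) ->
  has_mean (fun w => \sum_(i < n) X i w) (\sum_(i < n) r i).
Proof.
elim: n X r => [X r _|n IH X r h].
  under eq_fun do rewrite big_ord0.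
  rewrite big_ord0; split; first exact: integrable0.
  by rewrite integral0_eq.
under eq_fun do rewrite big_ord_recl.
rewrite big_ord_recl; apply: has_meanD => //.
exact: (IH (fun i => X (lift ord0 i))).
Qed.

Lemma has_meanM_ge0 X Y r s : (forall w, 0 <= X w) -> (forall w, 0 <= Y w) ->
  indep_rv X Y -> has_mean X r -> has_mean Y s ->
  has_mean (fun w => X w * Y w) (r * s).
Proof.
move=> X0 Y0 XY hX hY.
have mX := has_mean_measurable hX; have mY := has_mean_measurable hY.
have E : (\int[P]_w (X w * Y w)%:E = (r * s)%:E)%E.
  by rewrite ge0_integral_indepM// hX.2 hY.2.
split=> //; apply/integrableP; split.
  by apply/measurable_EFinP; exact: measurable_funM.
under eq_integral => w _ do rewrite /= ger0_norm ?mulr_ge0//.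
by rewrite E ltry.
Qed.

(** The non-negative case is applied to the four products of positive and negative parts. *)
Lemma has_meanM X Y r s : indep_rv X Y -> has_mean X r -> has_mean Y s ->
  has_mean (fun w => X w * Y w) (r * s).
Proof.
move=> XY hX hY.
have mX := has_mean_measurable hX; have mY := has_mean_measurable hY.
pose pos (x : R) : R := Num.max x 0; pose neg (x : R) : R := Num.max (- x) 0.
have pos0 x : 0 <= pos x by rewrite /pos le_max lexx orbT.
have neg0 x : 0 <= neg x by rewrite /neg le_max lexx orbT.
have posneg x : pos x - neg x = x.
  by rewrite /pos /neg; have [x0|x0] := leP x 0; rewrite maxEge oppr_ge0;
    case: ifP => h; lra.
have mpos : measurable_fun setT pos by exact: measurable_funrpos.
have mneg : measurable_fun setT neg by exact: measurable_funrneg.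
have ipos Z t : has_mean Z t -> P.-integrable setT (EFin \o (pos \o Z)).
  by move=> [iZ _]; exact: (integrable_funrpos _ iZ).
have ineg Z t : has_mean Z t -> P.-integrable setT (EFin \o (neg \o Z)).
  by move=> [iZ _]; exact: (integrable_funrneg _ iZ).
have [x1 hx1] := integrable_has_mean (ipos _ _ hX).
have [x2 hx2] := integrable_has_mean (ineg _ _ hX).
have [y1 hy1] := integrable_has_mean (ipos _ _ hY).
have [y2 hy2] := integrable_has_mean (ineg _ _ hY).
have uniq Z t t' : has_mean Z t -> has_mean Z t' -> t = t'.
  by move=> [_ e] [_ e']; apply: EFin_inj; rewrite -e -e'.
have posnegE Z : (fun w => (pos \o Z) w - (neg \o Z) w) = Z.
  by apply/funext => w; exact: posneg.
have -> : r = x1 - x2.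
  by apply: uniq (has_meanB hx1 hx2); rewrite posnegE.
have -> : s = y1 - y2.
  by apply: uniq (has_meanB hy1 hy2); rewrite posnegE.
have h11 := has_meanM_ge0 (fun w => pos0 (X w)) (fun w => pos0 (Y w))
  (indep_rv_comp mpos mpos XY) hx1 hy1.
have h12 := has_meanM_ge0 (fun w => pos0 (X w)) (fun w => neg0 (Y w))
  (indep_rv_comp mpos mneg XY) hx1 hy2.
have h21 := has_meanM_ge0 (fun w => neg0 (X w)) (fun w => pos0 (Y w))
  (indep_rv_comp mneg mpos XY) hx2 hy1.
have h22 := has_meanM_ge0 (fun w => neg0 (X w)) (fun w => neg0 (Y w))
  (indep_rv_comp mneg mneg XY) hx2 hy2.
have := has_meanD (has_meanB h11 h12) (has_meanB h22 h21).
rewrite (_ : _ + _ = (x1 - x2) * (y1 - y2)); last by ring.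
congr (has_mean _ _); apply/funext => w /=.
by rewrite -[X w in RHS]posneg -[Y w in RHS]posneg; ring.
Qed.

(* Y is allowed to take negative values, on a negligible set. *)
Lemma indep_centered X Y :
  P.-integrable setT (EFin \o X) -> has_mean Y 1 -> indep_rv X Y ->
  has_mean (fun w => X w * (Y w - 1)) 0.
Proof.
move=> /integrable_has_mean[r hX] hY XY.
have := has_meanB (has_meanM XY hX hY) hX.
rewrite mulr1 subrr; congr (has_mean _ _); apply/funext => w; ring.
Qed.

End IndependentVariables.

(** * Independence of one sigma-algebra from all the others *)

Section SigmaAlgebraIndependence.
Context d (T : measurableType d) (R : realType) (P : probability T R).
Context (I : eqType) (F : I -> set (set T)).
Hypothesis Fsig : forall i, sigma_algebra setT (F i).
Hypothesis Fmeas : forall i, F i `<=` measurable.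
Hypothesis Find : mutually_independent P F.

(** A union of sigma-algebras, used as a family of generators: what it generates carries all the
    information except that of index [i0]. *)
Definition sigma_others (i0 : I) : set (set T) :=
  \bigcup_(i in [set i | i != i0]) F i.

Let cylinders (i0 : I) : set (set T) :=
  [set E | exists s : seq I, exists D : I -> set T,
     [/\ i0 \notin s, uniq s, forall i, F i (D i)
       & E = \big[setI/setT]_(i <- s) D i]].

Let FT i : F i setT.
Proof. by case: (Fsig i) => F0 FD _; rewrite -(setD0 setT); exact: FD. Qed.

Let FI i A B : F i A -> F i B -> F i (A `&` B).
Proof.
by have := @measurableI _ (g_sigma_algebraType (F i)) A B;
  rewrite /measurable/= !sigma_algebra_id.
Qed.

Let bigI (s : seq I) (D : I -> set T) w :
  (\big[setI/setT]_(i <- s) D i) w <-> forall i, i \in s -> D i w.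
Proof.
elim: s => [|i s IH]; first by rewrite big_nil.
rewrite big_cons; split=> [[Di /IH Ds] j|Ds].
  by rewrite inE => /predU1P[->//|]; exact: Ds.
split; first by apply: Ds; rewrite mem_head.
by apply/IH => j js; apply: Ds; rewrite inE js orbT.
Qed.

(** Uniqueness of measures on a pi-system: the restriction of P to A and the multiple of P by P A
    are finite measures which agree on [cylinders] by mutual independence, and E lies in the
    sigma-algebra that these generate. *)
Lemma indep_sigma_others (i0 : I) (A E : set T) :
  F i0 A -> <<s sigma_others i0 >> E -> (P (A `&` E) = P A * P E)%E.
Proof.
move=> FA sE.
have mA : measurable A by exact: Fmeas FA.
have mcyl : cylinders i0 `<=` measurable.
  move=> _ [s [D [_ _ FD ->]]]; apply: bigsetI_measurable => i _.
  exact: Fmeas (FD i).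
have PA : P A = (fine (P A))%:E by rewrite fineK// fin_num_measure.
pose c : {nonneg R} := NngNum (fine_ge0 (measure_ge0 P A)).
have cE B : mscale c P B = (P A * P B)%E by rewrite [in RHS]PA.
suff : mrestr P mA E = mscale c P E.
  by rewrite /mrestr setIC => ->; exact: cE.
apply: (@g_sigma_algebra_measure_unique _ _ _ (cylinders i0) mcyl (fun=> setT)).
- by move=> _; exists [::], (fun=> setT); split => //; rewrite big_nil.
- by rewrite bigcup_const//; exists 0%N.
- move=> _ _ [s [D [si us FD ->]]] [t [D' [ti ut FD' ->]]].
  (* An index that occurs in only one of the two lists receives the factor [setT] from the other. *)
  exists (undup (s ++ t)).
  exists (fun i => (if i \in s then D i else setT) `&` (if i \in t then D' i else setT)).
  split.
  + by rewrite mem_undup mem_cat negb_or si.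
  + exact: undup_uniq.
  + by move=> i; apply: FI; case: ifP.
  + apply/seteqP; split => w.
      move=> [/bigI h1 /bigI h2]; apply/bigI => i _; split; case: ifP => // ?.
        exact: h1.
      exact: h2.
    move=> /bigI h; split; apply/bigI => i is_.
      by have /h [] : i \in undup (s ++ t); rewrite ?is_// mem_undup mem_cat is_.
    by have /h [] : i \in undup (s ++ t); rewrite ?is_// mem_undup mem_cat is_ orbT.
- move=> _ [s [D [si us FD ->]]]; apply: etrans (esym (cE _)).
  (* With A placed at index [i0], the intersection of A and the cylinder is a single product over
     [i0 :: s]. *)
  pose D0 i := if i == i0 then A else D i.
  have FD0 i : F i (D0 i) by rewrite /D0; case: eqP => [->|].
  have e : \big[setI/setT]_(i <- s) D i = \big[setI/setT]_(i <- s) D0 i.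
    apply: eq_big_seq => i is_; rewrite /D0; case: eqP => // ii.
    by move: si; rewrite -ii is_.
  have e0 : D0 i0 = A by rewrite /D0 eqxx.
  have us0 : uniq (i0 :: s) by rewrite /= si.
  have := Find us0 (fun i _ => FD0 i).
  rewrite !big_cons e0 -(Find us (fun i _ => FD0 i)) -e setIC; exact.
- by move=> _; rewrite (le_lt_trans (probability_le1 _ _)) ?ltry// /mrestr setTI.
- move: E sE; apply: smallest_sub; first exact: smallest_sigma_algebra.
  move=> E [i ii0 FE]; apply: sub_sigma_algebra.
  exists [:: i], (fun j => if j == i then E else setT); split => //.
  + by rewrite inE eq_sym.
  + by move=> j; case: eqP => [->|].
  + by rewrite big_seq1 eqxx.
Qed.

End SigmaAlgebraIndependence.

(** * Moment bounds and martingales with values in l^q *)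

Section MeasurableLqNorm.
Context d (T : measurableType d) (R : realType).

Lemma measurable_fun_powR (f : T -> R) (p : R) : measurable_fun setT f ->
  measurable_fun setT (fun w => f w `^ p).
Proof. by move=> mf; exact: (measurableT_comp (measurable_powR p) mf). Qed.

Lemma measurable_lqnorm q n (X : 'I_n -> T -> R) :
  (forall i, measurable_fun setT (X i)) ->
  measurable_fun setT (fun w => lqnorm q (X ^~ w)).
Proof.
move=> mX; rewrite /lqnorm; apply: measurable_fun_powR.
apply: measurable_sum => i.
apply: measurable_funX; exact: measurableT_comp.
Qed.

Lemma measurable_lqgrad q n p (X : 'I_n -> T -> R) i :
  (forall i, measurable_fun setT (X i)) ->
  measurable_fun setT (fun w => lqgrad q p (X ^~ w) i).
Proof.
move=> mX; rewrite /lqgrad; apply: measurable_funM.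
  by apply: measurable_fun_powR; exact: measurable_lqnorm.
exact: measurable_funX.
Qed.

End MeasurableLqNorm.

Section Moments.
Context d (T : measurableType d) (R : realType) (P : probability T R).

Lemma ge0_has_mean (X : T -> R) (B : R) : measurable_fun setT X ->
  (forall w, 0 <= X w) -> (\int[P]_w (X w)%:E <= B%:E)%E ->
  exists2 r, has_mean P X r & 0 <= r <= B.
Proof.
move=> mX X0 XB.
have i0 : (0 <= \int[P]_w (X w)%:E)%E by apply: integral_ge0 => w _; rewrite lee_fin.
have fin : (\int[P]_w (X w)%:E \is a fin_num)%E.
  by rewrite ge0_fin_numE// (le_lt_trans XB)// ltry.
exists (fine (\int[P]_w (X w)%:E)).
  split; last by rewrite fineK.
  apply/integrableP; split; first exact/measurable_EFinP.
  under eq_integral do rewrite /= ger0_norm//.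
  by rewrite (le_lt_trans XB)// ltry.
by apply/andP; split; [exact: fine_ge0|rewrite -lee_fin fineK].
Qed.

Lemma has_mean_le (X Y : T -> R) (r : R) : measurable_fun setT X ->
  (forall w, 0 <= X w) -> (forall w, X w <= Y w) -> has_mean P Y r ->
  (\int[P]_w (X w)%:E <= r%:E)%E.
Proof.
move=> mX X0 XY hY; rewrite -hY.2; apply: ge0_le_integral => //.
- by move=> w _; rewrite lee_fin.
- exact/measurable_EFinP.
- by apply/measurable_EFinP; exact: has_mean_measurable hY.
- by move=> w _; rewrite lee_fin.
Qed.

Lemma le_ge0_integral (X Y : T -> R) (B : R) :
  measurable_fun setT X -> measurable_fun setT Y ->
  (forall w, 0 <= X w) -> (forall w, X w <= Y w) ->
  (\int[P]_w (Y w)%:E <= B%:E)%E -> (\int[P]_w (X w)%:E <= B%:E)%E.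
Proof.
move=> mX mY X0 XY; apply: le_trans; apply: ge0_le_integral => //.
- by move=> w _; rewrite lee_fin.
- exact/measurable_EFinP.
- exact/measurable_EFinP.
- by move=> w _; rewrite lee_fin.
Qed.

Lemma ge0_integralZ_le (X : T -> R) (k B : R) : measurable_fun setT X ->
  (forall w, 0 <= X w) -> 0 <= k ->
  (\int[P]_w (X w)%:E <= B%:E)%E -> (\int[P]_w (k * X w)%:E <= (k * B)%:E)%E.
Proof.
move=> mX X0 k0 XB; under eq_integral do rewrite EFinM.
rewrite ge0_integralZl_EFin//; first by rewrite EFinM lee_wpmul2l.
- by move=> w _; rewrite lee_fin.
- exact/measurable_EFinP.
Qed.

Lemma ge0_integralD_le (X Y : T -> R) (A B : R) : measurable_fun setT X ->
  measurable_fun setT Y -> (forall w, 0 <= X w) -> (forall w, 0 <= Y w) ->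
  (\int[P]_w (X w)%:E <= A%:E)%E -> (\int[P]_w (Y w)%:E <= B%:E)%E ->
  (\int[P]_w (X w + Y w)%:E <= (A + B)%:E)%E.
Proof.
move=> mX mY X0 Y0 XA YB; under eq_integral do rewrite EFinD.
rewrite ge0_integralD//; first by rewrite EFinD leeD.
- by move=> w _; rewrite lee_fin.
- exact/measurable_EFinP.
- by move=> w _; rewrite lee_fin.
- exact/measurable_EFinP.
Qed.

Lemma ge0_integral_sum_le n (X : 'I_n -> T -> R) (B : R) :
  (forall i, measurable_fun setT (X i)) -> (forall i w, 0 <= X i w) ->
  (forall i, \int[P]_w (X i w)%:E <= B%:E)%E ->
  (\int[P]_w (\sum_(i < n) X i w)%:E <= (n%:R * B)%:E)%E.
Proof.
move=> mX X0 XB; elim: n X mX X0 XB => [|n IH] X mX X0 XB.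
  by under eq_integral do rewrite big_ord0; rewrite integral0 mul0r.
under eq_integral do rewrite big_ord_recl.
rewrite -natr1 addrC mulrDl mul1r; apply: ge0_integralD_le => //.
- by apply: measurable_sum.
- by move=> w; apply: sumr_ge0.
- exact: (IH (fun i => X (lift ord0 i))).
Qed.

(** The L^p norm of the sum is at most n times a common bound; convexity stands in for Minkowski's
    inequality. *)
Lemma powR_sum_integral_le n (X : 'I_n -> T -> R) (p B : R) : 1 < p ->
  (forall i, measurable_fun setT (X i)) -> (forall i w, 0 <= X i w) ->
  (forall i, \int[P]_w (X i w `^ p)%:E <= B%:E)%E ->
  (\int[P]_w ((\sum_(i < n) X i w) `^ p)%:E <= (n%:R `^ p * B)%:E)%E.
Proof.
move=> p1 mX X0 XB; have p0 : 0 < p by exact: lt_trans p1.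
rewrite -(mulr_powRB1 (ler0n _ n) p0) mulrAC mulrC.
have mXp i : measurable_fun setT (fun w => X i w `^ p).
  exact: measurable_fun_powR.
apply: (@le_ge0_integral _ (fun w => n%:R `^ (p - 1) * \sum_(i < n) X i w `^ p)).
- apply: measurable_fun_powR; exact: measurable_sum.
- by apply: measurable_funM => //; exact: measurable_sum.
- by move=> w; exact: powR_ge0.
- by move=> w; apply: powR_sum_le.
- apply: ge0_integralZ_le; rewrite ?powR_ge0//.
  + exact: measurable_sum.
  + by move=> w; apply: sumr_ge0 => i _; exact: powR_ge0.
  + by apply: ge0_integral_sum_le => // i w; exact: powR_ge0.
Qed.

Lemma powR_add_integral_le (X Y : T -> R) (p t A B : R) : 1 < p -> 0 < t < 1 ->
  measurable_fun setT X -> measurable_fun setT Y ->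
  (\int[P]_w (`|X w| `^ p)%:E <= A%:E)%E -> (\int[P]_w (`|Y w| `^ p)%:E <= B%:E)%E ->
  (\int[P]_w (`|X w + Y w| `^ p)%:E
     <= (t `^ (1 - p) * A + (1 - t) `^ (1 - p) * B)%:E)%E.
Proof.
move=> p1 /andP[t0 t1] mX mY XA YB; have p0 : 0 < p by exact: lt_trans p1.
have mp (Z : T -> R) : measurable_fun setT Z -> measurable_fun setT (fun w => `|Z w| `^ p).
  move=> mZ; apply: measurable_fun_powR.
  exact: measurableT_comp.
apply: (@le_ge0_integral _ (fun w => t `^ (1 - p) * `|X w| `^ p
    + (1 - t) `^ (1 - p) * `|Y w| `^ p)).
- by apply: mp; exact: measurable_funD.
- by apply: measurable_funD; apply: measurable_funM => //; exact: mp.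
- by move=> w; exact: powR_ge0.
- move=> w; apply: (@le_trans _ _ ((`|X w| + `|Y w|) `^ p)).
    by rewrite ge0_ler_powR ?nnegrE ?addr_ge0 ?ler_normD ?(ltW p0).
  by rewrite powR_add_le.
- apply: ge0_integralD_le.
  + by apply: measurable_funM => //; exact: mp.
  + by apply: measurable_funM => //; exact: mp.
  + by move=> w; rewrite mulr_ge0 ?powR_ge0.
  + by move=> w; rewrite mulr_ge0 ?powR_ge0.
  + by apply: ge0_integralZ_le; rewrite ?powR_ge0//; exact: mp.
  + by apply: ge0_integralZ_le; rewrite ?powR_ge0//; exact: mp.
Qed.

(** An inequality of von Bahr-Esseen type: each new term is added by p-smoothness, and the linear
    term has mean 0 by the last hypothesis. That hypothesis replaces conditioning on the past; it
    may assume a finite moment of the previous sum because the induction provides it. *)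
Lemma lqnorm_martingale (q n N : nat) (p B : R) (X : nat -> 'I_n -> T -> R) :
  (2 < q)%N -> ~~ odd q -> 1 < p -> p <= 2 ->
  (forall k i, (k < N)%N -> measurable_fun setT (X k i)) ->
  (forall k, (k < N)%N -> \int[P]_w (lqnorm q ((X k) ^~ w) `^ p)%:E <= B%:E)%E ->
  (forall k i, (k < N)%N ->
    (\int[P]_w (lqnorm q (fun i => \sum_(l < k) X l i w) `^ p)%:E < +oo)%E ->
    has_mean P
      (fun w => lqgrad q p (fun i => \sum_(l < k) X l i w) i * X k i w) 0) ->
  (\int[P]_w (lqnorm q (fun i => \sum_(l < N) X l i w) `^ p)%:E
     <= (N%:R * (lqconst R q * B))%:E)%E.
Proof.
move=> q3 qe p1 p2; have p0 : 0 < p by exact: lt_trans p1.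
elim: N => [|N IH] mX XB Xc.
  have z w : lqnorm q (fun i => \sum_(l < 0) X l i w) `^ p = 0.
    rewrite (_ : lqnorm _ _ = 0) ?powR0 ?gt_eqF//.
    rewrite /lqnorm big1 ?powR0 ?invr_eq0 ?pnatr_eq0 -?lt0n ?(ltn_trans _ q3)//.
    by move=> i _; rewrite big_ord0 normr0 expr0n eqn0Ngt (ltn_trans _ q3).
  by rewrite mul0r; under eq_integral do rewrite z; rewrite integral0.
have {}IH := IH (fun k i kN => mX k i (ltnW kN)) (fun k kN => XB k (ltnW kN))
  (fun k i kN => Xc k i (ltnW kN)).
set S := fun i w => \sum_(l < N) X l i w.
have mS i : measurable_fun setT (S i).
  apply: measurable_sum => l; apply: mX; exact: ltn_trans (ltn_ord l) _.
have mXN i : measurable_fun setT (X N i) by exact: mX.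
have mp (Y : 'I_n -> T -> R) : (forall i, measurable_fun setT (Y i)) ->
    measurable_fun setT (fun w => lqnorm q (Y ^~ w) `^ p).
  move=> mY; apply: measurable_fun_powR.
  exact: measurable_lqnorm.
have [r1 h1 /andP[_ r1B]] := ge0_has_mean (mp S mS) (fun w => powR_ge0 _ _) IH.
have [r2 h2 /andP[_ r2B]] :=
  ge0_has_mean (mp _ mXN) (fun w => powR_ge0 _ _) (XB N (ltnSn N)).
have hL := has_meanZ p (has_mean_sum (fun i =>
  Xc N i (ltnSn N) (le_lt_trans IH (ltry _)))).
have := has_meanD (has_meanD h1 hL) (has_meanZ (lqconst R q) h2).
rewrite big1// mulr0 addr0 => /has_mean_le h.
apply: (@le_trans _ _ (r1 + lqconst R q * r2)%:E); last first.
  have -> : N.+1%:R * (lqconst R q * B) =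
      N%:R * (lqconst R q * B) + lqconst R q * B by rewrite -natr1; ring.
  rewrite lee_fin lerD// ler_wpM2l//.
  by rewrite /lqconst addr_ge0// mulr_ge0 ?exprn_ge0.
apply: h.
- by apply: mp => i; apply: measurable_sum => l; exact: mX.
- by move=> w; exact: powR_ge0.
- move=> w; under [X in lqnorm q X]eq_fun do rewrite big_ord_recr/=.
  exact: lqnorm_smooth.
Qed.

End Moments.

(** * From summable expectations to almost sure bounds *)

Section AlmostSureBounds.
Context d (T : measurableType d) (R : realType) (P : probability T R).

(** The sum of the series is integrable, hence almost surely finite, and it dominates each of its
    terms. *)
Lemma ae_bounded_of_summable (Z : nat -> T -> \bar R) :
  (forall k, measurable_fun setT (Z k)) -> (forall k w, 0 <= Z k w)%E ->
  (\sum_(k <oo) \int[P]_w Z k w < +oo)%E ->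
  {ae P, forall w, exists C : R, forall k, (Z k w <= C%:E)%E}.
Proof.
move=> mZ Z0 fin.
have : P.-integrable setT (fun w => \sum_(k <oo) Z k w)%E.
  apply/integrableP; split.
    by apply: ge0_emeasurable_sum => // k w _ _; exact: Z0.
  under eq_integral do rewrite gee0_abs ?nneseries_ge0//.
  by rewrite integral_nneseries.
move=> /integrable_ae -/(_ measurableT); apply: filterS => w /(_ I) fw.
exists (fine (\sum_(k <oo) Z k w)%E) => k; rewrite fineK//.
apply: le_trans (nneseries_lim_ge k.+1 (fun i _ _ => Z0 i w)).
by rewrite big_nat_recr//= leeDr// sume_ge0.
Qed.

(** Summation over m for fixed k, then over k, so that one random constant serves for all pairs. *)
Lemma ae_bounded_of_geometric (Z : nat -> nat -> T -> \bar R) (A r1 r2 : R) :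
  (forall k m, measurable_fun setT (Z k m)) -> (forall k m w, 0 <= Z k m w)%E ->
  0 <= A -> 0 <= r1 < 1 -> 0 <= r2 < 1 ->
  (forall k m, \int[P]_w Z k m w <= (A * r1 ^+ k * r2 ^+ m)%:E)%E ->
  {ae P, forall w, exists C : R, forall k m, (Z k m w <= C%:E)%E}.
Proof.
move=> mZ Z0 A0 /andP[r10 r11] /andP[r20 r21] ZA.
have geo (a r : R) : 0 <= a -> 0 <= r -> r < 1 ->
    (\sum_(m <oo) (a * r ^+ m)%:E <= (a / (1 - r))%:E)%E.
  move=> a0 r0 rlt1; apply: lime_le.
    by apply: is_cvg_nneseries => m _ _; rewrite lee_fin mulr_ge0 ?exprn_ge0.
  apply: nearW => N; rewrite sumEFin lee_fin -mulr_sumr ler_wpM2l//.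
  rewrite -[leRHS]mul1r ler_pdivlMr ?subr_gt0// mulrC big_mkord.
  by rewrite -opprB mulNr -subrX1 opprB lerBlDr lerDl exprn_ge0.
have : {ae P, forall w, exists C : R, forall k, (\sum_(m <oo) Z k m w <= C%:E)%E}.
  apply: ae_bounded_of_summable.
  - by move=> k; apply: ge0_emeasurable_sum => // m w _ _; exact: Z0.
  - by move=> k w; apply: nneseries_ge0.
  - apply: (@le_lt_trans _ _ (A / (1 - r2) / (1 - r1))%:E); last exact: ltry.
    apply: le_trans (geo _ _ _ _ _); rewrite ?divr_ge0 ?subr_ge0 ?(ltW r21)//.
    apply: lee_nneseries => [k _ _|k _].
      by apply: integral_ge0 => w _; apply: nneseries_ge0.
    rewrite integral_nneseries//.
    apply: (@le_trans _ _ (A * r1 ^+ k / (1 - r2))%:E); last by rewrite mulrAC.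
    apply: le_trans (geo _ _ _ _ _); rewrite ?mulr_ge0 ?exprn_ge0//.
    by apply: lee_nneseries => [m _ _|m _]; [apply: integral_ge0 => w _|exact: ZA].
apply: filterS => w [C hC]; exists C => k m; apply: le_trans (hC k).
apply: le_trans (nneseries_lim_ge m.+1 (fun i _ _ => Z0 k i w)).
by rewrite big_nat_recr//= leeDr// sume_ge0.
Qed.

End AlmostSureBounds.

(** * Exponential moments of the normal law *)

Section Density.
Local Open Scope ereal_scope.
Context d (T : measurableType d) (R : realType).
Variables (mu nu : {measure set T -> \bar R}) (h : T -> R).
Hypotheses (mh : measurable_fun setT h) (h0 : forall x, (0 <= h x)%R).
Hypothesis nuE : forall A, measurable A -> nu A = \int[mu]_(x in A) (h x)%:E.

Import HBNNSimple.

(** True for simple functions by [nuE]; both sides pass to the limit by monotone convergence. *)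
Lemma ge0_integral_density (f : T -> \bar R) :
  measurable_fun setT f -> (forall x, 0 <= f x) ->
  \int[nu]_x f x = \int[mu]_x (f x * (h x)%:E).
Proof.
move=> mf f0; pose g := nnsfun_approx measurableT mf.
have mg n : measurable_fun setT (EFin \o g n) by exact/measurable_EFinP/measurable_funP.
have gf x : (EFin \o g n) x @[n --> \oo] --> f x by exact: cvg_nnsfun_approx.
have ndg x : nondecreasing_seq (fun n => g n x).
  by move=> m n mn; exact/lefP/nd_nnsfun_approx.
transitivity (limn (fun n => \int[nu]_x (g n x)%:E)).
  rewrite -monotone_convergence//.
  - by apply: eq_integral => x _; apply/esym/cvg_lim => //; exact: gf.
  - by move=> n x _; rewrite lee_fin.
  - by move=> x _ m n mn; rewrite lee_fin; exact: ndg.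
transitivity (limn (fun n => \int[mu]_x ((g n x)%:E * (h x)%:E))); last first.
  rewrite -monotone_convergence//.
  - apply: eq_integral => x _; apply/cvg_lim => //.
    by apply: cvgeZr => //; exact: gf.
  - by move=> n; apply: emeasurable_funM => //; exact/measurable_EFinP.
  - by move=> n x _; rewrite mule_ge0 ?lee_fin.
  - by move=> x _ m n mn; rewrite lee_wpmul2r ?lee_fin//; exact: ndg.
congr (limn _); apply/funext => n.
rewrite integralT_nnsfun sintegralE.
transitivity (\int[mu]_x
    (\sum_(r \in range (g n)) (r * \1_(g n @^-1` [set r]) x)%:E * (h x)%:E)).
  rewrite ge0_integral_fsum//.
  - apply: eq_fsbigr => r /[!inE] -[y _ <-].
    rewrite nuE; last exact: measurable_funPTI.
    under [RHS]eq_integral do rewrite EFinM -muleA.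
    rewrite ge0_integralZl_EFin//.
    + congr (_ * _); rewrite integral_mkcond; apply: eq_integral => x _.
      by rewrite patchE indicE; case: ifPn => _; rewrite ?mul1e ?mul0e.
    + by move=> x _; rewrite mule_ge0 ?lee_fin.
    + by apply: emeasurable_funM; exact/measurable_EFinP.
  - move=> r; apply: emeasurable_funM; last exact/measurable_EFinP.
    by apply/measurable_EFinP; exact: measurable_funM.
  - move=> r x _; apply: mule_ge0; last by rewrite lee_fin.
    by rewrite EFinM; exact: nnfun_muleindic_ge0.
apply: eq_integral => x _; rewrite -ge0_mule_fsuml; last first.
  by move=> r; exact: nnfun_muleindic_ge0.
by rewrite fsumEFin// -fimfunE.
Qed.

End Density.

Section GaussianExponential.
Variable R : realType.
Local Notation mu := (@lebesgue_measure R).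

(** Completion of the square: an exponential tilt moves the mean of the normal density to u s^2. *)
Lemma expR_normal_pdf (u s x : R) : s != 0 ->
  expR (u * x) * normal_pdf 0 s x =
  expR (u ^+ 2 * s ^+ 2 / 2) * normal_pdf (u * s ^+ 2) s x.
Proof.
move=> s0; rewrite !normal_pdfE// mulrCA [RHS]mulrCA; congr (_ * _).
rewrite /normal_fun -!expRD; congr expR; rewrite subr0 -mulr_natr.
by field.
Qed.

Lemma integral_expR_normal (u s : R) : s != 0 ->
  (\int[normal_prob 0 s]_x (expR (u * x))%:E = (expR (u ^+ 2 * s ^+ 2 / 2))%:E)%E.
Proof.
move=> s0.
have me : measurable_fun setT (fun x : R => (expR (u * x))%:E).
  by apply/measurable_EFinP; apply: measurableT_comp => //; exact: measurable_funM.
rewrite (@ge0_integral_density _ _ _ mu _ (normal_pdf 0 s))//; last 2 first.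
- exact: measurable_normal_pdf.
- by move=> x; exact: normal_pdf_ge0.
under eq_integral do rewrite -EFinM expR_normal_pdf// EFinM.
rewrite ge0_integralZl_EFin ?expR_ge0//.
- by rewrite integral_normal_pdf mule1.
- by move=> x _; rewrite lee_fin normal_pdf_ge0.
- by apply/measurable_EFinP; exact: measurable_normal_pdf.
Qed.

End GaussianExponential.

(** * Moments of geometric Brownian motion *)

Section MeanBounds.
Context d (T : measurableType d) (R : realType) (P : probability T R).

Lemma has_mean_ge0 (X : T -> R) (r : R) : measurable_fun setT X ->
  (forall w, 0 <= X w) -> (\int[P]_w (X w)%:E = r%:E)%E -> has_mean P X r.
Proof.
move=> mX X0 E; split=> //; apply/integrableP; split; first exact/measurable_EFinP.
by under eq_integral do rewrite /= ger0_norm//; rewrite E ltry.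
Qed.

Lemma has_mean_cst (r : R) : has_mean P (fun=> r) r.
Proof.
split; first exact: finite_measure_integrable_cst.
by rewrite integral_cst//= probability_setT mule1.
Qed.

(** Pointwise, |X|^p <= v^(p/2) + v^(p/2-1) X^2, by comparison of X^2 with v. This stands in for
    Lyapunov's inequality, at the price of the factor 2. *)
Lemma powR_integral_le_sqr (X : T -> R) (p v : R) : 1 < p -> p <= 2 -> 0 < v ->
  measurable_fun setT X -> (\int[P]_w (X w ^+ 2)%:E <= v%:E)%E ->
  (\int[P]_w (`|X w| `^ p)%:E <= (2 * v `^ (p / 2))%:E)%E.
Proof.
move=> p1 p2 v0 mX Xv; have p0 : 0 < p by exact: lt_trans p1.
have vp0 : 0 < v `^ (p / 2 - 1) by rewrite powR_gt0.
have vE : v `^ (p / 2 - 1) * v = v `^ (p / 2).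
  by rewrite mulrC mulr_powRB1 ?divr_gt0// ltW.
have mX2 : measurable_fun setT (fun w => X w ^+ 2) by exact: measurable_funX.
apply: (@le_ge0_integral _ _ _ _ _
  (fun w => v `^ (p / 2) + v `^ (p / 2 - 1) * X w ^+ 2)).
- by apply: measurable_fun_powR; exact: measurableT_comp.
- by apply: measurable_funD => //; exact: measurable_funM.
- by move=> w; exact: powR_ge0.
- move=> w; have XE : `|X w| `^ p = (X w ^+ 2) `^ (p / 2).
    rewrite -real_normK ?num_real// -powR_mulrn// -powRrM; congr (_ `^ _).
    by field.
  rewrite XE; have [Xv2|vX2] := leP (X w ^+ 2) v.
    rewrite (le_trans (y := v `^ (p / 2)))//.
      by rewrite ge0_ler_powR ?nnegrE ?sqr_ge0 ?divr_ge0 ?(ltW p0) ?(ltW v0).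
    by rewrite lerDl mulr_ge0 ?powR_ge0 ?sqr_ge0.
  rewrite (le_trans (y := v `^ (p / 2 - 1) * X w ^+ 2))//; last first.
    by rewrite lerDr powR_ge0.
  rewrite -(@mulr_powRB1 _ _ (p / 2)) ?sqr_ge0 ?divr_gt0// mulrC.
  rewrite ler_wpM2r ?sqr_ge0//.
  rewrite -(opprB 1) !powRN lef_pV2 ?posrE ?powR_gt0 ?(lt_trans v0 vX2)//.
  by rewrite ge0_ler_powR ?nnegrE ?sqr_ge0 ?(ltW v0) ?(ltW vX2)//; lra.
- rewrite -vE (_ : 2 * _ = v `^ (p / 2 - 1) * v + v `^ (p / 2 - 1) * v);
    last by ring.
  apply: ge0_integralD_le.
  + by [].
  + by apply: measurable_funM.
  + by move=> w; rewrite mulr_ge0 ?powR_ge0 ?(ltW v0).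
  + by move=> w; rewrite mulr_ge0 ?powR_ge0 ?sqr_ge0.
  + by rewrite integral_cst//= probability_setT mule1.
  + by apply: ge0_integralZ_le; rewrite ?powR_ge0// => w; rewrite sqr_ge0.
Qed.

End MeanBounds.

Section GeometricBM.
Context d (T : measurableType d) (R : realType) (P : probability T R).
Variables (B : R -> T -> R) (sigma : R).
Hypothesis hB : brownian_motion01 P B.
Local Notation W := (geometric_bm sigma B).

Let mB t : 0 <= t -> t <= 1 -> measurable_fun setT (B t).
Proof. by move=> t0 t1; apply: (bm_measurable hB); rewrite in_itv/= t0. Qed.

(** The ratio W t / W s, a function of a single Brownian increment. *)
Let incr s t w := expR (sigma * (B t w - B s w) - sigma ^+ 2 / 2 * (t - s)).

Let mincr s t : 0 <= s -> s <= t -> t <= 1 -> measurable_fun setT (incr s t).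
Proof.
move=> s0 st t1; apply: measurableT_comp => //; apply: measurable_funB => //.
apply: measurable_funM => //; apply: measurable_funB; apply: mB => //.
  by rewrite (le_trans s0).
by rewrite (le_trans st).
Qed.

Let incr_gt0 s t w : 0 < incr s t w. Proof. exact: expR_gt0. Qed.

Let incr_moment s t (u : R) : 0 <= s -> s <= t -> t <= 1 ->
  has_mean P (fun w => incr s t w `^ u)
    (expR (u * (u - 1) * sigma ^+ 2 / 2 * (t - s))).
Proof.
(* The Gaussian law is given for s < t only; for s = t the ratio is 1. *)
move=> s0 st t1; rewrite le_eqVlt in st; case/predU1P: st => [<-|st].
  have -> : (fun w => incr s s w `^ u) = fun=> 1.
    by apply/funext => w; rewrite /incr !subrr !mulr0 subrr expR0 powR1.
  by rewrite subrr mulr0 expR0; exact: has_mean_cst.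
have mZ : measurable_fun setT (fun w => B t w - B s w).
  apply: measurable_funB; apply: mB => //; first by rewrite (le_trans s0)// ltW.
  by rewrite (le_trans (ltW st)).
have mZ' : @measurable_fun _ _ T (measurableTypeR R) setT (fun w => B t w - B s w).
  exact: mZ.
pose Z : {mfun T >-> measurableTypeR R} := HB.pack (fun w => B t w - B s w)
  (isMeasurableFun.Build _ _ _ _ _ mZ').
have ts0 : 0 < t - s by rewrite subr_gt0.
apply: has_mean_ge0.
- by apply: measurable_fun_powR; apply: mincr => //; exact: ltW.
- by move=> w; exact: powR_ge0.
set v := u * sigma.
have E w : (incr s t w `^ u)%:E =
    ((expR (- (u * sigma ^+ 2 / 2 * (t - s))))%:E * (expR (v * Z w))%:E)%E.
  rewrite -EFinM -expRD /incr /powR gt_eqF ?expR_gt0// expRK; congr (expR _)%:E.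
  by rewrite /v /=; ring.
under eq_integral do rewrite E.
have me : measurable_fun setT (fun x : measurableTypeR R => (expR (v * (x : R)))%:E).
  by apply/measurable_EFinP; apply: measurableT_comp => //; exact: measurable_funM.
rewrite ge0_integralZl_EFin ?expR_ge0//; last exact: measurableT_comp me mZ.
have -> : (\int[P]_w (expR (v * Z w))%:E =
    (expR (v ^+ 2 * Num.sqrt (t - s) ^+ 2 / 2))%:E)%E.
  transitivity (\int[distribution P Z]_x (expR (v * x))%:E)%E.
    by rewrite ge0_integral_distribution// => x; rewrite lee_fin expR_ge0.
  have sq0 : Num.sqrt (t - s) != 0 by rewrite gt_eqF// sqrtr_gt0.
  rewrite -(integral_expR_normal v sq0); apply: eq_measure_integral => A mA _.
  exact: (bm_gaussian hB s0 st t1 mA).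
rewrite -EFinM -expRD sqr_sqrtr ?(ltW ts0)//; congr (expR _)%:E.
by rewrite /v; field.
Qed.

Let W_ae t : {ae P, forall w, W t w = incr 0 t w}.
Proof.
apply: filterS (bm_start hB) => w B0.
by rewrite /geometric_bm /incr B0 !subr0.
Qed.

Lemma measurable_gbm t : 0 <= t -> t <= 1 -> measurable_fun setT (W t).
Proof.
move=> t0 t1; apply: measurableT_comp => //; apply: measurable_funB => //.
by apply: measurable_funM => //; exact: mB.
Qed.

Let expo_ge0 p : 1 < p -> 0 <= p * (p - 1) * sigma ^+ 2 / 2.
Proof.
move=> p1; apply: divr_ge0 => //; apply: mulr_ge0; last exact: sqr_ge0.
by apply: mulr_ge0; lra.
Qed.

Lemma gbm_mean t : 0 <= t -> t <= 1 -> has_mean P (W t) 1.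
Proof.
move=> t0 t1; apply: has_mean_ge0; [exact: measurable_gbm|by move=> w; exact: expR_ge0|].
have := (@incr_moment 0 t 1 (lexx 0) t0 t1).2.
rewrite subrr mulr0 !mul0r expR0 => <-.
apply: ae_eq_integral => //.
- by apply/measurable_EFinP; exact: measurable_gbm.
- by apply/measurable_EFinP; apply: measurable_fun_powR; exact: mincr.
- by apply: filterS (W_ae t) => w E _; rewrite E powRr1// ltW.
Qed.

Lemma gbm_moment p t : 1 < p -> 0 <= t -> t <= 1 ->
  (\int[P]_w (`|W t w| `^ p)%:E <= (expR (p * (p - 1) * sigma ^+ 2 / 2))%:E)%E.
Proof.
move=> p1 t0 t1.
have -> : (\int[P]_w (`|W t w| `^ p)%:E = \int[P]_w (incr 0 t w `^ p)%:E)%E.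
  apply: ae_eq_integral => //.
  - apply/measurable_EFinP; apply: measurable_fun_powR.
    by apply: measurableT_comp => //; exact: measurable_gbm.
  - by apply/measurable_EFinP; apply: measurable_fun_powR; exact: mincr.
  - by apply: filterS (W_ae t) => w E _; rewrite E gtr0_norm.
rewrite (incr_moment p (lexx 0) t0 t1).2 lee_fin ler_expR subr0.
rewrite -[leRHS]mulr1 ler_wpM2l//.
exact: expo_ge0.
Qed.

Local Notation K0 := (sigma ^+ 2 * expR (sigma ^+ 2)).

(** Expansion of the square gives e^x - 1 with x = sigma^2 (t - s), and e^x - 1 <= x e^x. *)
Let incr_sqr s t : 0 <= s -> s <= t -> t <= 1 ->
  (\int[P]_w ((incr s t w - 1) ^+ 2)%:E <= (K0 * (t - s))%:E)%E.
Proof.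
move=> s0 st t1.
have h2 := incr_moment 2 s0 st t1; have h1 := incr_moment 1 s0 st t1.
have h := has_meanD (has_meanB h2 (has_meanZ 2 h1)) (has_mean_cst P 1).
have -> : (fun w => ((incr s t w - 1) ^+ 2)%:E) =
    (fun w => (incr s t w `^ 2 - 2 * incr s t w `^ 1 + 1)%:E).
  apply/funext => w; congr _%:E.
  by rewrite powRr1 ?(ltW (incr_gt0 _ _ _))// powR_mulrn ?(ltW (incr_gt0 _ _ _))//; ring.
rewrite h.2 lee_fin subrr mulr0 !mul0r expR0.
set x := sigma ^+ 2 * (t - s).
have x0 : 0 <= x by rewrite mulr_ge0 ?sqr_ge0 ?subr_ge0.
have xs : x <= sigma ^+ 2.
  by rewrite -[leRHS]mulr1 ler_wpM2l ?sqr_ge0//; lra.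
have -> : 2 * (2 - 1) * sigma ^+ 2 / 2 * (t - s) = x by rewrite /x; field.
have : expR x * (1 - x) <= 1.
  rewrite -[leRHS](expR0 R) -(subrr x) expRD ler_wpM2l ?expR_ge0//.
  exact: expR_ge1Dx.
have : x * expR x <= x * expR (sigma ^+ 2) by rewrite ler_wpM2l// ler_expR.
have -> : sigma ^+ 2 * expR (sigma ^+ 2) * (t - s) = x * expR (sigma ^+ 2).
  by rewrite /x; ring.
lra.
Qed.

(** W t - W s is almost surely the product of the independent factors W s and W t / W s - 1; the
    latter has second moment of order t - s, hence p-th moment of order (t - s)^(p/2). *)
Lemma gbm_increment p s t : 0 < sigma -> 1 < p -> p <= 2 ->
  0 <= s -> s < t -> t <= 1 ->
  (\int[P]_w (`|W t w - W s w| `^ p)%:E <=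
     (expR (p * (p - 1) * sigma ^+ 2 / 2) * (2 * K0 `^ (p / 2))
       * (t - s) `^ (p / 2))%:E)%E.
Proof.
move=> sig0 p1 p2 s0 st t1; have p0 : 0 < p by exact: lt_trans p1.
have t0 : 0 <= t by rewrite (le_trans s0)// ltW.
have s1 : s <= 1 by rewrite (le_trans (ltW st)).
have tst : t - s <= 1 by lra.
have K00 : 0 < K0 by rewrite mulr_gt0 ?expR_gt0// exprn_gt0.
have mX : measurable_fun setT (incr 0 s) by exact: mincr.
have mY : measurable_fun setT (incr s t) by apply: mincr => //; exact: ltW.
have -> : (\int[P]_w (`|W t w - W s w| `^ p)%:E =
    \int[P]_w (incr 0 s w `^ p * `|incr s t w - 1| `^ p)%:E)%E.
  apply: ae_eq_integral => //.
  - apply/measurable_EFinP; apply: measurable_fun_powR.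
    by apply: measurableT_comp => //; apply: measurable_funB; exact: measurable_gbm.
  - apply/measurable_EFinP; apply: measurable_funM.
      exact: measurable_fun_powR.
    apply: measurable_fun_powR; apply: measurableT_comp => //.
    exact: measurable_funB.
  - apply: filterS2 (W_ae t) (W_ae s) => w Et Es _; congr _%:E.
    rewrite -powRM// ?(ltW (incr_gt0 _ _ _))// Et Es.
    rewrite -[X in X * _](gtr0_norm (incr_gt0 _ _ _)) -normrM mulrBr mulr1.
    by rewrite -expRD; congr (`|expR _ - _| `^ p); ring.
have indep : indep_rv P (fun w => B s w - B 0 w) (fun w => B t w - B s w).
  move=> A A' mA mA'.
  (* Times 0, s, t, t, ...: the increments of index 0 and 1 are the two in question. *)
  pose tt (n : nat) : R := if n == 0%N then 0 else if n == 1%N then s else t.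
  have := bm_independent hB (t := tt) _ _.
  have tt1 : {homo tt : i j / (i <= j)%N >-> i <= j}.
    by case=> [|[|i]] [|[|j]]; rewrite /tt//= ltW.
  have tt2 i : tt i \in `[0, 1].
    by rewrite in_itv/= /tt; case: i => [|[|i]] /=; rewrite ?lexx ?ler01 ?s0 ?t0.
  move=> /(_ tt1 tt2 [:: 0%N; 1%N] (fun i => if i == 0%N
    then (fun w => B s w - B 0 w) @^-1` A else (fun w => B t w - B s w) @^-1` A')).
  rewrite !big_cons !big_nil/= setIT mule1; apply => // i.
  rewrite !inE => /orP[]/eqP -> /=; first by exists A => //; rewrite setTI.
  by exists A' => //; rewrite setTI.
rewrite ge0_integral_indepM; last 5 first.
- exact: measurable_fun_powR.
- apply: measurable_fun_powR; apply: measurableT_comp => //.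
  exact: measurable_funB.
- by move=> w; exact: powR_ge0.
- by move=> w; exact: powR_ge0.
- apply: (@indep_rv_comp _ _ _ _ _ _
    (fun x => expR (sigma * x - sigma ^+ 2 / 2 * (s - 0)) `^ p)
    (fun x => `|expR (sigma * x - sigma ^+ 2 / 2 * (t - s)) - 1| `^ p)) indep.
    apply: measurable_fun_powR; apply: measurableT_comp => //.
    by apply: measurable_funB => //; exact: measurable_funM.
  apply: measurable_fun_powR; apply: measurableT_comp => //.
  apply: measurable_funB => //; apply: measurableT_comp => //.
  by apply: measurable_funB => //; exact: measurable_funM.
rewrite -mulrA EFinM; apply: lee_pmul.
- by apply: integral_ge0 => w _; rewrite lee_fin powR_ge0.
- by apply: integral_ge0 => w _; rewrite lee_fin powR_ge0.
- rewrite (incr_moment p (lexx 0) s0 s1).2 lee_fin ler_expR subr0.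
  rewrite -[leRHS]mulr1 ler_wpM2l//.
  exact: expo_ge0.
- have ts0 : 0 < t - s by rewrite subr_gt0.
  rewrite -mulrA -powRM ?(ltW K00) ?(ltW ts0)//.
  apply: powR_integral_le_sqr => //; first exact: mulr_gt0.
    exact: measurable_funB.
  by apply: incr_sqr => //; exact: ltW.
Qed.

End GeometricBM.

(** * Laws of processes on path space *)

Section PathLaw.
Context (R : realType).

Definition path_generators (T : set R) : set (set (R -> R)) :=
  \bigcup_(t in T) preimage_set_system [set: R -> R] (fun f : R -> R => f t)
    (@measurable _ R).

(** Functions with the product sigma-algebra as measurable structure, so that the closure properties
    of [measurable_fun] apply to functionals of a path. *)
Definition path_space (T : set R) := g_sigma_algebraType (path_generators T).

Lemma measurable_eval (T : set R) t : T t ->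
  measurable_fun [set: path_space T] (fun f : path_space T => f t).
Proof.
by move=> Tt _ A mA; apply: sub_sigma_algebra; exists t => //; exists A.
Qed.

Lemma path_sigma_preimage (T : set R) (F : (R -> R) -> R) (A : set R) :
  measurable_fun [set: path_space T] (F : path_space T -> R) -> measurable A ->
  path_sigma T (F @^-1` A).
Proof. by move=> mF mA; rewrite -[_ @^-1` _]setTI; exact: mF. Qed.

Lemma sigma_algebra_path_sigma (T : set R) : sigma_algebra setT (path_sigma T).
Proof. exact: smallest_sigma_algebra. Qed.

Lemma sigma_algebra_process_sigma (Omega : Type) (T : set R)
  (X : R -> Omega -> R) : sigma_algebra setT (process_sigma T X).
Proof.
by apply: sigma_algebra_preimage; exact: sigma_algebra_path_sigma.
Qed.

Section Process.
Context d (Omega : measurableType d) (T : set R) (X : R -> Omega -> R).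
Hypothesis mX : forall t, T t -> measurable_fun setT (X t).

Lemma measurable_path (A : set (R -> R)) : path_sigma T A ->
  measurable [set w | A (X ^~ w)].
Proof.
move: A; apply: smallest_sub.
  split=> /= [|A mA|A mA].
  - by rewrite (_ : [set _ | _] = set0)//; apply/seteqP; split.
  - rewrite (_ : [set _ | _] = ~` [set w | A (X ^~ w)]); first exact: measurableC.
    by apply/seteqP; split => w /=; [case | split].
  - rewrite (_ : [set _ | _] = \bigcup_i [set w | A i (X ^~ w)]).
      exact: bigcup_measurable.
    by apply/seteqP; split.
move=> _ [t Tt [B mB <-]] /=; rewrite (_ : [set _ | _] = X t @^-1` B).
  by rewrite -[_ @^-1` _]setTI; exact: mX.
by apply/seteqP; split => w /=; [case | split].
Qed.

Lemma process_sigma_measurable : process_sigma T X `<=` measurable.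
Proof.
by move=> _ [A sA <-]; rewrite setTI; exact: measurable_path.
Qed.

Lemma process_sigma_functional (F : (R -> R) -> R) (A : set R) :
  measurable_fun [set: path_space T] (F : path_space T -> R) -> measurable A ->
  process_sigma T X ((fun w => F (X ^~ w)) @^-1` A).
Proof.
by move=> mF mA; exists (F @^-1` A); rewrite ?setTI//; exact: path_sigma_preimage.
Qed.

Lemma measurable_functional (F : (R -> R) -> R) :
  measurable_fun [set: path_space T] (F : path_space T -> R) ->
  measurable_fun setT (fun w => F (X ^~ w)).
Proof.
move=> mF _ A mA; rewrite setTI; apply: process_sigma_measurable.
exact: process_sigma_functional.
Qed.

End Process.

Section SameLaw.
Context d d' (Omega : measurableType d) (Omega' : measurableType d').
Context (P : probability Omega R) (P' : probability Omega' R) (T : set R).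
Context (X : R -> Omega -> R) (Y : R -> Omega' -> R).
Hypothesis mX : forall t, T t -> measurable_fun setT (X t).
Hypothesis mY : forall t, T t -> measurable_fun setT (Y t).
Hypothesis XY : same_law T P P' X Y.

(** Both sides are integrals of g against the law of the functional F, and the events of F are path
    events. Keeping g apart from F lets one lemma treat absolute values, positive parts and negative
    parts. *)
Lemma same_law_integral (F : (R -> R) -> R) (g : R -> \bar R) :
  measurable_fun [set: path_space T] (F : path_space T -> R) ->
  measurable_fun setT g -> (forall x, 0 <= g x)%E ->
  (\int[P]_w g (F (X ^~ w)) = \int[P']_w g (F (Y ^~ w)))%E.
Proof.
move=> mF mg g0.
have mFX := measurable_functional mX mF; have mFY := measurable_functional mY mF.
pose FX : {mfun Omega >-> R} := HB.pack (fun w => F (X ^~ w))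
  (isMeasurableFun.Build _ _ _ _ _ mFX).
pose FY : {mfun Omega' >-> R} := HB.pack (fun w => F (Y ^~ w))
  (isMeasurableFun.Build _ _ _ _ _ mFY).
transitivity (\int[distribution P FX]_x g x)%E.
  by rewrite ge0_integral_distribution.
transitivity (\int[distribution P' FY]_x g x)%E.
  apply: eq_measure_integral => A mA _.
  exact: (XY (path_sigma_preimage mF mA)).
by rewrite ge0_integral_distribution.
Qed.

Lemma same_law_has_mean (F : (R -> R) -> R) (r : R) :
  measurable_fun [set: path_space T] (F : path_space T -> R) ->
  has_mean P' (fun w => F (Y ^~ w)) r -> has_mean P (fun w => F (X ^~ w)) r.
Proof.
move=> mF hY; have mFX := measurable_functional mX mF.
have mabs : measurable_fun setT (fun x : R => `|x|%:E).
  by apply/measurable_EFinP; exact: normr_measurable.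
have mE : measurable_fun setT (@EFin R \o id).
  by apply/measurable_EFinP; exact: measurable_id.
split.
  apply/integrableP; split; first by apply/measurable_EFinP; exact: mFX.
  rewrite (same_law_integral mF (g := fun x => `|x|%:E) mabs) => [|x]; last first.
    by rewrite lee_fin.
  by have [/integrableP[]] := hY.
rewrite -hY.2 integralE [RHS]integralE; congr (_ - _)%E.
  have mp : measurable_fun setT (fun x : R => (maxe x%:E 0)%E).
    exact: (measurable_maxe mE (measurable_cst _)).
  have p0 (x : R) : (0 <= maxe x%:E 0)%E by rewrite le_max lexx orbT.
  under eq_integral do rewrite funeposE; under [RHS]eq_integral do rewrite funeposE.
  exact: (same_law_integral mF mp p0).
have mn : measurable_fun setT (fun x : R => (maxe (- x%:E) 0)%E).
  exact: (measurable_maxe (measurableT_comp (@oppe_measurable _ _) mE) (measurable_cst _)).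
have n0 (x : R) : (0 <= maxe (- x%:E) 0)%E by rewrite le_max lexx orbT.
under eq_integral do rewrite funenegE; under [RHS]eq_integral do rewrite funenegE.
exact: (same_law_integral mF mn n0).
Qed.

End SameLaw.
End PathLaw.

(** * Products of independent processes along a grid *)

Section SubSigmaAlgebras.
Context d (T : measurableType d) (R : realType).

(** G need not be a sigma-algebra: measurability refers to the one that G generates. *)
Definition sub_measurable (G : set (set T)) (X : T -> R) :=
  measurable_fun [set: g_sigma_algebraType G] (X : g_sigma_algebraType G -> R).

Lemma sub_measurableW (G : set (set T)) (X : T -> R) :
  G `<=` measurable -> sub_measurable G X -> measurable_fun setT X.
Proof.
move=> Gm mX _ A mA.
have /(smallest_sub (@sigma_algebra_measurable _ T) Gm) : <<s G >> (X @^-1` A).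
  by rewrite -[_ @^-1` _]setTI; exact: mX.
by rewrite setTI.
Qed.

Lemma sub_measurableS (G H : set (set T)) (X : T -> R) :
  G `<=` H -> sub_measurable G X -> sub_measurable H X.
Proof.
move=> GH mX _ A mA; have := mX measurableT A mA.
by apply: sub_smallest2r.
Qed.

End SubSigmaAlgebras.

(* The values of an independent array of processes along a grid of b^n points:
   [V t j] is the value at the j-th point of the process attached to the block
   of level t+1 (of length b^(n-t-1)) that contains it. *)
Record grid_array d (T : measurableType d) (R : realType) (P : probability T R)
    (b n : nat) (p kappa K : R) (I : eqType) (F : I -> set (set T))
    (idx : nat -> nat -> I) (V : nat -> nat -> T -> R) : Prop := {
  ga_sigma : forall i, sigma_algebra setT (F i) ;
  ga_sub : forall i, F i `<=` measurable ;
  ga_indep : mutually_independent P F ;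
  ga_idx : forall t t' j j', (t < n)%N -> (t' < n)%N ->
    (j < b ^ n)%N -> (j' < b ^ n)%N ->
    idx t j = idx t' j' <->
      t = t' /\ (j %/ b ^ (n - t.+1) = j' %/ b ^ (n - t'.+1))%N ;
  ga_meas : forall t j, (t < n)%N -> (j < b ^ n)%N ->
    sub_measurable (F (idx t j)) (V t j) ;
  ga_mean : forall t j, (t < n)%N -> (j < b ^ n)%N -> has_mean P (V t j) 1 ;
  ga_moment : forall t j, (t < n)%N -> (j < b ^ n)%N ->
    (\int[P]_w (`|V t j w| `^ p)%:E <= kappa%:E)%E ;
  ga_increment : forall t j h, (t < n)%N -> (j + h < b ^ n)%N ->
    ((j + h) %/ b ^ (n - t.+1) = j %/ b ^ (n - t.+1))%N ->
    (\int[P]_w (`|V t (j + h)%N w - V t j w| `^ p)%:E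
      <= (K * (h%:R / (b ^ (n - t.+1))%:R) `^ (p / 2))%:E)%E }.

Section GridArray.
Context d (T : measurableType d) (R : realType) (P : probability T R).
Context (b n : nat) (p kappa K : R) (I : eqType) (F : I -> set (set T)).
Context (idx : nat -> nat -> I) (V : nat -> nat -> T -> R).
Hypothesis hV : grid_array P b n p kappa K F idx V.
Hypotheses (b2 : (2 <= b)%N) (p1 : 1 < p) (p2 : p <= 2).
Hypotheses (kappa1 : 1 <= kappa) (K0 : 0 <= K).

Let p0 : 0 < p. Proof. exact: lt_trans p1. Qed.
Let b0 : (0 < b)%N. Proof. exact: ltnW. Qed.
Let kappa0 : 0 <= kappa. Proof. exact: le_trans kappa1. Qed.

Let others_sub i : sigma_others F i `<=` measurable.
Proof. by move=> A [i' _ FA]; exact: (ga_sub hV) FA. Qed.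

Lemma indep_of_others (i : I) (X Y : T -> R) :
  sub_measurable (sigma_others F i) X -> sub_measurable (F i) Y -> indep_rv P X Y.
Proof.
move=> mX mY A B mA mB; rewrite setIC muleC.
apply: (indep_sigma_others (ga_sigma hV) (ga_sub hV) (ga_indep hV) (i0 := i)).
  rewrite -(sigma_algebra_id (ga_sigma hV i)) -[_ @^-1` _]setTI.
  exact: mY.
by rewrite -[_ @^-1` _]setTI; exact: mX.
Qed.

Lemma sub_measurable_others t j i : (t < n)%N -> (j < b ^ n)%N -> idx t j <> i ->
  sub_measurable (sigma_others F i) (V t j).
Proof.
move=> tn jn /eqP ti; apply: sub_measurableS (ga_meas hV tn jn) => A FA.
by exists (idx t j).
Qed.

Lemma measurable_V t j : (t < n)%N -> (j < b ^ n)%N -> measurable_fun setT (V t j).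
Proof. by move=> tn jn; apply: sub_measurableW (ga_meas hV tn jn); exact: (ga_sub hV). Qed.

(** The value at the j-th grid point of the density after m levels. *)
Definition grid_prod (m j : nat) (w : T) : R := \prod_(t < m) V t j w.

Lemma sub_measurable_prod m j i : (m <= n)%N -> (j < b ^ n)%N ->
  (forall t, (t < m)%N -> idx t j <> i) ->
  sub_measurable (sigma_others F i) (grid_prod m j).
Proof.
move=> mn jn ti; apply: measurable_prod => /= t _.
by apply: sub_measurable_others => //; [exact: leq_trans mn|exact: ti].
Qed.

Lemma measurable_grid_prod m j : (m <= n)%N -> (j < b ^ n)%N ->
  measurable_fun setT (grid_prod m j).
Proof.
move=> mn jn; apply: measurable_prod => /= t _.
by apply: measurable_V => //; exact: leq_trans mn.
Qed.

Let idx_neq t m j j' : (t < m)%N -> (m < n)%N -> (j < b ^ n)%N -> (j' < b ^ n)%N ->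
  idx t j <> idx m j'.
Proof.
move=> tm mn jn j'n /(ga_idx hV (ltn_trans tm mn) mn jn j'n)[e _].
by rewrite e ltnn in tm.
Qed.

Let mabsp (X : T -> R) : measurable_fun setT X ->
  measurable_fun setT (fun w => `|X w| `^ p).
Proof. by move=> mX; apply: measurable_fun_powR; exact: measurableT_comp. Qed.

Lemma indep_moment_le (i : I) (X Y : T -> R) (A B : R) :
  sub_measurable (sigma_others F i) X -> sub_measurable (F i) Y ->
  (\int[P]_w (`|X w| `^ p)%:E <= A%:E)%E -> (\int[P]_w (`|Y w| `^ p)%:E <= B%:E)%E ->
  (\int[P]_w (`|X w * Y w| `^ p)%:E <= (A * B)%:E)%E.
Proof.
move=> mX mY XA YB; have ind := indep_of_others mX mY.
have mX' := sub_measurableW (@others_sub i) mX.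
have mY' := sub_measurableW (ga_sub hV (i:=i)) mY.
have mp : measurable_fun setT (fun x : R => `|x| `^ p).
  by apply: measurable_fun_powR; exact: normr_measurable.
under eq_integral do rewrite normrM powRM//.
rewrite ge0_integral_indepM; last 5 first.
- exact: mabsp.
- exact: mabsp.
- by move=> w; exact: powR_ge0.
- by move=> w; exact: powR_ge0.
- exact: (indep_rv_comp mp mp ind).
rewrite EFinM; apply: lee_pmul => //.
- by apply: integral_ge0 => w _; rewrite lee_fin powR_ge0.
- by apply: integral_ge0 => w _; rewrite lee_fin powR_ge0.
Qed.

(** Each new factor is independent of the product of the coarser ones, so a level multiplies the
    moment by at most [kappa]. *)
Lemma grid_prod_moment m j : (m <= n)%N -> (j < b ^ n)%N ->
  (\int[P]_w (`|grid_prod m j w| `^ p)%:E <= (kappa ^+ m)%:E)%E.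
Proof.
move=> + jn; elim: m => [|m IH] mn.
  rewrite /grid_prod; under eq_integral do rewrite big_ord0 normr1 powR1.
  by rewrite (has_mean_cst P 1).2.
rewrite exprSr /grid_prod; under eq_integral do rewrite big_ord_recr/=.
apply: (@indep_moment_le (idx m j) (grid_prod m j)).
- by apply: sub_measurable_prod => //; [exact: ltnW|move=> t tm; exact: idx_neq].
- exact: (ga_meas hV).
- by apply: IH; exact: ltnW.
- exact: (ga_moment hV).
Qed.

Lemma grid_prod_mean m j : (m <= n)%N -> (j < b ^ n)%N ->
  has_mean P (grid_prod m j) 1.
Proof.
move=> + jn; elim: m => [|m IH] mn.
  by rewrite /grid_prod; under eq_fun do rewrite big_ord0; exact: has_mean_cst.
rewrite /grid_prod; under eq_fun do rewrite big_ord_recr/=.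
rewrite -[X in has_mean _ _ X](mulr1 1); apply: has_meanM.
- apply: (@indep_of_others (idx m j) (grid_prod m j)); last exact: (ga_meas hV).
  by apply: sub_measurable_prod => //; [exact: ltnW|move=> t tm; exact: idx_neq].
- by apply: IH; exact: ltnW.
- exact: (ga_mean hV).
Qed.

(* p - 1 <= p / 2, and (3/2)^(p/2) 2^(-p/2) = (3/4)^(p/2) <= 7/8. *)
Let contraction : (2 / 3) `^ (1 - p) * (2^-1) `^ (p / 2) <= 7 / 8 :> R.
Proof.
have p1' := p1; have p2' := p2.
have -> : (2 / 3) `^ (1 - p) = (3 / 2) `^ (p - 1) :> R.
  have -> : 2 / 3 = (3 / 2) `^ (-1) :> R by rewrite powR_inv1 ?divr_ge0//; field.
  by rewrite -powRrM; congr (_ `^ _); ring.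
apply: (@le_trans _ _ ((3 / 2) `^ (p / 2) * (2^-1) `^ (p / 2))).
  by rewrite ler_wpM2r ?powR_ge0// ler_powR//; lra.
rewrite -powRM ?divr_ge0 ?invr_ge0//.
apply: (@le_trans _ _ ((3 / 4) `^ (2^-1))).
  have -> : 3 / 2 * 2^-1 = 3 / 4 :> R by field.
  by rewrite ger_powR//; lra.
rewrite -(ler_pXn2r (ltn0Sn 1)) ?nnegrE ?powR_ge0//.
rewrite -powR_mulrn ?powR_ge0// -powRrM mulVf// powRr1; lra.
Qed.

(** The solution C = 24 K of C = 3 K + (7 / 8) C, the recursion over the levels in
    [grid_prod_increment]. *)
Definition rough_const : R := 24 * K.

(** Product rule: the increment of a product is the new product times the increment of the last
    factor, plus the increment of the product times the old last factor; both terms have independent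
    factors. The increment of the product lives on a block b >= 2 times longer, which gains
    2^(-p/2); the weights 1 / 3 and 2 / 3 then leave a contraction by 7 / 8. *)
Lemma grid_prod_increment m j h : (m <= n)%N -> (j + h < b ^ n)%N ->
  ((j + h) %/ b ^ (n - m) = j %/ b ^ (n - m))%N ->
  (\int[P]_w (`|grid_prod m (j + h)%N w - grid_prod m j w| `^ p)%:E
    <= (rough_const * kappa ^+ m * (h%:R / (b ^ (n - m))%:R) `^ (p / 2))%:E)%E.
Proof.
move=> + jhn; have jn : (j < b ^ n)%N by exact: leq_ltn_trans (leq_addr _ _) jhn.
have K24 : 0 <= rough_const by rewrite mulr_ge0.
elim: m => [|m IH] mn same.
  rewrite /grid_prod; under eq_integral do rewrite !big_ord0 subrr normr0 powR0 ?gt_eqF//.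
  by rewrite integral0 lee_fin !mulr_ge0 ?powR_ge0 ?exprn_ge0.
have bpos : (0 < b ^ (n - m.+1))%N by rewrite expn_gt0 b0.
have bpow : (b ^ (n - m) = b ^ (n - m.+1) * b)%N by rewrite -expnSr subnSK.
have {}IH := IH (ltnW mn) _.
have {}IH := IH _.
move: IH; rewrite bpow !divnMA same => /(_ erefl).
set rho' := (_ / _) `^ (p / 2); set rho := (_ / _) `^ (p / 2) => IH.
have rho0 : 0 <= rho by exact: powR_ge0.
have rho'le : rho' <= (2^-1) `^ (p / 2) * rho.
  rewrite -powRM ?invr_ge0 ?divr_ge0//; apply: ge0_ler_powR.
  - by rewrite divr_ge0// ltW.
  - by rewrite nnegrE divr_ge0.
  - by rewrite nnegrE mulr_ge0 ?invr_ge0 ?divr_ge0.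
  - rewrite [leRHS]mulrCA natrM invfM ler_wpM2l// mulrC ler_wpM2r ?invr_ge0//.
    by rewrite lef_pV2 ?posrE ?ltr0n// ler_nat.
pose X w := grid_prod m (j + h)%N w * (V m (j + h)%N w - V m j w).
pose Y w := (grid_prod m (j + h)%N w - grid_prod m j w) * V m j w.
have idxE : idx m (j + h)%N = idx m j by apply/(ga_idx hV) => //.
have mO j' : (j' < b ^ n)%N -> sub_measurable (sigma_others F (idx m j)) (grid_prod m j').
  move=> j'n; apply: sub_measurable_prod => //; first exact: ltnW.
  by move=> t tm; exact: idx_neq.
have mV : sub_measurable (F (idx m j)) (V m j) by exact: (ga_meas hV).
have mV' : sub_measurable (F (idx m j)) (V m (j + h)%N).
  by rewrite -idxE; exact: (ga_meas hV).
have XB : (\int[P]_w (`|X w| `^ p)%:E <= (kappa ^+ m * (K * rho))%:E)%E.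
  apply: (@indep_moment_le (idx m j)).
  - exact: mO.
  - exact: measurable_funB.
  - by apply: grid_prod_moment => //; exact: ltnW.
  - exact: (ga_increment hV).
have YB : (\int[P]_w (`|Y w| `^ p)%:E
    <= (rough_const * kappa ^+ m * rho' * kappa)%:E)%E.
  apply: (@indep_moment_le (idx m j)) => //.
  - by apply: measurable_funB; exact: mO.
  - exact: (ga_moment hV).
have XY w : grid_prod m.+1 (j + h)%N w - grid_prod m.+1 j w = X w + Y w.
  by rewrite /X /Y /grid_prod !big_ord_recr/=; ring.
under eq_integral do rewrite XY.
have t01 : 0 < (3^-1 : R) < 1 by apply/andP; split; lra.
have mX : measurable_fun setT X.
  apply: measurable_funM; first by apply: measurable_grid_prod => //; exact: ltnW.
  by apply: measurable_funB; exact: measurable_V.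
have mY : measurable_fun setT Y.
  apply: measurable_funM; last exact: measurable_V.
  by apply: measurable_funB; apply: measurable_grid_prod => //; exact: ltnW.
apply: le_trans (powR_add_integral_le p1 t01 mX mY XB YB) _.
have k0 : 0 <= kappa ^+ m by exact: exprn_ge0.
have three : 3^-1 `^ (1 - p) <= 3 :> R.
  have p2' := p2.
  rewrite -(powR_inv1 (ler0n _ 3)) -powRrM -[leRHS]powRr1// ler_powR//; lra.
have -> : 1 - 3^-1 = 2 / 3 :> R by field.
rewrite lee_fin.
apply: (@le_trans _ _ (3 * (kappa ^+ m.+1 * (K * rho)) +
    7 / 8 * (rough_const * kappa ^+ m.+1 * rho))); last first.
  by rewrite /rough_const; lra.
apply: lerD.
  apply: ler_pM => //; rewrite ?powR_ge0 ?mulr_ge0//.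
  rewrite ler_wpM2r ?mulr_ge0// exprS ler_peMl//.
have -> : rough_const * kappa ^+ m.+1 * rho = rough_const * kappa ^+ m * kappa * rho.
  by rewrite exprSr; ring.
apply: (@le_trans _ _ ((2 / 3) `^ (1 - p) *
    (rough_const * kappa ^+ m * ((2^-1) `^ (p / 2) * rho) * kappa))).
  rewrite ler_wpM2l ?powR_ge0// ler_wpM2r// ler_wpM2l// mulr_ge0//.
rewrite (_ : _ * _ = ((2 / 3) `^ (1 - p) * (2^-1) `^ (p / 2)) *
  (rough_const * kappa ^+ m * kappa * rho)); last by ring.
by rewrite ler_wpM2r// !mulr_ge0.
Qed.

(** The increment of the density from level m to level m + 1, in a form that shows the centered
    factor. *)
Definition grid_diff (m j : nat) (w : T) : R := grid_prod m j w * (V m j w - 1).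

Lemma grid_diffE m j w : grid_diff m j w = grid_prod m.+1 j w - grid_prod m j w.
Proof. by rewrite /grid_diff /grid_prod big_ord_recr/= mulrBr mulr1. Qed.

Lemma measurable_grid_diff m j : (m < n)%N -> (j < b ^ n)%N ->
  measurable_fun setT (grid_diff m j).
Proof.
move=> mn jn; apply: measurable_funM.
  by apply: measurable_grid_prod => //; exact: ltnW.
by apply: measurable_funB => //; exact: measurable_V.
Qed.

Let half_powR : (2^-1) `^ (1 - p) <= 2 :> R.
Proof.
have p2' := p2.
by rewrite -(powR_inv1 (ler0n _ 2)) -powRrM -[leRHS]powRr1// ler_powR//; lra.
Qed.

Let sum_moment_le (X Y : T -> R) (A : R) : 0 <= A ->
  measurable_fun setT X -> measurable_fun setT Y ->
  (\int[P]_w (`|X w| `^ p)%:E <= A%:E)%E -> (\int[P]_w (`|Y w| `^ p)%:E <= A%:E)%E ->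
  (\int[P]_w (`|X w - Y w| `^ p)%:E <= (4 * A)%:E)%E.
Proof.
move=> A0 mX mY XA YA.
have YA' : (\int[P]_w (`|- Y w| `^ p)%:E <= A%:E)%E.
  by under eq_integral do rewrite normrN.
have t01 : 0 < (2^-1 : R) < 1 by apply/andP; split; lra.
have mNY : measurable_fun setT (fun w => - Y w) by exact: measurableT_comp.
apply: le_trans (powR_add_integral_le p1 t01 mX mNY XA YA') _.
have -> : 1 - 2^-1 = 2^-1 :> R by field.
rewrite lee_fin; have := ler_wpM2r A0 half_powR; lra.
Qed.

Lemma grid_diff_moment m j : (m < n)%N -> (j < b ^ n)%N ->
  (\int[P]_w (`|grid_diff m j w| `^ p)%:E <= (4 * kappa ^+ m.+1)%:E)%E.
Proof.
move=> mn jn; under eq_integral do rewrite grid_diffE.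
apply: sum_moment_le.
- exact: exprn_ge0.
- exact: measurable_grid_prod.
- by apply: measurable_grid_prod => //; exact: ltnW.
- exact: grid_prod_moment.
- apply: le_trans (grid_prod_moment (ltnW mn) jn) _.
  by rewrite lee_fin exprS ler_peMl ?exprn_ge0.
Qed.

Lemma grid_diff_increment m j h : (m < n)%N -> (j + h < b ^ n)%N ->
  ((j + h) %/ b ^ (n - m.+1) = j %/ b ^ (n - m.+1))%N ->
  (\int[P]_w (`|grid_diff m (j + h)%N w - grid_diff m j w| `^ p)%:E
    <= (4 * (rough_const * kappa ^+ m.+1
             * (h%:R / (b ^ (n - m.+1))%:R) `^ (p / 2)))%:E)%E.
Proof.
move=> mn jhn same; have jn : (j < b ^ n)%N by exact: leq_ltn_trans (leq_addr _ _) jhn.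
have K24 : 0 <= rough_const by rewrite mulr_ge0.
have bpow : (b ^ (n - m) = b ^ (n - m.+1) * b)%N by rewrite -expnSr subnSK.
have E w : grid_diff m (j + h)%N w - grid_diff m j w =
    (grid_prod m.+1 (j + h)%N w - grid_prod m.+1 j w)
    - (grid_prod m (j + h)%N w - grid_prod m j w).
  by rewrite !grid_diffE; ring.
under eq_integral do rewrite E.
apply: sum_moment_le.
- by rewrite !mulr_ge0 ?exprn_ge0 ?powR_ge0.
- by apply: measurable_funB; exact: measurable_grid_prod.
- by apply: measurable_funB; apply: measurable_grid_prod => //; exact: ltnW.
- exact: grid_prod_increment.
- have same' : ((j + h) %/ b ^ (n - m) = j %/ b ^ (n - m))%N.
    by rewrite bpow !divnMA same.
  apply: le_trans (grid_prod_increment (ltnW mn) jhn same') _.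
  rewrite lee_fin; apply: ler_pM; rewrite ?mulr_ge0 ?exprn_ge0 ?powR_ge0//.
    by rewrite ler_wpM2l// exprS ler_peMl ?exprn_ge0.
  apply: ge0_ler_powR.
  + by rewrite divr_ge0// ltW.
  + by rewrite nnegrE divr_ge0.
  + by rewrite nnegrE divr_ge0.
  + rewrite ler_wpM2l// lef_pV2 ?posrE ?ltr0n ?expn_gt0 ?b0//.
    by rewrite ler_nat leq_pexp2l// leq_sub2l.
Qed.

End GridArray.

(** * Moment estimates for one level of the cascade *)

Section MixedMoments.
Variable R : realType.

Lemma lqgrad_le (q n : nat) (p : R) (x : 'I_n -> R) i :
  (2 < q)%N -> 1 < p -> p <= 2 ->
  `|lqgrad q p x i| <= lqnorm q x `^ (p - 1).
Proof.
move=> q3 p1 p2; have q0 : (0 < q)%N by exact: ltn_trans q3.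
rewrite /lqgrad normrM (ger0_norm (powR_ge0 _ _)) normrX.
have [a0|a0] := eqVneq (lqnorm q x) 0.
  rewrite a0 powR0 ?mul0r ?powR_ge0// subr_eq0 lt_eqF//.
  by rewrite (le_lt_trans p2)// ltr_nat.
have -> : p - 1 = (p - q%:R) + q.-1%:R by rewrite -subn1 natrB//; ring.
rewrite (@powRD _ (lqnorm q x) (p - q%:R)) ?a0 ?implybT// powR_mulrn ?lqnorm_ge0//.
rewrite ler_wpM2l ?powR_ge0// lerXn2r ?nnegrE ?lqnorm_ge0//.
exact: ler_lqnorm.
Qed.

(** Used with a the l^q norm of a partial sum and m the modulus of a density value: finite p-th
    moments of both make the gradient term integrable. *)
Lemma powR_mixed_le (a m p : R) : 1 < p -> 0 <= a -> 0 <= m ->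
  a `^ (p - 1) * m <= a `^ p + m `^ p.
Proof.
move=> p1 a0 m0; have p0 : 0 < p by exact: lt_trans p1.
have [ma|am] := leP m a.
  rewrite (le_trans (y := a `^ p)) ?lerDl ?powR_ge0//.
  by rewrite -(mulr_powRB1 a0 p0) mulrC ler_wpM2r ?powR_ge0.
rewrite (le_trans (y := m `^ p)) ?lerDr ?powR_ge0//.
rewrite -(mulr_powRB1 m0 p0) mulrC ler_wpM2l//.
by apply: ge0_ler_powR; rewrite ?nnegrE// ?subr_ge0 ltW.
Qed.

Lemma sum_blocks (f : nat -> R) (K L : nat) :
  \sum_(j < K * L) f j = \sum_(k < K) \sum_(j < L) f (k * L + j)%N.
Proof.
elim: K => [|K IH]; first by rewrite mul0n !big_ord0.
by rewrite mulSnr big_split_ord/= IH big_ord_recr.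
Qed.

End MixedMoments.

Section KeyEstimate.
Context d (T : measurableType d) (R : realType) (P : probability T R).
Context (b n : nat) (p kappa K : R) (I : eqType) (F : I -> set (set T)).
Context (idx : nat -> nat -> I) (V : nat -> nat -> T -> R).
Hypothesis hV : grid_array P b n p kappa K F idx V.
Hypotheses (b2 : (2 <= b)%N) (p1 : 1 < p) (p2 : p <= 2).
Hypotheses (kappa1 : 1 <= kappa) (K0 : 0 <= K).
Variables (q m N : nat).
Hypotheses (q3 : (2 < q)%N) (qeven : ~~ odd q) (mn : (m < n)%N).
Local Notation L := (b ^ (n - m.+1))%N.
Local Notation D := (grid_diff V m).
Implicit Types (c : 'I_N -> nat -> R).

Let p0 : 0 < p. Proof. exact: lt_trans p1. Qed.
Let b0 : (0 < b)%N. Proof. exact: ltnW. Qed.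
Let L0 : (0 < L)%N. Proof. by rewrite expn_gt0 b0. Qed.

Let block_total : (b ^ n = b ^ m.+1 * L)%N.
Proof. by rewrite -expnD subnKC. Qed.

Let block_lt k j : (k < b ^ m.+1)%N -> (j < L)%N -> (k * L + j < b ^ n)%N.
Proof.
move=> km jL; rewrite block_total (leq_trans (n := k.+1 * L))//.
  by rewrite mulSnr ltn_add2l.
by rewrite leq_mul2r km orbT.
Qed.

Let block_div k j : (j < L)%N -> ((k * L + j) %/ L = k)%N.
Proof. by move=> jL; rewrite divnMDl// divn_small// addn0. Qed.

(** Contribution to frequency number x of the k-th interval of length b^-(m+1), which contains [L]
    grid points. *)
Definition block_sum c (k : nat) (x : 'I_N) (w : T) : R :=
  \sum_(j < L) D (k * L + j)%N w * c x (k * L + j)%N.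

Lemma measurable_block_sum c k x : (k < b ^ m.+1)%N ->
  measurable_fun setT (block_sum c k x).
Proof.
move=> km; apply: measurable_sum => j; apply: measurable_funM => //.
by apply: (measurable_grid_diff hV mn); exact: block_lt.
Qed.

(** The previous blocks and the coarser levels do not involve the process attached to block k at the
    current level. Each summand is thus a variable independent of [V m j], times the centered factor
    [V m j - 1]. *)
Lemma block_centered c k x : (k < b ^ m.+1)%N ->
  (\int[P]_w (lqnorm q (fun x => \sum_(l < k) block_sum c l x w) `^ p)%:E < +oo)%E ->
  has_mean P
    (fun w => lqgrad q p (fun x => \sum_(l < k) block_sum c l x w) x
      * block_sum c k x w) 0.
Proof.
move=> km fin; set S := fun x w => \sum_(l < k) block_sum c l x w.
have mS y : measurable_fun setT (S y).
  apply: measurable_sum => l; apply: measurable_block_sum.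
  exact: ltn_trans (ltn_ord l) km.
pose G w := lqgrad q p (S ^~ w) x.
have mG : measurable_fun setT G by exact: measurable_lqgrad.
suff H (j : 'I_L) : has_mean P
    (fun w => G w * grid_prod V m (k * L + j)%N w * (V m (k * L + j)%N w - 1)) 0.
  have := has_mean_sum (fun j : 'I_L => has_meanZ (c x (k * L + j)%N) (H j)).
  rewrite big1 => [|j _]; last by rewrite mulr0.
  congr (has_mean _ _); apply/funext => w; rewrite /block_sum mulr_sumr.
  by apply: eq_bigr => j _; rewrite /G /grid_diff; ring.
set j0 := (k * L + j)%N; have j0n : (j0 < b ^ n)%N by exact: block_lt.
have mM : measurable_fun setT (grid_prod V m j0).
  by apply: (measurable_grid_prod hV) => //; exact: ltnW.
apply: indep_centered.
(* Integrability: the gradient is at most the power p - 1 of the norm of S, and the mixed moment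
   with the density value is controlled by two p-th moments. *)
- have mSp : measurable_fun setT (fun w => lqnorm q (S ^~ w) `^ p).
    by apply: measurable_fun_powR; exact: measurable_lqnorm.
  have finE : (\int[P]_w (lqnorm q (S ^~ w) `^ p)%:E
      <= (fine (\int[P]_w (lqnorm q (S ^~ w) `^ p)%:E))%:E)%E.
    rewrite fineK// ge0_fin_numE//; apply: integral_ge0 => w _.
    by rewrite lee_fin powR_ge0.
  have [r1 h1 _] := ge0_has_mean mSp (fun w => powR_ge0 _ _) finE.
  have [r2 h2 _] := ge0_has_mean
    (measurable_fun_powR p (measurableT_comp (@normr_measurable R setT) mM))
    (fun w => powR_ge0 _ _) (grid_prod_moment hV (ltnW mn) j0n).
  apply: le_integrable (has_meanD h1 h2).1 => //.
    by apply/measurable_EFinP; exact: measurable_funM.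
  move=> w _; rewrite /= lee_fin.
  rewrite [leRHS]ger0_norm ?addr_ge0 ?powR_ge0// normrM.
  apply: le_trans (powR_mixed_le p1 (lqnorm_ge0 q (S ^~ w)) (normr_ge0 _)).
  by rewrite ler_wpM2r// lqgrad_le.
- exact: (ga_mean hV).
- apply: (indep_of_others hV (i := idx m j0)); last exact: (ga_meas hV).
  (* A factor avoids the process at [j0] if its level is coarser or if its block is not the k-th. *)
  have mprod t j' : (t <= m)%N -> (j' < b ^ n)%N ->
      ((t < m)%N \/ (j' %/ L)%N <> k) -> (t < n)%N ->
      sub_measurable (sigma_others F (idx m j0)) (V t j').
    move=> tm j'n tk tn; apply: (sub_measurable_others hV) => //.
    move=> /(ga_idx hV tn mn j'n j0n)[tE]; rewrite tE /j0 block_div//.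
    by case: tk => // tm'; move: tm'; rewrite tE ltnn.
  have mpr j' : (j' < b ^ n)%N ->
      sub_measurable (sigma_others F (idx m j0)) (grid_prod V m j').
    move=> j'n; apply: measurable_prod => t _; apply: mprod => //.
    + exact: ltnW.
    + by left.
    + exact: ltn_trans mn.
  apply: measurable_funM; last exact: mpr.
  apply: measurable_lqgrad => y; apply: measurable_sum => l.
  have lb : (l < b ^ m.+1)%N by exact: ltn_trans km.
  apply: measurable_sum => j'; apply: measurable_funM => //.
  apply: measurable_funM; first by apply: mpr; exact: block_lt.
  apply: measurable_funB => //; apply: mprod => //; first exact: block_lt.
  by right; rewrite block_div// => lk; move: (ltn_ord l); rewrite lk ltnn.
Qed.

(** The bound [A k] is uniform in the frequencies, so a block costs N^(p/q) B. The two estimates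
    below differ only in the choice of [A]. *)
Lemma block_martingale c (A : nat -> T -> R) (B : R) :
  (forall k, (k < b ^ m.+1)%N -> measurable_fun setT (A k)) ->
  (forall k x w, (k < b ^ m.+1)%N -> `|block_sum c k x w| <= A k w) ->
  (forall k, (k < b ^ m.+1)%N -> (\int[P]_w (`|A k w| `^ p)%:E <= B%:E)%E) ->
  (\int[P]_w (lqnorm q (fun x => \sum_(j < b ^ n) D j w * c x j) `^ p)%:E
    <= ((b ^ m.+1)%:R * (lqconst R q * (N%:R `^ (p / q%:R) * B)))%:E)%E.
Proof.
move=> mA cA AB; have q0 : (0 < q)%N by exact: ltn_trans q3.
have E w : (fun x => \sum_(j < b ^ n) D j w * c x j) =
    (fun x => \sum_(k < b ^ m.+1) block_sum c k x w).
  apply/funext => x; rewrite /block_sum -(sum_blocks (fun j => D j w * c x j)).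
  by rewrite -block_total.
under eq_integral do rewrite E.
apply: lqnorm_martingale => //.
- by move=> k x km; exact: measurable_block_sum.
- move=> k km; apply: (@le_ge0_integral _ _ _ _ _
    (fun w => N%:R `^ (p / q%:R) * `|A k w| `^ p)).
  + apply: measurable_fun_powR; apply: measurable_lqnorm => x.
    exact: measurable_block_sum.
  + apply: measurable_funM => //; apply: measurable_fun_powR.
    by apply: measurableT_comp => //; exact: mA.
  + by move=> w; exact: powR_ge0.
  + move=> w; rewrite mulrC [p / _]mulrC powRrM mulrC -powRM ?powR_ge0//.
    apply: ge0_ler_powR; rewrite ?nnegrE ?lqnorm_ge0 ?mulr_ge0 ?powR_ge0 ?(ltW p0)//.
    apply: lqnorm_le => // x; rewrite (le_trans (cA k x w km))//.
    exact: ler_norm.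
  + apply: ge0_integralZ_le; rewrite ?powR_ge0//; last exact: AB.
    apply: measurable_fun_powR; apply: measurableT_comp => //; exact: mA.
- by move=> k x km; exact: block_centered.
Qed.

(** The cosines are only bounded by 1: all cancellation comes from the independence of the blocks.
    This serves the fine levels. *)
Lemma key_estimate c : (forall x j, `|c x j| <= 1) ->
  (\int[P]_w (lqnorm q (fun x => \sum_(j < b ^ n) D j w * c x j) `^ p)%:E
    <= ((b ^ m.+1)%:R * (lqconst R q * (N%:R `^ (p / q%:R) *
         (L%:R `^ p * (4 * kappa ^+ m.+1)))))%:E)%E.
Proof.
move=> c1; pose A k w := \sum_(j < L) `|D (k * L + j)%N w|.
apply: (@block_martingale c A).
- move=> k km; apply: measurable_sum => j; apply: measurableT_comp => //.
  by apply: (measurable_grid_diff hV mn); exact: block_lt.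
- move=> k x w km; rewrite (le_trans (ler_norm_sum _ _ _))// ler_sum// => j _.
  by rewrite normrM ler_piMr.
- move=> k km; under eq_integral do rewrite ger0_norm ?sumr_ge0//.
  apply: powR_sum_integral_le => //.
  + move=> j; apply: measurableT_comp => //.
    by apply: (measurable_grid_diff hV mn); exact: block_lt.
  + by move=> j; apply: (grid_diff_moment hV) => //; exact: block_lt.
Qed.

(** The factor 4 is the price of a difference of two levels; [rough_const K] stands for the interior
    increments and 1 for the boundary values. *)
Definition smooth_const : R := 4 * (rough_const K + 1).

(** Inside a block [oscillatory_sum_le] replaces the sum by the h-variation, at the cost of 1 / e.
    Interior increments have moments of order (h / L)^(p/2); each boundary sum has h terms, and (h /
    L)^p <= (h / L)^(p/2). The factor 3^p comes from adding the three sums. *)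
Lemma key_estimate_smooth (theta delta : 'I_N -> R) (h : nat) (e : R) :
  0 < e -> (0 < h <= L)%N -> (forall x, e <= 1 - cos (h%:R * delta x)) ->
  (\int[P]_w (lqnorm q (fun x => \sum_(j < b ^ n) D j w *
       cos (theta x + j%:R * delta x)) `^ p)%:E
    <= ((b ^ m.+1)%:R * (lqconst R q * (N%:R `^ (p / q%:R) *
         (e^-1 `^ p * (3 `^ p * (L%:R `^ p *
           (smooth_const * kappa ^+ m.+1 * (h%:R / L%:R) `^ (p / 2))))))))%:E)%E.
Proof.
move=> e0 /andP[h0 hL] he; set rho := (_ / _) `^ _.
have kap0 : 0 <= kappa ^+ m.+1 by rewrite exprn_ge0// (le_trans _ kappa1).
have rho0 : 0 <= rho by exact: powR_ge0.
have rc0 : 0 <= rough_const K by rewrite mulr_ge0.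
have LR0 : 0 < L%:R :> R by rewrite ltr0n.
pose g k w (j : nat) := D (k * L + j)%N w.
pose A k w := e^-1 * variation_bound L h (g k w).
have vb0 k w : 0 <= variation_bound L h (g k w).
  by rewrite !addr_ge0// sumr_ge0.
have mD k j : (k < b ^ m.+1)%N -> (j < L)%N -> measurable_fun setT (g k ^~ j).
  by move=> km jL; apply: (measurable_grid_diff hV mn); exact: block_lt.
have hlt (j : 'I_h) : (j < L)%N by exact: leq_trans hL.
have hlt' (j : 'I_h) : (L - h + j < L)%N.
  by rewrite -ltn_subRL subKn.
have llt (j : 'I_(L - h)) : (j + h < L)%N.
  by rewrite addnC -ltn_subRL.
have llt' (j : 'I_(L - h)) : (j < L)%N.
  by rewrite (leq_trans (ltn_ord j))// leq_subr.
pose Z k (i : 'I_3) : T -> R :=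
  if i == 0 :> nat then fun w => \sum_(j < L - h) `|g k w j - g k w (j + h)%N|
  else if i == 1%N :> nat then fun w => \sum_(j < h) `|g k w j|
  else fun w => \sum_(j < h) `|g k w (L - h + j)%N|.
have vbE k w : variation_bound L h (g k w) = \sum_(i < 3) Z k i w.
  by rewrite !big_ord_recl big_ord0 /Z /variation_bound/= addr0 addrA.
have mZ k i : (k < b ^ m.+1)%N -> measurable_fun setT (Z k i).
  move=> km; rewrite /Z; case: ifP => _; last case: ifP => _.
  - apply: measurable_sum => j; apply: measurableT_comp => //.
    by apply: measurable_funB; apply: mD.
  - by apply: measurable_sum => j; apply: measurableT_comp => //; exact: mD.
  - by apply: measurable_sum => j; apply: measurableT_comp => //; exact: mD.
have Z0 k i w : 0 <= Z k i w.
  by rewrite /Z; case: ifP => _; last case: ifP => _; exact: sumr_ge0.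
have hLrho : (h%:R / L%:R) `^ p <= rho.
  have hL1 : h%:R / L%:R <= 1 :> R by rewrite ler_pdivrMr// mul1r ler_nat.
  have p2' := p0; rewrite ger_powR//; last by lra.
  by rewrite hL1 andbT divr_gt0 ?ltr0n.
have bdry k (f : 'I_h -> nat) : (k < b ^ m.+1)%N -> (forall j, (f j < L)%N) ->
    (\int[P]_w ((\sum_(j < h) `|g k w (f j)|) `^ p)%:E <=
     (L%:R `^ p * (smooth_const * kappa ^+ m.+1 * rho))%:E)%E.
  move=> km fL; apply: le_trans (powR_sum_integral_le p1 _ _
    (fun j => grid_diff_moment hV p1 p2 kappa1 mn (block_lt km (fL j)))) _.
  - by move=> j; apply: measurableT_comp => //; exact: mD.
  - by move=> j w; exact: normr_ge0.
  - rewrite lee_fin; have -> : h%:R = L%:R * (h%:R / L%:R) :> R.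
      by rewrite mulrC divfK// gt_eqF.
    rewrite powRM ?divr_ge0// -mulrA ler_wpM2l ?powR_ge0// mulrC.
    apply: ler_pM; rewrite ?mulr_ge0 ?powR_ge0//.
    by rewrite ler_wpM2r// /smooth_const; lra.
apply: (@block_martingale (fun x j => cos (theta x + j%:R * delta x)) A).
- move=> k km; apply: measurable_funM => //.
  under eq_fun do rewrite vbE; apply: measurable_sum => i; exact: mZ.
- move=> k x w km; rewrite /A -ler_pdivrMl ?invr_gt0// invrK.
  have := oscillatory_sum_le (g k w) (theta x + (k * L)%:R * delta x) (delta x) hL.
  apply: le_trans; rewrite /block_sum.
  apply: ler_pM; rewrite ?(ltW e0)//.
  rewrite le_eqVlt; apply/orP; left; apply/eqP; congr `|_|.
  apply: eq_bigr => j _; rewrite /g; congr (_ * cos _).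
  by rewrite natrD; ring.
- move=> k km; have eV0 : 0 <= e^-1 by rewrite invr_ge0 ltW.
  under eq_integral do rewrite ger0_norm ?mulr_ge0// powRM//.
  apply: ge0_integralZ_le; rewrite ?powR_ge0//.
  + apply: measurable_fun_powR; under eq_fun do rewrite vbE.
    by apply: measurable_sum => i; exact: mZ.
  + by move=> w; exact: powR_ge0.
  + under eq_integral do rewrite vbE.
    apply: powR_sum_integral_le => // [i|i]; first exact: mZ.
    rewrite /Z; case: ifP => _; last case: ifP => _; [|exact: bdry|exact: bdry].
    apply: (@le_trans _ _ ((L - h)%:R `^ p *
        (4 * (rough_const K * kappa ^+ m.+1 * rho)))%:E).
      apply: powR_sum_integral_le => // j.
        apply: measurableT_comp => //.
        by apply: measurable_funB; apply: mD.
      under eq_integral do rewrite distrC.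
      have := grid_diff_increment hV b2 p1 p2 kappa1 K0 mn (j := k * L + j) (h := h).
      rewrite -addnA !block_div//; apply => //.
      exact: block_lt.
    rewrite lee_fin; apply: ler_pM; rewrite ?mulr_ge0 ?powR_ge0//.
      by apply: ge0_ler_powR; rewrite ?nnegrE ?(ltW p0)// ler_nat leq_subr.
    have -> : 4 * (rough_const K * kappa ^+ m.+1 * rho) =
        4 * rough_const K * kappa ^+ m.+1 * rho by ring.
    by rewrite ler_wpM2r// ler_wpM2r// /smooth_const; lra.
Qed.

End KeyEstimate.

(** * The cascade as a grid array *)

Section CascadeGrid.
Context (R : realType) (b : nat).
Hypothesis b2 : (2 <= b)%N.

Let b0 : (0 < b)%N. Proof. exact: ltnW. Qed.
Let bR0 : 0 < b%:R :> R. Proof. by rewrite ltr0n. Qed.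

Lemma expb_gt0 t : (0 < b ^ t)%N. Proof. by rewrite expn_gt0 b0. Qed.

(* The interval of level t+1 whose index is i, for i < b^(t+1). *)
Definition block_index (t i : nat) : cascade_index b :=
  Tagged (fun t => 'I_(b ^ t.+1)) (insubd (Ordinal (expb_gt0 t.+1)) i).

Lemma block_indexE t i : (i < b ^ t.+1)%N -> tagged (block_index t i) = i :> nat.
Proof. by move=> it; rewrite /block_index/= val_insubd it. Qed.

Definition grid_index (n t j : nat) : cascade_index b :=
  block_index t (j %/ b ^ (n - t.+1)).

Definition grid_point (n j : nat) : R := j%:R / b%:R ^+ n.

Definition grid_value (Omega : Type) (WI : cascade_index b -> R -> Omega -> R)
  (n t j : nat) : Omega -> R := WI (grid_index n t j) (grid_point n j).

Lemma grid_split n t : (t < n)%N -> (b ^ n = b ^ t.+1 * b ^ (n - t.+1))%N.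
Proof. by move=> tn; rewrite -expnD subnKC. Qed.

Lemma grid_block_lt n t j : (t < n)%N -> (j < b ^ n)%N ->
  (j %/ b ^ (n - t.+1) < b ^ t.+1)%N.
Proof. by move=> tn jn; rewrite ltn_divLR ?expb_gt0// -grid_split. Qed.

(** The position of the grid point inside its interval, rescaled to [0, 1[: this is the time at
    which W is evaluated. *)
Lemma grid_local_coord n t j : (t < n)%N -> (j < b ^ n)%N ->
  b%:R ^+ (tag (grid_index n t j)).+1 *
    (grid_point n j - left_end R (grid_index n t j)) =
  (j %% b ^ (n - t.+1))%:R / (b ^ (n - t.+1))%:R.
Proof.
move=> tn jn; rewrite /left_end block_indexE; last exact: grid_block_lt.
rewrite /grid_point /= {1}(divn_eq j (b ^ (n - t.+1))) natrD natrM.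
have -> : b%:R ^+ n = b%:R ^+ t.+1 * (b ^ (n - t.+1))%:R :> R.
  by rewrite -natrX (grid_split tn) natrM natrX.
have L0 : (b ^ (n - t.+1))%:R != 0 :> R by rewrite pnatr_eq0 -lt0n expb_gt0.
have B0 : b%:R ^+ t.+1 != 0 :> R by rewrite expf_neq0// gt_eqF.
by field; rewrite L0 B0.
Qed.

Lemma grid_coord_itv n t j :
  0 <= (j %% b ^ (n - t.+1))%:R / ((b ^ (n - t.+1))%:R : R) < 1.
Proof.
have L0 : 0 < (b ^ (n - t.+1))%:R :> R by rewrite ltr0n expb_gt0.
by rewrite divr_ge0 ?(ltW L0)//= ltr_pdivrMr// mul1r ltr_nat ltn_mod expb_gt0.
Qed.

Lemma badic_interval_coord (I : cascade_index b) x :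
  badic_interval R I x <->
  0 <= b%:R ^+ (tag I).+1 * (x - left_end R I) < 1.
Proof.
rewrite /badic_interval /= in_itv/=.
have B0 : 0 < b%:R ^+ (tag I).+1 :> R by rewrite exprn_gt0.
rewrite pmulr_rge0// subr_ge0.
have -> : (b%:R ^+ (tag I).+1 * (x - left_end R I) < 1) = (x < right_end R I).
  have -> : right_end R I = left_end R I + (b%:R ^+ (tag I).+1)^-1.
    by rewrite /right_end /left_end -natr1 mulrDl mul1r.
  by rewrite -ltrBlDl -ltr_pdivlMl// mulr1.
by [].
Qed.

Lemma grid_point_in n t j : (t < n)%N -> (j < b ^ n)%N ->
  badic_interval R (grid_index n t j) (grid_point n j).
Proof.
move=> tn jn; apply/badic_interval_coord; rewrite grid_local_coord//.
exact: grid_coord_itv.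
Qed.

Section Family.
Context d d' (Omega : measurableType d) (Omega' : measurableType d').
Context (P : probability Omega R) (P' : probability Omega' R).
Context (B : R -> Omega' -> R) (WI : cascade_index b -> R -> Omega -> R).
Variable sigma : R.
Hypothesis hB : brownian_motion01 P' B.
Hypothesis hWI : cascade_family P P' (geometric_bm sigma B) WI.
Local Notation W := (geometric_bm sigma B).

Definition gbm_kappa (p : R) : R := expR (p * (p - 1) * sigma ^+ 2 / 2).
Definition gbm_holder (p : R) : R :=
  gbm_kappa p * (2 * (sigma ^+ 2 * expR (sigma ^+ 2)) `^ (p / 2)).

Let mX (I : cascade_index b) t : badic_interval R I t -> measurable_fun setT (WI I t).
Proof. exact: (cf_measurable hWI). Qed.

Let mY (I : cascade_index b) t : badic_interval R I t ->
  measurable_fun setT (W (b%:R ^+ (tag I).+1 * (t - left_end R I))).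
Proof.
by move=> /badic_interval_coord/andP[? /ltW ?]; exact: (measurable_gbm _ hB).
Qed.

Let W_on (I : cascade_index b) t := W (b%:R ^+ (tag I).+1 * (t - left_end R I)).

Let family_has_mean (I : cascade_index b) (F : (R -> R) -> R) (r : R) :
  measurable_fun [set: path_space (badic_interval R I)]
    (F : path_space (badic_interval R I) -> R) ->
  has_mean P' (fun w => F (W_on I ^~ w)) r -> has_mean P (fun w => F (WI I ^~ w)) r.
Proof.
move=> mF hY.
exact: (@same_law_has_mean _ _ _ _ _ P P' _ (WI I) (W_on I) (@mX I) (@mY I)
  (cf_law hWI (I:=I)) F r mF hY).
Qed.

Let family_integral (I : cascade_index b) (F : (R -> R) -> R) (g : R -> \bar R) :
  measurable_fun [set: path_space (badic_interval R I)]
    (F : path_space (badic_interval R I) -> R) ->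
  measurable_fun setT g -> (forall x, 0 <= g x)%E ->
  (\int[P]_w g (F (WI I ^~ w)) = \int[P']_w g (F (W_on I ^~ w)))%E.
Proof.
move=> mF mg g0.
exact: (@same_law_integral _ _ _ _ _ P P' _ (WI I) (W_on I) (@mX I) (@mY I)
  (cf_law hWI (I:=I)) F g mF mg g0).
Qed.

(** Two grid points of the same interval see the same process, so an increment is a functional of
    one path and its moments are those of W. *)
Lemma cascade_grid_array (n : nat) (p : R) : 0 < sigma -> 1 < p -> p <= 2 ->
  grid_array P b n p (gbm_kappa p) (gbm_holder p)
    (fun I => process_sigma (badic_interval R I) (WI I))
    (grid_index n) (grid_value WI n).
Proof.
move=> sig0 p1 p2; have p0 : 0 < p by exact: lt_trans p1.
have mabs : measurable_fun setT (fun x : R => (`|x| `^ p)%:E).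
  by apply/measurable_EFinP; apply: measurable_fun_powR; exact: normr_measurable.
have abs0 (x : R) : (0 <= (`|x| `^ p)%:E)%E by rewrite lee_fin powR_ge0.
split.
- by move=> I; exact: sigma_algebra_process_sigma.
- by move=> I; apply: process_sigma_measurable; exact: mX.
- exact: (cf_independent hWI).
- move=> t t' j j' tn tn' jn jn'; split=> [e|[tt' e]]; last first.
    by rewrite /grid_index; move: e; rewrite tt' => ->.
  have tt' : t = t' by exact: (congr1 tag e).
  split => //; have := congr1 (fun I : cascade_index b => nat_of_ord (tagged I)) e.
  by rewrite !block_indexE//; exact: grid_block_lt.
- move=> t j tn jn _ A mA; rewrite setTI; apply: sub_sigma_algebra.
  apply: (@process_sigma_functional _ _ _ _ _ (fun f => f (grid_point n j))) => //.
  by apply: measurable_eval; exact: grid_point_in.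
- move=> t j tn jn; have xI := grid_point_in tn jn.
  have /andP[u0 /ltW u1] := grid_coord_itv n t j.
  have := @family_has_mean _ (fun f => f (grid_point n j)) 1 (measurable_eval xI).
  by apply; rewrite /W_on grid_local_coord//; exact: gbm_mean.
- move=> t j tn jn; have xI := grid_point_in tn jn.
  have /andP[u0 /ltW u1] := grid_coord_itv n t j.
  have -> := @family_integral _ (fun f => f (grid_point n j)) _
    (measurable_eval xI) mabs abs0.
  by rewrite /W_on grid_local_coord//; exact: gbm_moment.
- move=> t j h tn jhn same.
  have jn : (j < b ^ n)%N by exact: leq_ltn_trans (leq_addr _ _) jhn.
  (* The increment bound for W is stated for distinct times. *)
  have [->|h0] := posnP h.
    under eq_integral do rewrite addn0 subrr normr0 powR0 ?gt_eqF//.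
    by rewrite integral0 lee_fin !mulr_ge0 ?powR_ge0 ?expR_ge0.
  have IE : grid_index n t (j + h)%N = grid_index n t j.
    by rewrite /grid_index same.
  have xI := grid_point_in tn jn; have xI' := grid_point_in tn jhn.
  rewrite IE in xI'.
  have /andP[u0 /ltW u1] := grid_coord_itv n t j.
  have /andP[v0 /ltW v1] := grid_coord_itv n t (j + h)%N.
  have L0 : 0 < (b ^ (n - t.+1))%:R :> R by rewrite ltr0n expb_gt0.
  have vu : ((j + h) %% b ^ (n - t.+1))%:R / (b ^ (n - t.+1))%:R
      - (j %% b ^ (n - t.+1))%:R / (b ^ (n - t.+1))%:R
      = h%:R / (b ^ (n - t.+1))%:R :> R.
    rewrite -mulrBl; congr (_ / _); apply/eqP; rewrite subr_eq -natrD eqr_nat.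
    have := divn_eq (j + h) (b ^ (n - t.+1)).
    rewrite same {1}(divn_eq j (b ^ (n - t.+1))) -addnA => /eqP.
    by rewrite eqn_add2l => /eqP <-; rewrite addnC.
  rewrite /grid_value IE.
  have -> := @family_integral _
    (fun f => f (grid_point n (j + h)) - f (grid_point n j)) _
    (measurable_funB (measurable_eval xI') (measurable_eval xI)) mabs abs0.
  have := grid_local_coord tn jhn; rewrite /W_on IE => ->.
  rewrite grid_local_coord//.
  rewrite -vu; apply: gbm_increment => //.
  by rewrite -subr_gt0 vu divr_gt0// ltr0n.
Qed.

End Family.
End CascadeGrid.

(** * Convergence of Riemann sums *)

Section RiemannSums.
Context (R : realType) (b : nat).
Hypothesis b2 : (2 <= b)%N.
Local Notation mu := (@lebesgue_measure R).
Local Notation gp := (grid_point R b).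

Let bn0 n : 0 < b%:R ^+ n :> R.
Proof. by rewrite exprn_gt0// ltr0n ltnW. Qed.

Definition grid_floor (n : nat) (x : R) : nat := Num.truncn (b%:R ^+ n * x).

Definition grid_cell (n j : nat) : set R := `[gp n j, gp n j.+1[.

Lemma grid_pointS n j : gp n j.+1 = gp n j + (b%:R ^+ n)^-1.
Proof. by rewrite /grid_point -natr1 mulrDl mul1r. Qed.

Lemma grid_cellP n j (x : R) : 0 <= x -> grid_cell n j x <-> j = grid_floor n x.
Proof.
move=> x0; have bx0 : 0 <= b%:R ^+ n * x by rewrite mulr_ge0// ltW.
rewrite /grid_cell /= in_itv/= /grid_point ler_pdivrMr// ltr_pdivlMr//.
rewrite mulrC; split=> [h|->]; last exact: truncn_itv.
by apply/esym/truncn_def.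
Qed.

Lemma grid_floor_lt n (x : R) : 0 <= x < 1 -> (grid_floor n x < b ^ n)%N.
Proof.
move=> /andP[x0 x1]; have bx0 : 0 <= b%:R ^+ n * x by rewrite mulr_ge0// ltW.
rewrite -(ltr_nat R); have /andP[h _] := truncn_itv bx0.
by apply: le_lt_trans h _; rewrite natrX gtr_pMr.
Qed.

Lemma grid_floor_cell n (x : R) : 0 <= x -> grid_cell n (grid_floor n x) x.
Proof. by move=> x0; apply/grid_cellP. Qed.

Lemma cvg_grid_floor (x : R) : 0 <= x ->
  gp n (grid_floor n x) @[n --> \oo] --> x.
Proof.
move=> x0; apply: (@squeeze_cvgr _ _ _ _ (fun n => x - (b%:R ^+ n)^-1) (cst x)).
- apply: nearW => n /=; have := grid_floor_cell n x0.
  rewrite /grid_cell/= in_itv/= grid_pointS => /andP[h1 h2].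
  by rewrite h1 andbT lerBlDr ltW.
- rewrite -[X in _ --> X]subr0; apply: cvgB; first exact: cvg_cst.
  under eq_fun do rewrite -exprVn; apply: cvg_expr.
  by rewrite ger0_norm ?invr_ge0// invf_lt1 ?ltr1n// ltr0n ltnW.
- exact: cvg_cst.
Qed.

(** Boundedness and convergence along left grid approximations: the input of dominated convergence
    for step functions. Unlike continuity, it tolerates the jumps of the densities at b-adic
    points. *)
Definition grid_regular (f : R -> R) (M : R) : Prop := forall x, 0 <= x < 1 ->
  `|f x| <= M /\ f (gp n (grid_floor n x)) @[n --> \oo] --> f x.

Lemma grid_regularM f g M N : grid_regular f M -> grid_regular g N ->
  grid_regular (fun x => f x * g x) (M * N).
Proof.
move=> hf hg x x01; have [f1 f2] := hf x x01; have [g1 g2] := hg x x01.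
by split; [rewrite normrM ler_pM|exact: cvgM].
Qed.

Lemma grid_regular_cst c : grid_regular (fun=> c) `|c|.
Proof. by move=> x _; split=> //; exact: cvg_cst. Qed.

Lemma grid_regular_continuous (f : R -> R) M : continuous f ->
  (forall x, `|f x| <= M) -> grid_regular f M.
Proof.
move=> cf fM x /andP[x0 _]; split=> //.
by apply: (cvg_comp _ f (cvg_grid_floor x0)); exact: cf.
Qed.

Lemma grid_regular_prod m (f : 'I_m -> R -> R) (M : 'I_m -> R) :
  (forall i, grid_regular (f i) (M i)) ->
  grid_regular (fun x => \prod_(i < m) f i x) (\prod_(i < m) M i).
Proof.
elim: m f M => [|m IH] f M h x x01.
  rewrite !big_ord0 normr1; split=> //.
  by under eq_fun do rewrite big_ord0; exact: cvg_cst.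
have := grid_regularM (h ord0) (IH (f \o lift ord0) (M \o lift ord0)
  (fun i => h (lift ord0 i))) x01.
by rewrite !big_ord_recl; under [X in _ -> _ /\ (X @ _ --> _)]eq_fun do rewrite big_ord_recl.
Qed.

Definition riemann_sum (f : R -> R) (n : nat) : R :=
  (b%:R ^+ n)^-1 * \sum_(j < b ^ n) f (gp n j).

Let step (f : R -> R) (n : nat) (x : R) : R :=
  \sum_(j < b ^ n) f (gp n j) * \1_(grid_cell n j) x.

Let stepE f n x : 0 <= x < 1 -> step f n x = f (gp n (grid_floor n x)).
Proof.
move=> x01; have /andP[x0 _] := x01.
rewrite /step (bigD1 (Ordinal (grid_floor_lt n x01)))//= big1 ?addr0.
  by rewrite indicE mem_set ?mulr1//; exact: grid_floor_cell.
move=> j /eqP jx; rewrite indicE memNset ?mulr0// => /(grid_cellP _ _ x0) e.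
by apply: jx; exact: val_inj.
Qed.

Let integral_step f n :
  (\int[mu]_(x in `[0%R, 1%R[) (step f n x)%:E = (riemann_sum f n)%:E)%E.
Proof.
have cell_sub (j : 'I_(b ^ n)) : grid_cell n j `<=` `[0%R, 1%R[.
  move=> x; rewrite /grid_cell/= !in_itv/= => /andP[h1 h2]; apply/andP; split.
    by apply: le_trans h1; rewrite divr_ge0// ltW.
  apply: lt_le_trans h2 _; rewrite ler_pdivrMr// mul1r -natrX ler_nat.
  exact: ltn_ord.
have mcell j : measurable (grid_cell n j) by exact: measurable_itv.
have mucell j : mu (grid_cell n j) = ((b%:R ^+ n)^-1)%:E.
  rewrite /grid_cell lebesgue_measure_itv/= lte_fin grid_pointS.
  by rewrite ltrDl invr_gt0 bn0 -EFinB addrAC subrr add0r.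
have mD : measurable (`[0%R, 1%R[%classic : set (measurableTypeR R)).
  exact: measurable_itv.
have intc (j : 'I_(b ^ n)) : mu.-integrable `[0%R, 1%R[ (EFin \o \1_(grid_cell n j)).
  apply: (integrableS measurableT) => //; apply/integrableP; split.
    by apply/measurable_EFinP; apply: measurable_indic; exact: mcell.
  under eq_integral do rewrite /= ger0_norm//.
  rewrite integral_indic//; last exact: mcell.
  by rewrite setIidl; [rewrite [ltLHS]mucell ltry|move=> x _].
rewrite /step; under eq_integral do rewrite -sumEFin.
rewrite integral_sum//=; last first.
  by move=> j; exact: (integrableZl mD (f (gp n j)) (intc j)).
rewrite /riemann_sum mulr_sumr -sumEFin; apply: eq_bigr => j _.
under eq_integral do rewrite EFinM.
rewrite integralZl//; last exact: intc.
rewrite integral_indic//; last exact: measurable_itv.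
rewrite setIidl; last exact: cell_sub.
by rewrite mulrC EFinM; congr (_ * _)%E; exact: mucell.
Qed.

Lemma grid_regular_measurable f M : grid_regular f M ->
  measurable_fun (`[0%R, 1%R[%classic : set (measurableTypeR R)) (EFin \o f).
Proof.
move=> hf; apply: (emeasurable_fun_cvg (fun n x => (step f n x)%:E)).
- move=> n; apply: measurable_funTS; apply/measurable_EFinP.
  apply: measurable_sum => j; apply: measurable_funM => //.
  by apply: measurable_indic; exact: measurable_itv.
- move=> x; rewrite /= in_itv/= => x01; have [_ h] := hf x x01.
  apply: cvg_EFin; first exact: nearW.
  by under eq_fun do rewrite /= stepE//.
Qed.

(** A Riemann sum is the integral of a step function over [0, 1[, to which dominated convergence
    applies; the point 1 has measure 0. *)
Lemma riemann_sum_cvg f M : grid_regular f M ->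
  (riemann_sum f n)%:E @[n --> \oo] --> (\int[mu]_(x in `[0%R, 1%R]) (f x)%:E)%E.
Proof.
move=> hf; have mf := grid_regular_measurable hf.
rewrite -integral_itv_bndo_bndc//.
under eq_fun do rewrite -integral_step.
apply: (@dominated_cvg _ _ _ mu _ _ _ _ (cst M%:E)).
- exact: measurable_itv.
- move=> n; apply: measurable_funTS; apply/measurable_EFinP.
  apply: measurable_sum => j; apply: measurable_funM => //.
  by apply: measurable_indic; exact: measurable_itv.
- move=> x; rewrite /= in_itv/= => x01; have [_ h] := hf x x01.
  apply: cvg_EFin; first exact: nearW.
  by under eq_fun do rewrite /= stepE//.
- by [].
- apply/integrableP; split; first exact: measurable_cst.
  rewrite /= integral_cst/=; last exact: measurable_itv.
  by rewrite lebesgue_measure_itv/= lte01 oppr0 adde0 mule1 ltry.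
- move=> n x; rewrite /= in_itv/= => x01; rewrite stepE// lee_fin.
  have /andP[x0 x1] := x01.
  have g01 : 0 <= gp n (grid_floor n x) < 1.
    have := grid_floor_cell n x0; rewrite /grid_cell/= in_itv/= => /andP[h _].
    by rewrite (le_lt_trans h x1) andbT divr_ge0// ltW.
  by have [] := hf _ g01.
Qed.

Lemma grid_regular_integral_fin f M : grid_regular f M ->
  (\int[mu]_(x in `[0%R, 1%R]) (f x)%:E \is a fin_num)%E.
Proof.
move=> hf; have mf := grid_regular_measurable hf.
rewrite -integral_itv_bndo_bndc//.
have mD : measurable (`[0%R, 1%R[%classic : set (measurableTypeR R)).
  exact: measurable_itv.
suff : mu.-integrable `[0%R, 1%R[ (EFin \o f) by move=> /(integrable_fin_num mD).
apply: (measurable_bounded_integrable mD); first last.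
- exists M; split; first exact: num_real.
  move=> y My x /=; rewrite in_itv/= => x01; have [h _] := hf x x01.
  by rewrite (le_trans h)// ltW.
- exact/measurable_EFinP.
- have : (mu `[0%R, 1%R[%classic = 1)%E.
    by rewrite lebesgue_measure_itv/= lte01 oppr0 adde0.
  by move=> h; rewrite [ltLHS]h ltry.
Qed.

Lemma riemann_sum_cvg_fine f M : grid_regular f M ->
  riemann_sum f n @[n --> \oo] --> fine (\int[mu]_(x in `[0%R, 1%R]) (f x)%:E).
Proof.
move=> hf; apply: (fine_cvg (f := fun n => (riemann_sum f n)%:E)).
by rewrite fineK; [exact: riemann_sum_cvg hf|exact: grid_regular_integral_fin hf].
Qed.

End RiemannSums.

(** * Pathwise regularity of the cascade densities *)

Section CascadeRegularity.
Context (R : realType) (b : nat).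
Hypothesis b2 : (2 <= b)%N.
Context d d' (Omega : measurableType d) (Omega' : measurableType d').
Context (P : probability Omega R) (P' : probability Omega' R).
Context (B : R -> Omega' -> R) (WI : cascade_index b -> R -> Omega -> R).
Variable sigma : R.
Hypothesis sigma0 : 0 < sigma.
Hypothesis hB : brownian_motion01 P' B.
Hypothesis hWI : cascade_family P P' (geometric_bm sigma B) WI.
Local Notation W := (geometric_bm sigma B).
Local Notation gp := (grid_point R b).
Local Notation floor := (@grid_floor R b).

Let bX0 k : 0 < b%:R ^+ k :> R.
Proof. by rewrite exprn_gt0// ltr0n ltnW. Qed.

Lemma badic_grid_cell (I : cascade_index b) :
  badic_interval R I = @grid_cell R b (tag I).+1 (tagged I).
Proof. by []. Qed.

(** The left approximation of x on a finer grid stays in the b-adic interval of x, and so does not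
    see the jumps of the coarser levels. *)
Lemma grid_floor_coarse (l n : nat) (x : R) : (l <= n)%N -> 0 <= x ->
  floor l (gp n (floor n x)) = floor l x.
Proof.
move=> ln x0; have y0 : 0 <= gp n (floor n x) by rewrite divr_ge0// ltW.
apply/esym/(grid_cellP b2) => //; rewrite /grid_cell/= in_itv/=.
have := grid_floor_cell b2 n x0; rewrite /grid_cell/= in_itv/= => /andP[h1 _].
have := grid_floor_cell b2 l x0; rewrite /grid_cell/= in_itv/= => /andP[h3 h4].
rewrite (le_lt_trans h1 h4) andbT /grid_point.
have bn : b%:R ^+ n = b%:R ^+ l * b%:R ^+ (n - l) :> R by rewrite -exprD subnKC.
have -> : (floor l x)%:R / b%:R ^+ l =
    (floor l x)%:R * b%:R ^+ (n - l) / b%:R ^+ n :> R.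
  by rewrite bn; field; rewrite !gt_eqF.
rewrite ler_pM2r ?invr_gt0//.
rewrite -natrX -natrM ler_nat truncn_ge_nat ?mulr_ge0 ?(ltW (bX0 _))//.
rewrite natrM natrX bn mulrAC ler_wpM2r ?(ltW (bX0 _))//.
by move: h3; rewrite /grid_point ler_pdivrMr// mulrC.
Qed.

Lemma cascade_level_floor (t : nat) (w : Omega) (x : R) : 0 <= x < 1 ->
  cascade_level WI t.+1 w x = WI (block_index b2 t (floor t.+1 x)) x w.
Proof.
move=> x01; have /andP[x0 _] := x01; have kb := grid_floor_lt b2 t.+1 x01.
rewrite /cascade_level (bigD1 (Ordinal kb))//= big1 ?addr0 => [|k /eqP kx].
  rewrite badic_grid_cell indicE mem_set ?mulr1; last exact: grid_floor_cell.
  congr (WI _ x w); congr (Tagged _ _); apply: val_inj.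
  by rewrite /= val_insubd kb.
rewrite badic_grid_cell indicE memNset ?mulr0// => /(grid_cellP b2 _ _ x0) e.
by apply: kx; exact: val_inj.
Qed.

Lemma grid_point_itv n j : (j < b ^ n)%N -> 0 <= gp n j < 1.
Proof.
move=> jn; rewrite divr_ge0 ?(ltW (bX0 _))//= ltr_pdivrMr// mul1r -natrX.
by rewrite ltr_nat.
Qed.

(** The link between the cascade and the abstract array. *)
Lemma cascade_density_grid (m n j : nat) (w : Omega) :
  (m <= n)%N -> (j < b ^ n)%N ->
  cascade_density WI m w (gp n j) = grid_prod (grid_value b2 WI n) m j w.
Proof.
move=> mn jn; have x01 := grid_point_itv jn; have /andP[x0 _] := x01.
rewrite /cascade_density big_ord_recl mul1r /grid_prod.
apply: eq_bigr => t _; rewrite lift0 cascade_level_floor//.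
have tn : (t < n)%N by exact: leq_trans mn.
have := grid_point_in R b2 tn jn.
rewrite badic_grid_cell block_indexE; last exact: grid_block_lt.
by move=> /(grid_cellP b2 _ _ x0) <-.
Qed.

(** Boundedness at grid points involves countably many times, so it is an event of the product
    sigma-algebra and can be transferred between processes with the same law. *)
Let bounded_paths (I : cascade_index b) : set (R -> R) :=
  \bigcup_(M : nat) \bigcap_n \bigcap_j
    [set f | badic_interval R I (gp n j) -> `|f (gp n j)| <= M%:R].

Let path_sigma_bounded I : path_sigma (badic_interval R I) (bounded_paths I).
Proof.
suff : measurable (bounded_paths I : set (path_space (badic_interval R I))) by [].
apply: bigcupT_measurable => M; apply: bigcapT_measurable => n.
apply: bigcapT_measurable => j.
have [Ij|nIj] := pselect (badic_interval R I (gp n j)); last first.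
  by rewrite (_ : [set _ | _] = setT)//; apply/seteqP; split=> // f _ /nIj.
have := measurable_eval Ij measurableT (measurable_itv `[- M%:R, M%:R]).
rewrite setTI; congr (measurable _); apply/seteqP; split=> f /=.
  by rewrite in_itv/= ler_norml.
by rewrite in_itv/= ler_norml => /(_ Ij).
Qed.

(** B attains a maximum on [0, 1], and the drift only lowers the exponent. *)
Let gbm_bounded (I : cascade_index b) : {ae P', forall w,
  bounded_paths I ((fun t => W (b%:R ^+ (tag I).+1 * (t - left_end R I))) ^~ w)}.
Proof.
apply: filterS (bm_continuous hB) => w cB.
have [c _ cmax] := EVT_max ler01 cB.
pose M := expR (sigma * B c w).
exists (Num.truncn M).+1 => // n _ j _ /= /(badic_interval_coord b2)/andP[u0 /ltW u1].
have MM : M <= (Num.truncn M).+1%:R by rewrite ltW// truncnS_gt.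
rewrite ger0_norm ?expR_ge0//; apply: le_trans MM; rewrite ler_expR.
rewrite lerBlDr (le_trans (y := sigma * B c w))//.
  by rewrite ler_pM2l// cmax// in_itv/= u0.
by rewrite lerDl mulr_ge0// divr_ge0// sqr_ge0.
Qed.

Let mW (I : cascade_index b) t : badic_interval R I t ->
  measurable_fun setT (W (b%:R ^+ (tag I).+1 * (t - left_end R I))).
Proof.
by move=> /(badic_interval_coord b2)/andP[? /ltW ?]; exact: (measurable_gbm _ hB).
Qed.

Let family_bounded_grid (I : cascade_index b) :
  {ae P, forall w, bounded_paths I (WI I ^~ w)}.
Proof.
have sC : path_sigma (badic_interval R I) (~` bounded_paths I).
  suff : measurable (~` bounded_paths I : set (path_space (badic_interval R I))) by [].
  by apply: measurableC; exact: path_sigma_bounded.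
have mP := measurable_path (@cf_measurable _ _ _ _ _ _ _ _ _ _ hWI I) sC.
have mP' := measurable_path (@mW I) sC.
apply/(negligibleP P mP); rewrite [LHS](cf_law hWI sC).
by apply/(negligibleP P' mP'); exact: gbm_bounded.
Qed.

Lemma cvg_in_interval (I : cascade_index b) (f : R -> R) (x : R) :
  {within badic_interval R I, continuous f} -> badic_interval R I x ->
  f (gp n (floor n x)) @[n --> \oo] --> f x.
Proof.
move=> /subspace_continuousP cf Ix; have x0 : 0 <= x.
  by move: Ix; rewrite /badic_interval /= in_itv/= => /andP[+ _]; apply: le_trans;
    rewrite divr_ge0// ltW.
apply: (cvg_comp _ f _ (cf x Ix)) => U /= /(cvg_grid_floor b2 x0) hU.
have hn : \forall n \near \oo, ((tag I).+1 <= n)%N by exact: nbhs_infty_ge.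
near=> n; have : badic_interval R I (gp n (floor n x)) -> U (gp n (floor n x)).
  by near: n.
apply; have y0 : 0 <= gp n (floor n x) by rewrite divr_ge0// ltW.
rewrite badic_grid_cell; apply/(grid_cellP b2) => //.
rewrite grid_floor_coarse//; last by near: n.
by apply/(grid_cellP b2); rewrite // -badic_grid_cell.
Unshelve. all: by end_near. Qed.

(** A bound at the grid points passes to all points of the interval by continuity. *)
Let family_regular (I : cascade_index b) : {ae P, forall w,
  {within badic_interval R I, continuous (WI I ^~ w)} /\
  exists M, forall x, badic_interval R I x -> `|WI I x w| <= M}.
Proof.
apply: filterS2 (cf_continuous hWI I) (family_bounded_grid I) => w cw [M _ hM].
split=> //; exists M%:R => x Ix.
have h : `|WI I (gp n (floor n x)) w| @[n --> \oo] --> `|WI I x w|.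
  by apply: cvg_norm; exact: (cvg_in_interval cw Ix).
rewrite -(cvg_lim _ h)//; apply: limr_le; first by apply/cvg_ex; eexists; exact: h.
have x0 : 0 <= x.
  by move: Ix; rewrite /badic_interval /= in_itv/= => /andP[+ _]; apply: le_trans;
    rewrite divr_ge0// ltW.
have hn : \forall n \near \oo, ((tag I).+1 <= n)%N by exact: nbhs_infty_ge.
near=> n; apply: hM => //.
have y0 : 0 <= gp n (floor n x) by rewrite divr_ge0// ltW.
rewrite badic_grid_cell; apply/(grid_cellP b2) => //.
rewrite grid_floor_coarse//; last by near: n.
by apply/(grid_cellP b2); rewrite // -badic_grid_cell.
Unshelve. all: by end_near. Qed.

Lemma cascade_density_regular : {ae P, forall w, forall m, exists M,
  grid_regular b (cascade_density WI m w) M}.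
Proof.
have : {ae P, forall w, forall t k, 
  {within badic_interval R (block_index b2 t k),
     continuous (WI (block_index b2 t k) ^~ w)} /\
  exists M, forall x, badic_interval R (block_index b2 t k) x ->
     `|WI (block_index b2 t k) x w| <= M}.
  by apply/ae_foralln => t; apply/ae_foralln => k; exact: family_regular.
apply: filterS => w hw m.
have level t : exists M, grid_regular b (cascade_level WI t w) M.
  case: t => [|t]; first by eexists; exact: (grid_regular_cst b 1).
  have /choice[M hM] : forall k, exists M, forall x,
      badic_interval R (block_index b2 t k) x -> `|WI (block_index b2 t k) x w| <= M.
    by move=> k; have [] := hw t k.
  (* A level has finitely many intervals, so the sum of their bounds serves for all of them. *)
  exists (\sum_(k < b ^ t.+1) `|M k|) => x x01; have /andP[x0 _] := x01.
  have kb := grid_floor_lt b2 t.+1 x01; set k := floor t.+1 x in kb *.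
  have Ik : badic_interval R (block_index b2 t k) x.
    by rewrite badic_grid_cell block_indexE//; exact: grid_floor_cell.
  rewrite cascade_level_floor//; split.
    apply: le_trans (hM k x Ik) _; apply: le_trans (ler_norm _) _.
    by rewrite (bigD1 (Ordinal kb))//= lerDl sumr_ge0.
  have h := cvg_in_interval (hw t k).1 Ik.
  apply: cvg_trans h; apply: near_eq_cvg.
  have hn : \forall n \near \oo, (t.+1 <= n)%N by exact: nbhs_infty_ge.
  near=> n; rewrite cascade_level_floor.
    by rewrite grid_floor_coarse//; near: n.
  by apply: grid_point_itv; exact: grid_floor_lt.
have /choice[M hM] := level.
exists (\prod_(j < m.+1) M j).
exact: (@grid_regular_prod _ _ _ (fun j => cascade_level WI j w) (fun j => M j)).
Unshelve. all: by end_near. Qed.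

End CascadeRegularity.

(** * Moments of the level increments of trigonometric sums *)

Section LevelBounds.
Context (R : realType) (b : nat).
Hypothesis b2 : (2 <= b)%N.
Context d d' (Omega : measurableType d) (Omega' : measurableType d').
Context (P : probability Omega R) (P' : probability Omega' R).
Context (B : R -> Omega' -> R) (WI : cascade_index b -> R -> Omega -> R).
Variable sigma : R.
Hypothesis sigma0 : 0 < sigma.
Hypothesis hB : brownian_motion01 P' B.
Hypothesis hWI : cascade_family P P' (geometric_bm sigma B) WI.
Variable p : R.
Hypotheses (p1 : 1 < p) (p2 : p <= 2).
Local Notation gp := (grid_point R b).
Local Notation kappa := (gbm_kappa sigma p).

Lemma lqnormZ (q n : nat) (c : R) (x : 'I_n -> R) : (0 < q)%N -> 0 <= c ->
  lqnorm q (fun i => c * x i) = c * lqnorm q x.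
Proof.
move=> q0 c0; rewrite /lqnorm.
under eq_bigr do rewrite normrM exprMn (ger0_norm c0).
have S0 : 0 <= \sum_(i < n) `|x i| ^+ q by apply: sumr_ge0 => i _; exact: exprn_ge0.
rewrite -mulr_sumr (powRM _ (exprn_ge0 q c0) S0).
rewrite -[c ^+ q]powR_mulrn// -powRrM mulfV ?powRr1//.
by rewrite pnatr_eq0 -lt0n.
Qed.

Let bX0 k : 0 < b%:R ^+ k :> R.
Proof. by rewrite exprn_gt0// ltr0n ltnW. Qed.

Let b_gt0 : 0 < b%:R :> R. Proof. by rewrite ltr0n ltnW. Qed.
Let p0 : 0 < p. Proof. exact: lt_trans p1. Qed.

Lemma gbm_kappa_ge1 : 1 <= kappa.
Proof.
have p1' := p1; rewrite /gbm_kappa -[leLHS](expR0 R) ler_expR.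
apply: divr_ge0 => //; apply: mulr_ge0; last exact: sqr_ge0.
by apply: mulr_ge0; lra.
Qed.

Lemma gbm_holder_ge0 : 0 <= gbm_holder sigma p.
Proof. by rewrite /gbm_holder mulr_ge0 ?mulr_ge0 ?powR_ge0 ?expR_ge0. Qed.

Definition cascade_array n :=
  cascade_grid_array b2 hB hWI n sigma0 p1 p2.

Definition decay_rate : R := b%:R `^ (1 - p) * kappa.

Lemma decay_rate_gt0 : 0 < decay_rate.
Proof. by rewrite mulr_gt0 ?powR_gt0 ?expR_gt0. Qed.

(** Riemann sum at mesh b^-n for the increment, from level m to level m + 1, of a Fourier integral;
    the phase [theta] treats cosine and sine at once. *)
Definition osc_diff (n m : nat) (theta x : R) (w : Omega) : R :=
  (b%:R ^+ n)^-1 * \sum_(j < b ^ n)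
    grid_diff (grid_value b2 WI n) m j w * cos (theta + j%:R * (2 * pi * x / b%:R ^+ n)).

Lemma measurable_osc_diff n m theta x : (m < n)%N ->
  measurable_fun setT (osc_diff n m theta x).
Proof.
move=> mn; apply: measurable_funM => //; apply: measurable_sum => j.
by apply: measurable_funM => //; exact: (measurable_grid_diff (cascade_array n)).
Qed.

Let mesh_total n m : (m < n)%N ->
  (b%:R ^+ n)^-1 * (b ^ (n - m.+1))%:R = (b%:R ^+ m.+1)^-1 :> R.
Proof.
move=> mn; have -> : b%:R ^+ n = b%:R ^+ m.+1 * b%:R ^+ (n - m.+1) :> R.
  by rewrite -exprD subnKC.
by rewrite natrX invfM mulrVK// unitfE gt_eqF.
Qed.

(** There are b^(m+1) blocks of length b^-(m+1), whence the factor b^((1-p)(m+1)). *)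
Let mesh_moment n m (A : R) : (m < n)%N ->
  (b%:R ^+ n)^-1 `^ p * ((b ^ m.+1)%:R * ((b ^ (n - m.+1))%:R `^ p * A * kappa ^+ m.+1))
  = A * decay_rate ^+ m.+1.
Proof.
move=> mn.
have -> : (b%:R ^+ n)^-1 `^ p * ((b ^ m.+1)%:R * ((b ^ (n - m.+1))%:R `^ p * A * kappa ^+ m.+1))
  = ((b%:R ^+ n)^-1 `^ p * (b ^ (n - m.+1))%:R `^ p) * (b ^ m.+1)%:R * A * kappa ^+ m.+1.
  by ring.
rewrite -powRM ?invr_ge0 ?(ltW (bX0 _))// mesh_total// natrX /decay_rate exprMn.
have -> : (b%:R `^ (1 - p)) ^+ m.+1 = (b%:R ^+ m.+1)^-1 `^ p * b%:R ^+ m.+1 :> R.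
  rewrite -powR_mulrn ?powR_ge0// -powRrM.
  have -> : (b%:R ^+ m.+1)^-1 `^ p = b%:R `^ (- (m.+1%:R * p)) :> R.
    by rewrite -powR_mulrn// -powRN -powRrM mulNr.
  rewrite -[b%:R ^+ m.+1]powR_mulrn// -powRD ?(gt_eqF b_gt0) ?implybT//.
  by congr (_ `^ _); ring.
by ring.
Qed.

Lemma osc_moment (q N n m : nat) (theta : R) (x : 'I_N -> R) :
  (2 < q)%N -> ~~ odd q -> (m < n)%N ->
  (\int[P]_w (lqnorm q (fun i => osc_diff n m theta (x i) w) `^ p)%:E
    <= (lqconst R q * N%:R `^ (p / q%:R) * 4 * decay_rate ^+ m.+1)%:E)%E.
Proof.
move=> q3 qe mn; have q0 : (0 < q)%N by exact: ltn_trans q3.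
have V0 : 0 <= (b%:R ^+ n)^-1 :> R by rewrite invr_ge0 ltW.
have cos1 (i : 'I_N) (j : nat) :
    `|cos (theta + j%:R * (2 * pi * x i / b%:R ^+ n))| <= 1 by exact: cos_max.
have := key_estimate (cascade_array n) b2 p1 p2 gbm_kappa_ge1 q3 qe mn cos1.
under [X in _ -> (X <= _)%E]eq_integral do rewrite lqnormZ// powRM ?lqnorm_ge0//.
move=> /(ge0_integralZ_le _ _ (powR_ge0 (b%:R ^+ n)^-1 p)) h.
apply: le_trans (h _ _) _.
- apply: measurable_fun_powR; apply: measurable_lqnorm => i.
  apply: measurable_sum => j; apply: measurable_funM => //.
  exact: (measurable_grid_diff (cascade_array n)).
- by move=> w; exact: powR_ge0.
rewrite lee_fin -(mesh_moment (_ * 4) mn) le_eqVlt; apply/orP; left; apply/eqP.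
by ring.
Qed.

(** A shift in time by b^-(k+2) changes the phase at a frequency in [b^k, b^(k+1)] by an angle
    between 2 pi / b^2 and 2 pi / b <= pi; this is the least value of 1 - cos between 2 pi / b^2 and
    pi. *)
Definition phase_gap : R := 1 - cos (2 * pi / b%:R ^+ 2).

Lemma cos_phase_gap (phi : R) : 2 * pi / b%:R ^+ 2 <= phi -> phi <= pi ->
  phase_gap <= 1 - cos phi.
Proof.
move=> h1 h2; rewrite /phase_gap lerD2l lerN2.
have h0 : 0 <= 2 * pi / b%:R ^+ 2 :> R.
  by rewrite divr_ge0 ?mulr_ge0 ?pi_ge0// ltW.
have : 2 * pi / b%:R ^+ 2 \in `[(0 : R), pi] by rewrite in_itv/= h0 (le_trans h1).
have : phi \in `[(0 : R), pi] by rewrite in_itv/= h2 (le_trans h0).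
by move=> a1 a2; rewrite !leNgt ltr_cos// -leNgt.
Qed.

Lemma phase_gap_gt0 : 0 < phase_gap.
Proof.
rewrite /phase_gap subr_gt0 -[ltRHS](@cos0 R).
have b2R : 2 <= b%:R :> R by rewrite ler_nat.
have h0 : 0 < 2 * pi / b%:R ^+ 2 :> R by rewrite divr_gt0 ?mulr_gt0 ?pi_gt0.
have h1 : 2 * pi / b%:R ^+ 2 <= pi :> R.
  rewrite ler_pdivrMr// mulrC ler_pM2l ?pi_gt0//.
  by rewrite expr2 (le_trans b2R)// ler_peMr//; lra.
have m1 : 2 * pi / b%:R ^+ 2 \in `[(0 : R), pi] by rewrite in_itv/= (ltW h0).
have m2 : 0 \in `[(0 : R), pi] by rewrite in_itv/= lexx pi_ge0.
by rewrite ltr_cos.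
Qed.

Lemma freq_phase_gap (n k : nat) (x : R) : (k.+2 <= n)%N ->
  b%:R ^+ k <= x <= b%:R ^+ k.+1 ->
  phase_gap <= 1 - cos ((b ^ (n - k.+2))%N%:R * (2 * pi * x / b%:R ^+ n)).
Proof.
move=> kn /andP[x1 x2]; have b2R : 2 <= b%:R :> R by rewrite ler_nat.
have hR : (b ^ (n - k.+2))%N%:R = b%:R ^+ n / b%:R ^+ k.+2 :> R.
  rewrite natrX; have -> : b%:R ^+ n = b%:R ^+ k.+2 * b%:R ^+ (n - k.+2) :> R.
    by rewrite -exprD subnKC.
  by rewrite mulrAC mulfV ?mul1r// gt_eqF.
have -> : (b ^ (n - k.+2))%N%:R * (2 * pi * x / b%:R ^+ n) =
    2 * pi * x / b%:R ^+ k.+2 :> R.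
  by rewrite hR; field; rewrite !gt_eqF.
apply: cos_phase_gap.
  have -> : 2 * pi / b%:R ^+ 2 = 2 * pi * b%:R ^+ k / b%:R ^+ k.+2 :> R.
    have -> : b%:R ^+ k.+2 = b%:R ^+ k * b%:R ^+ 2 :> R by rewrite -exprD addn2.
    by field; rewrite !gt_eqF.
  by rewrite ler_pM2r ?invr_gt0// ler_pM2l ?mulr_gt0 ?pi_gt0.
rewrite ler_pdivrMr// (_ : 2 * pi * x = pi * (2 * x)); last by ring.
rewrite ler_pM2l ?pi_gt0// exprS ler_pM//.
exact: le_trans (ltW (bX0 k)) x1.
Qed.

Definition smooth_moment_const (q : nat) : R :=
  lqconst R q * (phase_gap^-1 `^ p * 3 `^ p * smooth_const (gbm_holder sigma p)).

Lemma lqconst_ge0 q : 0 <= lqconst R q.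
Proof. by rewrite /lqconst addr_ge0// mulr_ge0 ?exprn_ge0. Qed.

Lemma smooth_moment_const_ge0 q : 0 <= smooth_moment_const q.
Proof.
apply: mulr_ge0; first exact: lqconst_ge0.
apply: mulr_ge0; first by rewrite mulr_ge0 ?powR_ge0.
apply: mulr_ge0 => //; apply: addr_ge0 => //; apply: mulr_ge0 => //.
exact: gbm_holder_ge0.
Qed.

(** The shift by b^(n-k-2) points is the fraction b^-(k-m+1) of a block, which is at most
    b^-(k-m-1). This serves the coarse levels. *)
Lemma osc_moment_smooth (q N n m k : nat) (theta : R) (x : 'I_N -> R) :
  (2 < q)%N -> ~~ odd q -> (m < k)%N -> (k.+2 <= n)%N ->
  (forall i, b%:R ^+ k <= x i <= b%:R ^+ k.+1) ->
  (\int[P]_w (lqnorm q (fun i => osc_diff n m theta (x i) w) `^ p)%:E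
    <= (smooth_moment_const q * N%:R `^ (p / q%:R) * decay_rate ^+ m.+1
          * (b%:R `^ (- (p / 2))) ^+ (k - m.+1))%:E)%E.
Proof.
move=> q3 qe mk kn xk; have q0 : (0 < q)%N by exact: ltn_trans q3.
have mn : (m < n)%N by apply: leq_trans kn; rewrite ltnW// ltnS ltnW// ltnS.
have V0 : 0 <= (b%:R ^+ n)^-1 :> R by rewrite invr_ge0 ltW.
have b2R : 2 <= b%:R :> R by rewrite ler_nat.
pose h := (b ^ (n - k.+2))%N.
have h0L : (0 < h <= b ^ (n - m.+1))%N.
  rewrite expn_gt0 (ltnW b2)/= leq_pexp2l ?(ltnW b2)// leq_sub2l//.
  by rewrite ltnW// ltnS ltnW.
have phase i : phase_gap <= 1 - cos (h%:R * (2 * pi * x i / b%:R ^+ n)).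
  exact: freq_phase_gap.
have := key_estimate_smooth (cascade_array n) b2 p1 p2 gbm_kappa_ge1 gbm_holder_ge0
  q3 qe mn (fun=> theta) phase_gap_gt0 h0L phase.
under [X in _ -> (X <= _)%E]eq_integral do rewrite lqnormZ// powRM ?lqnorm_ge0//.
move=> /(ge0_integralZ_le _ _ (powR_ge0 (b%:R ^+ n)^-1 p)) hle.
apply: le_trans (hle _ _) _.
- apply: measurable_fun_powR; apply: measurable_lqnorm => i.
  apply: measurable_sum => j; apply: measurable_funM => //.
  exact: (measurable_grid_diff (cascade_array n)).
- by move=> w; exact: powR_ge0.
have exps : (n - k.+2 + (k - m.+1) <= n - m.+1)%N by clear -mk kn; lia.
have rhoE : (h%:R / (b ^ (n - m.+1))%:R) `^ (p / 2)
    <= (b%:R `^ (- (p / 2))) ^+ (k - m.+1) :> R.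
  have -> : (b%:R `^ (- (p / 2))) ^+ (k - m.+1) =
      (b%:R ^+ (k - m.+1))^-1 `^ (p / 2) :> R.
    rewrite -[LHS]powR_mulrn ?powR_ge0// -powRrM.
    have -> : - (p / 2) * (k - m.+1)%:R = - (k - m.+1)%:R * (p / 2) by ring.
    by rewrite (powRrM b%:R) powRN powR_mulrn.
  apply: ge0_ler_powR.
  - by rewrite divr_ge0// ltW.
  - by rewrite nnegrE divr_ge0.
  - by rewrite nnegrE invr_ge0 ltW.
  - rewrite natrX ler_pdivrMr// mulrC ler_pdivlMr// /h natrX -exprD.
    by rewrite ler_eXn2l ?ltr1n.
set G := lqconst R q * N%:R `^ (p / q%:R) * (phase_gap^-1 `^ p * 3 `^ p *
  smooth_const (gbm_holder sigma p)).
have GE : smooth_moment_const q * N%:R `^ (p / q%:R) = G.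
  by rewrite /G /smooth_moment_const; ring.
have G0 : 0 <= G by rewrite -GE mulr_ge0 ?powR_ge0 ?smooth_moment_const_ge0.
rewrite lee_fin; apply: (@le_trans _ _ (G * decay_rate ^+ m.+1 *
    (h%:R / (b ^ (n - m.+1))%:R) `^ (p / 2))); last first.
  by rewrite GE ler_wpM2l// mulr_ge0// exprn_ge0// ltW// decay_rate_gt0.
rewrite -(mesh_moment G mn) le_eqVlt; apply/orP; left; apply/eqP.
by rewrite /G; ring.
Qed.

End LevelBounds.

(** * Lower limits and Fatou's lemma *)

Section FatouBounds.
Context (R : realType) d (T : measurableType d) (P : probability T R).

Lemma measurable_limn_einf (u : nat -> T -> \bar R) :
  (forall n, measurable_fun setT (u n)) ->
  measurable_fun setT (fun w => limn_einf (u^~ w)).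
Proof.
move=> mu; apply: (eq_measurable_fun (fun w => - limn_esup (fun n => - u n w))%E) => //.
apply: measurableT_comp => //.
apply: measurable_fun_limn_esup => n; exact: measurableT_comp.
Qed.

Lemma limn_einf_ge0 (u : nat -> \bar R) :
  (forall n, 0 <= u n)%E -> (0 <= limn_einf u)%E.
Proof.
move=> u0; rewrite limn_einf_lim; apply: lime_ge; first exact: is_cvg_einfs.
by apply: nearW => n; apply: le_ereal_inf_tmp => _ [k _ <-].
Qed.

Lemma limn_einf_le (u : nat -> \bar R) (c : \bar R) :
  (forall n, u n <= c)%E -> (limn_einf u <= c)%E.
Proof.
move=> uc; rewrite limn_einf_lim; apply: lime_le; first exact: is_cvg_einfs.
apply: nearW => n; apply: le_trans (uc n).
by apply: ereal_inf_lbound; exists n => /=.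
Qed.

(** Lower limits are measurable, and Fatou's lemma asks for no convergence in n. *)
Lemma integral_limn_einf_le (u : nat -> T -> \bar R) (c : \bar R) :
  (forall n, measurable_fun setT (u n)) -> (forall n w, 0 <= u n w)%E ->
  (forall n, \int[P]_w u n w <= c)%E ->
  (\int[P]_w limn_einf (u^~ w) <= c)%E.
Proof.
move=> mu u0 uc; apply: le_trans (fatou P measurableT mu _) _; first by move=> *.
exact: limn_einf_le.
Qed.

Lemma limn_einf_ge (u : nat -> \bar R) (c : \bar R) :
  (\forall n \near \oo, c <= u n)%E -> (c <= limn_einf u)%E.
Proof.
move=> [N _ hN]; rewrite limn_einf_lim; apply: lime_ge; first exact: is_cvg_einfs.
exists N => // n /= Nn; apply: le_ereal_inf_tmp => _ [k /= nk <-].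
by apply: hN => /=; exact: leq_trans nk.
Qed.

(** If |l|^p exceeded C, then v^p would eventually stay above some s^p > C. It is applied with v the
    l^q norm over all frequencies of a scale and r one coordinate. *)
Lemma powR_limit_le (p C l : R) (r v : nat -> R) : 0 < p ->
  r n @[n --> \oo] --> l -> (forall n, `|r n| <= v n) ->
  (limn_einf (fun n => (v n `^ p)%:E) <= C%:E)%E -> `|l| `^ p <= C.
Proof.
move=> p0 rl rv hC; have C0 : 0 <= C.
  rewrite -lee_fin; apply: le_trans hC; apply: limn_einf_ge0 => n.
  by rewrite lee_fin powR_ge0.
rewrite leNgt; apply/negP => Cl.
have CE : (C `^ p^-1) `^ p = C by rewrite -powRrM mulVf ?gt_eqF// powRr1.
have Cl' : C `^ p^-1 < `|l|.
  rewrite ltNge; apply: contraTN Cl => h; rewrite -leNgt -[leRHS]CE.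
  by apply: ge0_ler_powR; rewrite ?nnegrE ?powR_ge0// ltW.
pose s := (C `^ p^-1 + `|l|) / 2; have [s1 s2] := midf_lt Cl'.
have cnl : `|r n| @[n --> \oo] --> `|l| by exact: cvg_norm.
have hs : ((s `^ p)%:E <= C%:E)%E.
  apply: le_trans hC; apply: limn_einf_ge.
  near=> n; rewrite lee_fin; apply: ge0_ler_powR; first exact: ltW.
  - by rewrite nnegrE (le_trans (powR_ge0 C p^-1))// ltW.
  - by rewrite nnegrE; apply: le_trans (rv n).
  - apply: le_trans (rv n); near: n.
    by apply: (cvgr_ge `|l| cnl).
have : C < s `^ p.
  rewrite -[ltLHS]CE; apply: gt0_ltr_powR => //; rewrite nnegrE ?powR_ge0//.
  by rewrite (le_trans (powR_ge0 C p^-1))// ltW.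
by rewrite ltNge -lee_fin hs.
Unshelve. all: by end_near. Qed.

End FatouBounds.

(** * Oscillatory integrals of the densities *)

Section OscillatoryIntegrals.
Context (R : realType) (b : nat).
Hypothesis b2 : (2 <= b)%N.
Context d (Omega : measurableType d).
Variable (WI : cascade_index b -> R -> Omega -> R).
Local Notation gp := (grid_point R b).
Local Notation mu := (@lebesgue_measure R).

Definition osc_int (m : nat) (theta x : R) (w : Omega) : R :=
  fine (\int[mu]_(t in `[0%R, 1%R])
          (cos (theta + 2 * pi * x * t) * cascade_density WI m w t)%:E).

Lemma continuous_cos_affine (theta y : R) : continuous (fun t : R => cos (theta + y * t)).
Proof.
move=> t; apply: continuous_comp; last exact: continuous_cos.
by apply: cvgD; [exact: cvg_cst|exact: mulrl_continuous].
Qed.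

Lemma grid_regular_osc m theta x w M :
  grid_regular b (cascade_density WI m w) M ->
  grid_regular b (fun t => cos (theta + 2 * pi * x * t) * cascade_density WI m w t) (1 * M).
Proof.
move=> hM; apply: grid_regularM => //; apply: (grid_regular_continuous b2).
  exact: continuous_cos_affine.
by move=> t; exact: cos_max.
Qed.

Lemma osc_diff_cvg m theta x w :
  (forall m, exists M, grid_regular b (cascade_density WI m w) M) ->
  osc_diff b2 WI n m theta x w @[n --> \oo] -->
    osc_int m.+1 theta x w - osc_int m theta x w.
Proof.
move=> reg.
have sum_cvg l : riemann_sum b (fun t => cos (theta + 2 * pi * x * t) *
    cascade_density WI l w t) n @[n --> \oo] --> osc_int l theta x w.
  by have [M /(@grid_regular_osc l theta x)/(riemann_sum_cvg_fine b2)] := reg l.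
apply: cvg_trans (cvgB (sum_cvg m.+1) (sum_cvg m)); apply: near_eq_cvg.
(* From n = m + 1 on, the grid sees both levels and the sums coincide exactly. *)
exists m.+1 => // n /= mn; rewrite fctE /riemann_sum /osc_diff -mulrBr -sumrB.
congr (_ * _); apply: eq_bigr => j _.
have -> : theta + j%:R * (2 * pi * x / b%:R ^+ n) = theta + 2 * pi * x * gp n j.
  by rewrite /grid_point; congr (_ + _); rewrite mulrCA mulrA.
rewrite grid_diffE (cascade_density_grid b2 _ _ mn)//.
rewrite (cascade_density_grid b2 _ _ (ltnW mn))//.
by rewrite [RHS]mulrC mulrBr.
Qed.

(** The density of level 0 is 1: its variation vanishes inside, and only the 2 h boundary terms of
    each Riemann sum remain. *)
Lemma osc_int0_le (k : nat) (theta x : R) (w : Omega) :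
  b%:R ^+ k <= x <= b%:R ^+ k.+1 ->
  `|osc_int 0 theta x w| <= 2 / phase_gap R b / b%:R ^+ k.+2.
Proof.
move=> xk; have gap0 : 0 < phase_gap R b by exact: phase_gap_gt0.
have bX0 n : 0 < b%:R ^+ n :> R by rewrite exprn_gt0// ltr0n ltnW.
pose c t := cos (theta + 2 * pi * x * t).
have oscE : osc_int 0 theta x w = fine (\int[mu]_(t in `[0%R, 1%R]) (c t)%:E).
  rewrite /osc_int; congr fine; apply: eq_integral => t _.
  by rewrite /cascade_density big_ord_recl big_ord0 !mulr1.
have regc : grid_regular b c 1.
  apply: (grid_regular_continuous b2); first exact: continuous_cos_affine.
  by move=> t; exact: cos_max.
have cvgc : `|riemann_sum b c n| @[n --> \oo] --> `|osc_int 0 theta x w|.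
  by rewrite oscE; apply: cvg_norm; exact: (riemann_sum_cvg_fine b2 regc).
rewrite -(cvg_lim _ cvgc)//; apply: limr_le; first by apply/cvg_ex; eexists; exact: cvgc.
exists k.+2 => // n /= kn.
have hL : (b ^ (n - k.+2) <= b ^ n)%N by rewrite leq_pexp2l ?(ltnW b2)// leq_subr.
have := oscillatory_sum_le (fun=> 1) theta (2 * pi * x / b%:R ^+ n) hL.
have := freq_phase_gap b2 kn xk; set h := (b ^ (n - k.+2))%N => gap.
have -> : \sum_(j < b ^ n) 1 * cos (theta + j%:R * (2 * pi * x / b%:R ^+ n)) =
    \sum_(j < b ^ n) c (gp n j).
  apply: eq_bigr => j _; rewrite mul1r /c; congr cos.
  by rewrite /grid_point; congr (_ + _); rewrite mulrCA mulrA.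
have -> : variation_bound (b ^ n) h (fun=> 1) = 2 * h%:R :> R.
  rewrite /variation_bound subrr normr0 normr1 big1// add0r.
  by rewrite !sumr_const card_ord; ring.
move=> le1; rewrite /riemann_sum normrM (gtr0_norm (_ : 0 < _^-1)) ?invr_gt0//.
have hR : b%:R ^+ n = h%:R * b%:R ^+ k.+2 :> R by rewrite natrX -exprD subnK.
have h0 : 0 < h%:R :> R by rewrite ltr0n expn_gt0 (ltnW b2).
rewrite ler_pdivrMl// hR.
have -> : h%:R * b%:R ^+ k.+2 * (2 / phase_gap R b / b%:R ^+ k.+2) = 2 * h%:R / phase_gap R b.
  by field; rewrite !gt_eqF.
rewrite ler_pdivlMr// mulrC; apply: le_trans le1.
by rewrite ler_wpM2r.
Qed.

End OscillatoryIntegrals.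

(** * Almost sure decay along the frequency grid *)

Lemma geometric_increments_le (R : realFieldType) (a : nat -> R) (c0 c rho : R) :
  0 <= c -> 0 <= rho < 1 -> `|a 0| <= c0 ->
  (forall m, `|a m.+1 - a m| <= c * rho ^+ m) ->
  forall m, `|a m| <= c0 + c / (1 - rho).
Proof.
move=> c_ge0 /andP[r0 r1] a0 am m; have r1' : 0 < 1 - rho by rewrite subr_gt0.
suff : `|a m| <= c0 + c * (1 - rho ^+ m) / (1 - rho).
  move=> h; apply: le_trans h _; rewrite lerD2l ler_pM2r ?invr_gt0//.
  by rewrite ler_piMr// gerBl exprn_ge0.
elim: m => [|m IH]; first by rewrite expr0 subrr mulr0 mul0r addr0.
have -> : a m.+1 = a m + (a m.+1 - a m) by ring.
apply: le_trans (ler_normD _ _) _; apply: le_trans (lerD IH (am m)) _.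
rewrite le_eqVlt; apply/orP; left; apply/eqP.
by rewrite exprS; field; rewrite gt_eqF.
Qed.

Section GridDecay.
Context (R : realType) (b : nat).
Hypothesis b2 : (2 <= b)%N.
Context d d' (Omega : measurableType d) (Omega' : measurableType d').
Context (P : probability Omega R) (P' : probability Omega' R).
Context (B : R -> Omega' -> R) (WI : cascade_index b -> R -> Omega -> R).
Variable sigma : R.
Hypothesis sigma0 : 0 < sigma.
Hypothesis hB : brownian_motion01 P' B.
Hypothesis hWI : cascade_family P P' (geometric_bm sigma B) WI.
Variable p : R.
Hypotheses (p1 : 1 < p) (p2 : p <= 2).
Variables D D' : R.
Hypothesis decayE : decay_rate b sigma p = b%:R `^ (- (p * D / 2)).
Hypotheses (D'0 : 0 <= D') (D'D : D' < D) (D1 : D <= 1).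
Local Notation bp e := ((b%:R : R) `^ e).

Let b_gt0 : 0 < b%:R :> R. Proof. by rewrite ltr0n ltnW. Qed.
Let b_gt1 : 1 < b%:R :> R. Proof. by rewrite ltr1n. Qed.
Let bX0 k : 0 < b%:R ^+ k :> R. Proof. by rewrite exprn_gt0. Qed.
Let bpD e f : bp (e + f) = bp e * bp f.
Proof. by rewrite powRD// (gt_eqF b_gt0) implybT. Qed.
Let bpX e n : bp e ^+ n = bp (e * n%:R).
Proof. by rewrite -powR_mulrn ?powR_ge0// -powRrM. Qed.
Let bp_le e f : e <= f -> bp e <= bp f.
Proof. by move=> ef; rewrite ler_powR// ltW. Qed.

(* The frequencies [freq k i], for i < b^(2k+1), are equally spaced in
   [b^k, b^(k+1)[, at a distance less than b^-k of each other. *)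
Definition freq_count (k : nat) : nat := b ^ (2 * k).+1.

Definition freq (k i : nat) : R :=
  b%:R ^+ k * (1 + (b%:R - 1) * i%:R / (freq_count k)%:R).

Lemma freq_itv k i : (i < freq_count k)%N -> b%:R ^+ k <= freq k i <= b%:R ^+ k.+1.
Proof.
move=> ik; have Nk : 0 < (freq_count k)%:R :> R by rewrite ltr0n (leq_ltn_trans _ ik).
have b1 : 0 <= b%:R - 1 :> R by rewrite subr_ge0 ltW.
apply/andP; split.
  by rewrite /freq ler_peMr ?(ltW (bX0 k))// lerDl divr_ge0 ?mulr_ge0// ltW.
rewrite /freq exprSr ler_pM2l// -lerBrDl -mulrA ler_piMr//.
by rewrite ler_pdivrMr// mul1r ler_nat ltnW.
Qed.

(** [D2] lies half-way between D' and D. [B2] carries the decay in k, with room left for the number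
    of frequencies; in rate = B2 r^2 one factor r pays for the sum over the levels and the other
    stays in the final bound. *)
Let D2 := (D + D') / 2.
Let B2 := bp (- (p * D2 / 2)).
Let r := bp (- (p * (D - D2) / 4)).

Let D2D : D2 < D. Proof. by rewrite /D2; have h := D'D; lra. Qed.
Let D'D2 : D' < D2. Proof. by rewrite /D2; have h := D'D; lra. Qed.

Let rateE : decay_rate b sigma p = B2 * r ^+ 2.
Proof. by rewrite decayE /B2 /r bpX -bpD; congr (_ `^ _); field. Qed.

Definition level_osc (q n m k : nat) (theta : R) (w : Omega) : R :=
  lqnorm q (fun i : 'I_(freq_count k) => osc_diff b2 WI n m theta (freq k i) w).

Definition level_const (q : nat) : R :=
  lqconst R q * 4 + smooth_moment_const b sigma p q.

Let level_const_ge0 q : 0 <= level_const q.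
Proof. by apply: addr_ge0; [rewrite mulr_ge0// lqconst_ge0|exact: smooth_moment_const_ge0]. Qed.

(** If m < k, the gain b^(-(k-m-1)p/2) is at most B2^(k-m-1) because D2 < D <= 1, and it completes
    B2^(m+1) to B2^k. If m >= k, B2^(m+1) <= B2^k since B2 <= 1. *)
Lemma level_osc_moment (q n m k : nat) (theta : R) : (2 < q)%N -> ~~ odd q ->
  (m + k + 3 <= n)%N ->
  (\int[P]_w (level_osc q n m k theta w `^ p)%:E <=
   (level_const q * (freq_count k)%:R `^ (p / q%:R) * B2 ^+ k * (r ^+ 2) ^+ m.+1)%:E)%E.
Proof.
move=> q3 qe mkn; have mn : (m < n)%N by clear -mkn; lia.
have kn : (k.+2 <= n)%N by clear -mkn; lia.
have p0 : 0 < p by exact: lt_trans p1.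
have D20 : 0 <= D2 by rewrite ltW// (le_lt_trans D'0).
have B20 : 0 <= B2 by exact: powR_ge0.
have B21 : B2 <= 1.
  rewrite -(powRr0 b%:R); apply: bp_le; rewrite oppr_le0.
  by rewrite divr_ge0// mulr_ge0// ltW.
have r0 l : 0 <= (r ^+ 2) ^+ l by rewrite exprn_ge0// sqr_ge0.
have F0 : 0 <= (freq_count k)%:R `^ (p / q%:R) :> R by exact: powR_ge0.
have lq0 := lqconst_ge0 R q.
have sm0 : 0 <= smooth_moment_const b sigma p q by exact: smooth_moment_const_ge0.
have [mk|km] := ltnP m k.
  apply: le_trans (osc_moment_smooth b2 sigma0 hB hWI p1 p2 theta q3 qe mk kn _) _.
    by move=> i; exact: freq_itv.
  rewrite lee_fin rateE exprMn.
  have -> : B2 ^+ k = B2 ^+ m.+1 * B2 ^+ (k - m.+1) by rewrite -exprD subnKC.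
  have gB : bp (- (p / 2)) ^+ (k - m.+1) <= B2 ^+ (k - m.+1).
    rewrite lerXn2r ?nnegrE ?powR_ge0//; apply: bp_le.
    by rewrite lerN2 ler_pM2r// ler_piMr ?(ltW p0)// (le_trans (ltW D2D)).
  have g0 : 0 <= bp (- (p / 2)) ^+ (k - m.+1) by rewrite exprn_ge0 ?powR_ge0.
  set g := _ ^+ (k - m.+1) in gB g0 *; set B' := _ ^+ (k - m.+1) in gB *.
  have -> : level_const q * (freq_count k)%:R `^ (p / q%:R) * (B2 ^+ m.+1 * B')
      * (r ^+ 2) ^+ m.+1 = level_const q *
      ((freq_count k)%:R `^ (p / q%:R) * (B2 ^+ m.+1 * (r ^+ 2) ^+ m.+1) * B') by ring.
  have Bm0 : 0 <= B2 ^+ m.+1 by exact: exprn_ge0.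
  have : smooth_moment_const b sigma p q <= level_const q.
    by rewrite /level_const lerDr mulr_ge0.
  move: (smooth_moment_const _ _ _ _) sm0 (level_const q) => S S0 L SL.
  rewrite -!mulrA; apply: ler_pM => //.
  - by do ![apply: mulr_ge0 => //].
  - apply: ler_wpM2l => //; rewrite !mulrA; apply: ler_wpM2l => //.
    exact: mulr_ge0.
apply: le_trans (osc_moment b2 sigma0 hB hWI p1 p2 theta _ q3 qe mn) _.
rewrite lee_fin rateE exprMn.
have -> : lqconst R q * (freq_count k)%:R `^ (p / q%:R) * 4 * (B2 ^+ m.+1 * (r ^+ 2) ^+ m.+1)
  = lqconst R q * 4 * ((freq_count k)%:R `^ (p / q%:R) * (r ^+ 2) ^+ m.+1 * B2 ^+ m.+1) by ring.
have -> : level_const q * (freq_count k)%:R `^ (p / q%:R) * B2 ^+ k * (r ^+ 2) ^+ m.+1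
  = level_const q * ((freq_count k)%:R `^ (p / q%:R) * (r ^+ 2) ^+ m.+1 * B2 ^+ k) by ring.
apply: ler_pM.
- by rewrite mulr_ge0.
- by rewrite !mulr_ge0// exprn_ge0.
- by rewrite lerDl.
- by rewrite ler_wpM2l ?mulr_ge0// ler_wiXn2l// ltnW.
Qed.

Variable q : nat.
Hypotheses (q3 : (2 < q)%N) (qe : ~~ odd q) (qD : 8 < q%:R * (D - D')).

(** The index is shifted so that the grid is fine enough for level m and for frequencies of scale k,
    whatever n. *)
Let level_limit (k m : nat) (theta : R) (w : Omega) : \bar R :=
  limn_einf (fun n => (level_osc q (n + (m + k + 3)) m k theta w `^ p)%:E).

(** Ratio in k of the expectations once normalised by b^(pD'k/2); it is below 1 exactly when q (D -
    D') > 8. *)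
Let rate_k := bp (p / q%:R * 2) * B2 * bp (p * D' / 2).

Let p0 : 0 < p. Proof. exact: lt_trans p1. Qed.

Let bp_lt1 e : e < 0 -> bp e < 1.
Proof.
move=> e0; have lnb : 0 < ln b%:R :> R by rewrite ln_gt0.
by rewrite /powR (gt_eqF b_gt0) expR_lt1 nmulr_rlt0.
Qed.

Let rate_k01 : 0 <= rate_k < 1.
Proof.
rewrite !mulr_ge0 ?powR_ge0//= /rate_k /B2 -!bpD; apply: bp_lt1.
have q0 : 0 < q%:R :> R by rewrite ltr0n (leq_ltn_trans _ q3).
have -> : p / q%:R * 2 + - (p * D2 / 2) + p * D' / 2 =
    p / q%:R / 4 * (8 - q%:R * (D - D')).
  by rewrite /D2; field; rewrite gt_eqF.
by rewrite nmulr_llt0 ?divr_gt0// subr_lt0.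
Qed.

Let r01 : 0 < r < 1.
Proof.
rewrite powR_gt0//=; apply: bp_lt1; have h := D2D.
by rewrite oppr_lt0 divr_gt0// mulr_gt0// subr_gt0.
Qed.

Let freq_countE e k : (freq_count k)%:R `^ e = bp e * bp (e * 2) ^+ k.
Proof.
rewrite natrX -powR_mulrn ?(ltW b_gt0)// -powRrM bpX -bpD; congr (_ `^ _).
by rewrite -addn1 natrD natrM; ring.
Qed.

Let mlevel k m theta n : measurable_fun setT
  (fun w => (level_osc q (n + (m + k + 3)) m k theta w `^ p)%:E).
Proof.
apply/measurable_EFinP; apply: measurable_fun_powR; apply: measurable_lqnorm => i.
by apply: (measurable_osc_diff b2 sigma0 hB hWI p1 p2); clear; lia.
Qed.

Let level_limit_ae theta : {ae P, forall w, exists C : R, forall k m,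
  (level_limit k m theta w <= (C * bp (- (p * D' / 2)) ^+ k * r ^+ m)%:E)%E}.
Proof.
have /andP[r0 r1] := r01.
(* The weights are the inverses of the decay to be proved; the moments contain r^(2m), so r^m is
   left for the summation. *)
pose Z k m w := ((bp (p * D' / 2) ^+ k * r^-1 ^+ m)%:E * level_limit k m theta w)%E.
have K0 k m : 0 <= bp (p * D' / 2) ^+ k * r^-1 ^+ m.
  by rewrite mulr_ge0 ?exprn_ge0 ?powR_ge0// invr_ge0 ltW.
have lev0 k m w : (0 <= level_limit k m theta w)%E.
  by apply: limn_einf_ge0 => n; rewrite lee_fin powR_ge0.
have mlim k m : measurable_fun setT (level_limit k m theta).
  exact: measurable_limn_einf.
have : {ae P, forall w, exists C : R, forall k m, (Z k m w <= C%:E)%E}.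
  apply: (@ae_bounded_of_geometric _ _ _ P Z
    (level_const q * bp (p / q%:R) * r ^+ 2) rate_k r).
  - by move=> k m; exact: measurable_funeM.
  - by move=> k m w; rewrite mule_ge0// lee_fin.
  - by rewrite !mulr_ge0 ?powR_ge0 ?sqr_ge0.
  - exact: rate_k01.
  - by rewrite (ltW r0).
  - move=> k m; rewrite ge0_integralZl//; last by rewrite lee_fin.
    have h : (\int[P]_w level_limit k m theta w <= (level_const q *
      (freq_count k)%:R `^ (p / q%:R) * B2 ^+ k * (r ^+ 2) ^+ m.+1)%:E)%E.
      apply: integral_limn_einf_le; first exact: mlevel.
        by move=> n w; rewrite lee_fin powR_ge0.
      by move=> n; apply: level_osc_moment => //; exact: leq_addl.
    apply: le_trans (lee_wpmul2l _ h) _; first by rewrite lee_fin.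
    rewrite -EFinM lee_fin freq_countE le_eqVlt; apply/orP; left; apply/eqP.
    have -> : rate_k ^+ k = bp (p / q%:R * 2) ^+ k * B2 ^+ k * bp (p * D' / 2) ^+ k.
      by rewrite /rate_k !exprMn.
    have -> : (r ^+ 2) ^+ m.+1 = r ^+ 2 * r ^+ m * r ^+ m by rewrite exprS expr2 exprMn; ring.
    have rm : r^-1 ^+ m * r ^+ m = 1 by rewrite exprVn mulVf// expf_neq0// gt_eqF.
    transitivity ((r^-1 ^+ m * r ^+ m) * (level_const q * bp (p / q%:R) * r ^+ 2
        * (bp (p / q%:R * 2) ^+ k * B2 ^+ k * bp (p * D' / 2) ^+ k) * r ^+ m)).
      by ring.
    by rewrite rm mul1r.
apply: filterS => w [C hC]; exists C => k m.
have := hC k m; rewrite /Z => hZ.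
have bk : bp (- (p * D' / 2)) ^+ k * bp (p * D' / 2) ^+ k = 1.
  by rewrite -exprMn -bpD addNr powRr0 expr1n.
have rm : r^-1 ^+ m * r ^+ m = 1 by rewrite exprVn mulVf// expf_neq0// gt_eqF.
have K'0 : 0 <= bp (- (p * D' / 2)) ^+ k * r ^+ m.
  by rewrite mulr_ge0 ?exprn_ge0 ?powR_ge0// ltW.
have := lee_wpmul2l (_ : (0 <= (bp (- (p * D' / 2)) ^+ k * r ^+ m)%:E)%E) hZ.
rewrite lee_fin => /(_ K'0); rewrite muleA -!EFinM.
have -> : bp (- (p * D' / 2)) ^+ k * r ^+ m * (bp (p * D' / 2) ^+ k * r^-1 ^+ m) = 1.
  transitivity (bp (- (p * D' / 2)) ^+ k * bp (p * D' / 2) ^+ k * (r^-1 ^+ m * r ^+ m)).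
    by ring.
  by rewrite bk rm mulr1.
by rewrite mul1e; congr (_ <= _)%E; congr EFin; ring.
Qed.

(** A p-th root turns b^(-pD'k/2) r^m into b^(-D'k/2) times a geometric term of ratio r^(1/p), and
    these increments are added to level 0. The constant does not depend on m, so the bound will
    survive the weak limit. *)
Lemma osc_int_freq_decay theta : {ae P, forall w, exists C : R,
  forall k m i, (i < freq_count k)%N ->
    `|osc_int WI m theta (freq k i) w| <= C * bp (- (D' / 2)) ^+ k}.
Proof.
have /andP[r0 r1] := r01; have gap0 : 0 < phase_gap R b by exact: phase_gap_gt0.
apply: filterS2 (level_limit_ae theta) (cascade_density_regular b2 sigma0 hB hWI).
move=> w [C hC] reg; pose rho := r `^ p^-1.
have rho01 : 0 <= rho < 1.
  rewrite powR_ge0/= /rho /r -powRrM; apply: bp_lt1; have h := D2D.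
  by rewrite nmulr_rlt0 ?invr_gt0// oppr_lt0 divr_gt0// mulr_gt0// subr_gt0.
have C0 : 0 <= C.
  have := hC 0 0; rewrite !expr0 !mulr1 -lee_fin; apply: le_trans.
  by apply: limn_einf_ge0 => n; rewrite lee_fin powR_ge0.
exists (2 / phase_gap R b + C `^ p^-1 / (1 - rho)) => k m i ik.
have q0 : (0 < q)%N by exact: leq_ltn_trans q3.
have incr l : `|osc_int WI l.+1 theta (freq k i) w - osc_int WI l theta (freq k i) w|
    <= C `^ p^-1 * bp (- (D' / 2)) ^+ k * rho ^+ l.
  have cv := @osc_diff_cvg _ _ b2 _ _ WI l theta (freq k i) w reg.
  have cv' : osc_diff b2 WI (n + (l + k + 3)) l theta (freq k i) w @[n --> \oo] -->
      osc_int WI l.+1 theta (freq k i) w - osc_int WI l theta (freq k i) w.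
    by rewrite (cvg_shiftn _ (fun n => osc_diff b2 WI n l theta (freq k i) w)).
  have := powR_limit_le p0 cv' (fun n => ler_lqnorm q0 _ (Ordinal ik)) (hC k l).
  set x := `|_| => xp; have x0 : 0 <= x by exact: normr_ge0.
  have -> : x = (x `^ p) `^ p^-1 by rewrite -powRrM mulfV ?gt_eqF// powRr1.
  apply: le_trans (ge0_ler_powR _ _ _ xp) _.
  - by rewrite invr_ge0 ltW.
  - by rewrite nnegrE; exact: powR_ge0.
  - by rewrite nnegrE !mulr_ge0 ?exprn_ge0 ?powR_ge0.
  rewrite !powRM ?mulr_ge0 ?exprn_ge0 ?powR_ge0//.
  have comm (z : R) j : 0 <= z -> (z ^+ j) `^ p^-1 = (z `^ p^-1) ^+ j.
    move=> z0; rewrite -(powR_mulrn j z0) -(powR_mulrn j (powR_ge0 z _)).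
    by rewrite -(powRrM z) -(powRrM z) mulrC.
  rewrite !comm ?powR_ge0// -powRrM -/rho.
  by have -> : - (p * D' / 2) * p^-1 = - (D' / 2) by field; rewrite gt_eqF.
have bk0 : 0 <= bp (- (D' / 2)) ^+ k by rewrite exprn_ge0 ?powR_ge0.
have c0 : 0 <= C `^ p^-1 * bp (- (D' / 2)) ^+ k by rewrite mulr_ge0 ?powR_ge0.
(* b^-(k+2) <= b^(-kD'/2), as D' < D <= 1. *)
have first : `|osc_int WI 0 theta (freq k i) w| <= 2 / phase_gap R b * bp (- (D' / 2)) ^+ k.
  apply: le_trans (osc_int0_le b2 WI theta w (freq_itv ik)) _.
  rewrite ler_wpM2l ?divr_ge0 ?(ltW gap0)// bpX -[_ ^+ k.+2]powR_mulrn ?(ltW b_gt0)//.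
  rewrite -powRN; apply: bp_le; rewrite mulNr lerN2.
  apply: (@le_trans _ _ (1 * k%:R)); last by rewrite mul1r ler_nat !leqW.
  by rewrite ler_wpM2r//; have h1 := D1; have h2 := D'D; lra.
apply: le_trans (geometric_increments_le c0 rho01 first incr m) _.
by rewrite [leRHS]mulrDl lerD2l mulrAC.
Qed.

End GridDecay.

(** * Total mass at the grid scale *)

(** Tangents at S with weights w, as for Jensen's inequality; w^(1-p) <= 1 / w because p <= 2 and w
    <= 1. Geometric weights allow any number of levels with a uniform bound. *)
Lemma powR_weighted_sum_le (R : realType) n (w a : 'I_n -> R) (p : R) :
  1 < p -> p <= 2 -> (forall i, 0 < w i) -> \sum_(i < n) w i <= 1 ->
  (forall i, 0 <= a i) ->
  (\sum_(i < n) a i) `^ p <= \sum_(i < n) (w i)^-1 * a i `^ p.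
Proof.
move=> p1 p2 w0 w1 a0; set S := \sum_(i < n) a i.
have p0 : 0 < p by exact: lt_trans p1.
have S0 : 0 <= S by exact: sumr_ge0.
have term i : w i * S `^ p + p * S `^ (p - 1) * (a i - w i * S) <= (w i)^-1 * a i `^ p.
  have aw0 : 0 <= a i / w i by rewrite divr_ge0// ltW.
  have := powR_tangent aw0 S0 p1; rewrite -(ler_pM2l (w0 i)) => h.
  apply: (@le_trans _ _ (w i * (a i / w i) `^ p)).
    apply: le_trans h; rewrite le_eqVlt; apply/orP; left; apply/eqP.
    by field; rewrite gt_eqF.
  rewrite powRM// ?invr_ge0 ?(ltW (w0 i))// mulrCA mulrC ler_wpM2r ?powR_ge0//.
  have wi1 : w i <= 1.
    by apply: le_trans w1; rewrite (bigD1 i)//= lerDl sumr_ge0// => j _; exact: ltW.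
  rewrite -(powR_inv1 (ltW (w0 i))) -powRrM -[X in X * _ <= _](powRr1 (ltW (w0 i))).
  rewrite -powRD ?(gt_eqF (w0 i)) ?implybT//; apply: ger_powR; first by rewrite w0.
  by rewrite mulN1r; lra.
apply: le_trans (ler_sum _ (fun i _ => term i)).
rewrite big_split/= -mulr_suml -mulr_sumr sumrB -mulr_suml -/S.
set W := \sum_(i < n) w i in w1 *.
have -> : p * S `^ (p - 1) * (S - W * S) = p * (1 - W) * (S * S `^ (p - 1)) by ring.
rewrite mulr_powRB1// -mulrDl ler_peMl ?powR_ge0//.
have h : 0 <= (p - 1) * (1 - W) by rewrite mulr_ge0//; lra.
by nra.
Qed.

(** Uniform integrability in pointwise form: above M, |x| <= M^(1-p) |x|^p. *)
Lemma le_truncation (R : realType) (x M p : R) : 0 < M -> 1 < p ->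
  x <= Num.min `|x| M + M `^ (1 - p) * `|x| `^ p.
Proof.
move=> M0 p1; have p0 : 0 < p by exact: lt_trans p1.
have [xM|Mx] := leP `|x| M.
  by apply: le_trans (ler_norm x) _; rewrite lerDl mulr_ge0 ?powR_ge0.
apply: le_trans (ler_norm x) _; apply: ler_wpDl; first exact: ltW.
rewrite -(mulr_powRB1 (normr_ge0 x) p0) mulrCA ler_peMr//.
rewrite -opprB powRN mulrC ler_pdivlMr ?powR_gt0// mul1r.
by apply: ge0_ler_powR; rewrite ?nnegrE ?subr_ge0 ?(ltW p1) ?(ltW M0)// ltW.
Qed.

(** If the masses y tend to 0, the truncated defect is asymptotically at least M, which will
    contradict a mean of at most M - 1 / 2. *)
Lemma limn_einf_truncated_eq0 (R : realType) (x : nat -> nat -> R) (y : nat -> R) (M : R) :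
  0 < M -> (forall m, x m n @[n --> \oo] --> y m) -> y m @[m --> \oo] --> 0 ->
  (M%:E <= limn_einf (fun m => limn_einf (fun n =>
    (M - Num.min `|x m n| M)%:E)))%E.
Proof.
move=> M0 xy y0; apply/lee_addgt0Pr => e e0; rewrite -leeBlDr// -EFinB.
have ny0 : `|y m| @[m --> \oo] --> (0 : R) by rewrite -[X in _ --> X](normr0 R); exact: cvg_norm.
apply: limn_einf_ge; near=> m; apply: limn_einf_ge.
have yme : `|y m| < e by near: m; exact: (cvgr_lt _ ny0).
have nx : `|x m n| @[n --> \oo] --> `|y m| by exact: cvg_norm.
near=> n; rewrite lee_fin lerD2l lerN2 ge_min; apply/orP; left.
by near: n; exact: (cvgr_le _ nx).
Unshelve. all: by end_near. Qed.

Section TotalMass.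
Context (R : realType) (b : nat).
Hypothesis b2 : (2 <= b)%N.
Context d d' (Omega : measurableType d) (Omega' : measurableType d').
Context (P : probability Omega R) (P' : probability Omega' R).
Context (B : R -> Omega' -> R) (WI : cascade_index b -> R -> Omega -> R).
Variable sigma : R.
Hypothesis sigma0 : 0 < sigma.
Hypothesis hB : brownian_motion01 P' B.
Hypothesis hWI : cascade_family P P' (geometric_bm sigma B) WI.
Variable p : R.
Hypotheses (p1 : 1 < p) (p2 : p <= 2).
Hypothesis rate1 : decay_rate b sigma p < 1.

Let p0 : 0 < p. Proof. exact: lt_trans p1. Qed.
Let bX0 k : 0 < b%:R ^+ k :> R.
Proof. by rewrite exprn_gt0// ltr0n ltnW. Qed.

Definition grid_mass (n m : nat) (w : Omega) : R :=
  (b%:R ^+ n)^-1 * \sum_(j < b ^ n) grid_prod (grid_value b2 WI n) m j w.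

Lemma grid_mass_sum n m w :
  grid_mass n m w = 1 + \sum_(l < m) osc_diff b2 WI n l 0 0 w.
Proof.
elim: m => [|m IH].
  rewrite big_ord0 addr0 /grid_mass /grid_prod.
  under eq_bigr do rewrite big_ord0.
  by rewrite sumr_const card_ord natrX mulVf// gt_eqF.
rewrite big_ord_recr/= addrA -IH /osc_diff /grid_mass -mulrDr -big_split/=.
congr (_ * _); apply: eq_bigr => j _.
by rewrite mulr0 mul0r mulr0 addr0 cos0 mulr1 grid_diffE addrC subrK.
Qed.

Lemma grid_mass_mean n m : (m <= n)%N -> has_mean P (grid_mass n m) 1.
Proof.
move=> mn; have : has_mean P (fun w => \sum_(j < b ^ n)
    grid_prod (grid_value b2 WI n) m j w) (\sum_(j < b ^ n) 1).
  apply: has_mean_sum => j.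
  exact: (grid_prod_mean (cascade_array b2 sigma0 hB hWI p1 p2 n) mn).
move=> /(has_meanZ (b%:R ^+ n)^-1).
by rewrite sumr_const card_ord natrX mulVf// gt_eqF.
Qed.

Let osc_diff_moment n m : (m < n)%N ->
  (\int[P]_w (`|osc_diff b2 WI n m 0 0 w| `^ p)%:E
    <= (lqconst R 4 * 4 * decay_rate b sigma p ^+ m.+1)%:E)%E.
Proof.
move=> mn.
(* A single frequency, with q = 4, the least even exponent above 2. *)
have := @osc_moment _ _ b2 _ _ _ _ _ _ _ _ _ sigma0 hB hWI _ p1 p2 4 1 n m 0
  (fun=> 0) isT isT mn.
rewrite powR1 mulr1; apply: le_ge0_integral.
- apply: measurable_fun_powR; apply: measurableT_comp => //.
  exact: (measurable_osc_diff b2 sigma0 hB hWI p1 p2).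
- apply: measurable_fun_powR; apply: measurable_lqnorm => i.
  exact: (measurable_osc_diff b2 sigma0 hB hWI p1 p2).
- by move=> w; exact: powR_ge0.
- move=> w; apply: ge0_ler_powR; rewrite ?nnegrE ?lqnorm_ge0// ?(ltW p0)//.
  exact: (@ler_lqnorm _ 4 1 isT (fun i : 'I_1 => osc_diff b2 WI n m 0 0 w) ord0).
Qed.

Let integral_sum_le n (X : 'I_n -> Omega -> R) (C : 'I_n -> R) :
  (forall i, measurable_fun setT (X i)) -> (forall i w, 0 <= X i w) ->
  (forall i, \int[P]_w (X i w)%:E <= (C i)%:E)%E ->
  (\int[P]_w (\sum_(i < n) X i w)%:E <= (\sum_(i < n) C i)%:E)%E.
Proof.
move=> mX X0 XC; under eq_integral do rewrite -sumEFin.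
rewrite ge0_integral_sum//.
- by rewrite -sumEFin; apply: lee_sum => i _; exact: XC.
- by move=> i; apply/measurable_EFinP; exact: mX.
- by move=> i w _; rewrite lee_fin.
Qed.

(** The weights are (1 - rho) rho^l with rho the square root of the rate: division by them still
    leaves a factor rho^l of the moments, which contain rho^(2l). *)
Let increments_moment : exists2 C : R, 0 <= C & forall n m, (m <= n)%N ->
  (\int[P]_w (`|\sum_(l < m) osc_diff b2 WI n l 0 0 w| `^ p)%:E <= C%:E)%E.
Proof.
pose rho := Num.sqrt (decay_rate b sigma p); have p1' := p1; have p2' := p2.
have rate0 := decay_rate_gt0 b2 sigma p.
have rho0 : 0 < rho by rewrite sqrtr_gt0.
have rho1 : rho < 1 by rewrite -sqrtr1 ltr_sqrt.
have rhoE : decay_rate b sigma p = rho ^+ 2 by rewrite sqr_sqrtr// ltW.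
have r1 : 0 < 1 - rho by rewrite subr_gt0.
have geo m : (1 - rho) * \sum_(l < m) rho ^+ l <= 1.
  by rewrite -[_ * _]opprK -mulNr opprB -subrX1 opprB gerBl exprn_ge0// ltW.
have c0 : 0 <= lqconst R 4 * 4 by rewrite mulr_ge0// lqconst_ge0.
exists ((1 - rho)^-1 * (lqconst R 4 * 4) / (1 - rho)).
  by rewrite divr_ge0 ?(ltW r1)// mulr_ge0// invr_ge0 ltW.
move=> n m mn; pose w_ (l : 'I_m) := (1 - rho) * rho ^+ l.
have w0 l : 0 < w_ l by rewrite mulr_gt0// exprn_gt0.
have mosc (l : 'I_m) : measurable_fun setT (osc_diff b2 WI n l 0 0).
  by apply: (measurable_osc_diff b2 sigma0 hB hWI p1 p2); exact: leq_trans mn.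
have mp (X : Omega -> R) : measurable_fun setT X ->
    measurable_fun setT (fun w => `|X w| `^ p).
  by move=> mX; apply: measurable_fun_powR; exact: measurableT_comp.
apply: (@le_ge0_integral _ _ _ _ _ (fun w => \sum_(l < m)
    (w_ l)^-1 * `|osc_diff b2 WI n l 0 0 w| `^ p)).
- by apply: mp; exact: measurable_sum.
- by apply: measurable_sum => l; apply: measurable_funM => //; exact: mp.
- by move=> w; exact: powR_ge0.
- move=> w; apply: le_trans (powR_weighted_sum_le p1 p2 w0 _ _) => //; last first.
    by rewrite /w_ -mulr_sumr.
  apply: ge0_ler_powR; rewrite ?nnegrE ?(ltW p0) ?sumr_ge0//.
  exact: ler_norm_sum.
apply: le_trans (integral_sum_le (C := fun l =>
    (w_ l)^-1 * (lqconst R 4 * 4 * decay_rate b sigma p ^+ l.+1)) _ _ _) _.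
- by move=> l; apply: measurable_funM => //; exact: mp.
- by move=> l w; rewrite mulr_ge0 ?powR_ge0// invr_ge0 ltW.
- move=> l; apply: ge0_integralZ_le.
  + exact: mp.
  + by move=> w; exact: powR_ge0.
  + by rewrite invr_ge0 ltW.
  + by apply: osc_diff_moment; exact: leq_trans mn.
rewrite lee_fin; apply: (@le_trans _ _ ((1 - rho)^-1 * (lqconst R 4 * 4) *
    \sum_(l < m) rho ^+ l)).
  rewrite mulr_sumr; apply: ler_sum => l _; rewrite /w_ rhoE.
  have -> : ((1 - rho) * rho ^+ l)^-1 * (lqconst R 4 * 4 * (rho ^+ 2) ^+ l.+1) =
      (1 - rho)^-1 * (lqconst R 4 * 4) * rho ^+ l * (rho ^+ 2).
    have e : (rho ^+ 2) ^+ l.+1 = rho ^+ l * rho ^+ l * rho ^+ 2.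
      by rewrite -!exprM -!exprD; congr (_ ^+ _); clear; lia.
    by rewrite e; field; rewrite !gt_eqF// exprn_gt0.
  rewrite ler_piMr//; first by rewrite !mulr_ge0 ?invr_ge0 ?exprn_ge0 ?lqconst_ge0 ?ltW.
  by rewrite expr_le1// ltW.
apply: ler_wpM2l; first by rewrite mulr_ge0// invr_ge0 ltW.
by rewrite -(ler_pM2l r1) mulfV ?gt_eqF.
Qed.

Lemma grid_mass_moment : exists2 C : R, 0 <= C & forall n m, (m <= n)%N ->
  (\int[P]_w (`|grid_mass n m w| `^ p)%:E <= C%:E)%E.
Proof.
have [C C0 hC] := increments_moment; pose t : R := 2^-1.
exists (t `^ (1 - p) * 1 + (1 - t) `^ (1 - p) * C).
  by rewrite addr_ge0 ?mulr_ge0 ?powR_ge0.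
move=> n m mn; under eq_integral do rewrite grid_mass_sum.
apply: (@powR_add_integral_le _ _ _ P (cst 1)) => //; last 3 first.
- apply: measurable_sum => l; apply: (measurable_osc_diff b2 sigma0 hB hWI p1 p2).
  exact: leq_trans mn.
- under eq_integral do rewrite normr1 powR1.
  by rewrite (has_mean_cst P 1).2.
- exact: hC.
- by apply/andP; split; rewrite /t; lra.
Qed.

Lemma truncated_mass_mean : exists2 M : R, 0 < M & forall n m, (m <= n)%N ->
  (\int[P]_w (M - Num.min `|grid_mass n m w| M)%:E <= (M - 2^-1)%:E)%E.
Proof.
have [C C0 hC] := grid_mass_moment; have p1' := p1.
(* Then M^(1-p) = 1 / (2 C + 1), so truncation at M loses at most C / (2 C + 1) <= 1 / 2 of the mean
   1. *)
pose M := (2 * C + 1) `^ (p - 1)^-1.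
have C1 : 0 < 2 * C + 1 by lra.
have M0 : 0 < M by exact: powR_gt0.
exists M => // n m mn.
have mm := has_mean_measurable (grid_mass_mean mn).
have mmp : measurable_fun setT (fun w => `|grid_mass n m w| `^ p).
  by apply: measurable_fun_powR; exact: measurableT_comp.
have [r hr /andP[r0 rC]] :=
  ge0_has_mean mmp (fun w => powR_ge0 _ _) (hC n m mn).
have hY := has_meanD (has_meanB (has_mean_cst P M) (grid_mass_mean mn))
  (has_meanZ (M `^ (1 - p)) hr).
apply: le_trans (has_mean_le _ _ _ hY) _.
- apply: measurable_funB => //; apply: measurable_minr => //.
  exact: measurableT_comp.
- by move=> w; rewrite subr_ge0 ge_min lexx orbT.
- move=> w; have := le_truncation (grid_mass n m w) M0 p1; lra.
have -> : M `^ (1 - p) = (2 * C + 1)^-1.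
  rewrite /M -powRrM -(powR_inv1 (ltW C1)); congr (_ `^ _).
  by field; rewrite gt_eqF// subr_gt0.
rewrite lee_fin.
have : (2 * C + 1)^-1 * r <= 2^-1 by rewrite ler_pdivrMl//; lra.
lra.
Qed.

End TotalMass.

(** * Non-degeneracy *)

Section NonDegenerate.
Context (R : realType) (b : nat).
Hypothesis b2 : (2 <= b)%N.
Context d d' (Omega : measurableType d) (Omega' : measurableType d').
Context (P : probability Omega R) (P' : probability Omega' R).
Context (B : R -> Omega' -> R) (WI : cascade_index b -> R -> Omega -> R).
Variable sigma : R.
Hypothesis sigma0 : 0 < sigma.
Hypothesis hB : brownian_motion01 P' B.
Hypothesis hWI : cascade_family P P' (geometric_bm sigma B) WI.
Variable p : R.
Hypotheses (p1 : 1 < p) (p2 : p <= 2).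
Hypothesis rate1 : decay_rate b sigma p < 1.
Variable MC : Omega -> {finite_measure set (measurableTypeR R) -> \bar R}.
Hypothesis hMC : is_cascade_measure P WI MC.

Let total (m : nat) (w : Omega) : R :=
  fine (\int[lebesgue_measure]_(t in `[0%R, 1%R]) (1 * cascade_density WI m w t)%:E).

Let grid_mass_cvg m w :
  (forall m, exists M, grid_regular b (cascade_density WI m w) M) ->
  grid_mass b2 WI (n + m) m w @[n --> \oo] --> total m w.
Proof.
move=> reg; have [M hM] := reg m.
have hM' : grid_regular b (fun t => 1 * cascade_density WI m w t) (`|1| * M).
  by apply: grid_regularM => //; exact: grid_regular_cst.
have := riemann_sum_cvg_fine b2 hM'; rewrite -(cvg_shiftn m).
apply: cvg_trans; apply: near_eq_cvg; apply: nearW => n.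
rewrite /riemann_sum /grid_mass /=; congr (_ * _); apply: eq_bigr => j _.
by rewrite mul1r (cascade_density_grid b2 _ _ (leq_addl n m)).
Qed.

Let total_cvg0 w :
  (forall m, exists M, grid_regular b (cascade_density WI m w) M) ->
  weak_limit01 (fun m => cascade_density WI m w) (MC w) -> MC w setT = 0%E ->
  total m w @[m --> \oo] --> 0.
Proof.
move=> reg [_ /(_ (fun=> 1))] + nu0.
have -> : (\int[MC w]_(t in `[0%R, 1%R]) (1 : R)%:E)%E = 0%E.
  rewrite integral_cst/= ?mul1e; last exact: measurable_itv.
  apply/eqP; rewrite eq_le measure_ge0 andbT -nu0.
  by apply: le_measure; rewrite ?inE//; exact: measurable_itv.
move=> h; apply: (fine_cvg (f := fun m =>
  (\int[lebesgue_measure]_(t in `[0%R, 1%R]) (1 * cascade_density WI m w t)%:E)%E)).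
by apply: h => t; exact: cvg_cst.
Qed.

(** The event is built from grid sums, which are measurable: Z, the iterated lower limit of the
    truncated defects, has mean at most M - 1 / 2 by Fatou's lemma, while Z >= M outside a null set
    N wherever the limit measure vanishes. So {Z < M} without N lies in {MC <> 0}; were it null, Z
    >= M would hold almost surely. *)
Lemma cascade_non_degenerate : non_degenerate P MC.
Proof.
have [M M0 hM] := truncated_mass_mean b2 sigma0 hB hWI p1 p2 rate1.
pose U m n w := (M - Num.min `|grid_mass b2 WI (n + m) m w| M)%:E.
pose Z w := limn_einf (fun m => limn_einf (fun n => U m n w)).
have U0 m n w : (0 <= U m n w)%E by rewrite lee_fin subr_ge0 ge_min lexx orbT.
have mU m n : measurable_fun setT (U m n).
  have mm := has_mean_measurable (grid_mass_mean b2 sigma0 hB hWI p1 p2 (leq_addl n m)).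
  apply/measurable_EFinP; apply: measurable_funB => //; apply: measurable_minr => //.
  exact: measurableT_comp.
have mUm m : measurable_fun setT (fun w => limn_einf (fun n => U m n w)).
  exact: measurable_limn_einf.
have mZ : measurable_fun setT Z by exact: measurable_limn_einf.
have EZ : (\int[P]_w Z w <= (M - 2^-1)%:E)%E.
  apply: integral_limn_einf_le => // [m w|m]; first exact: limn_einf_ge0.
  by apply: integral_limn_einf_le => // n; exact: (hM _ _ (leq_addl n m)).
have mlt : measurable [set w | (Z w < M%:E)%E].
  by have := emeasurable_fun_infty_o measurableT mZ M%:E; rewrite setTI.
have : {ae P, forall w, (forall m, exists M, grid_regular b (cascade_density WI m w) M) /\
    weak_limit01 (fun m => cascade_density WI m w) (MC w)}.
  by apply: filterS2 (cascade_density_regular b2 sigma0 hB hWI) hMC.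
move=> [N [mN PN hN]].
have mA : measurable (~` N `&` [set w | (Z w < M%:E)%E]).
  by apply: measurableI => //; exact: measurableC.
exists (~` N `&` [set w | (Z w < M%:E)%E]); split=> //.
  move=> w [Nw Zw] /=; apply/eqP => nu0.
  have [reg wl] : (forall m, exists M, grid_regular b (cascade_density WI m w) M) /\
    weak_limit01 (fun m => cascade_density WI m w) (MC w).
    by apply: contrapT => /hN.
  have := @limn_einf_truncated_eq0 _ (fun m n => grid_mass b2 WI (n + m) m w)
    (fun m => total m w) M M0 (fun m => grid_mass_cvg reg) (total_cvg0 reg wl nu0).
  by rewrite leNgt Zw.
rewrite lt_neqAle measure_ge0 andbT; apply/eqP => PA.
have : ((M%:E) <= \int[P]_w Z w)%E.
  have <- : (\int[P]_w M%:E = M%:E)%E.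
    by rewrite integral_cst//= probability_setT mule1.
  apply: ae_ge0_le_integral => //.
  - by move=> w _; rewrite lee_fin ltW.
  - by move=> w _; apply: limn_einf_ge0 => m; exact: limn_einf_ge0.
  have hA : P.-negligible (~` N `&` [set w | (Z w < M%:E)%E]).
    by apply/(negligibleP P mA).
  have hN' : P.-negligible N by apply/(negligibleP P mN).
  apply: negligibleS (negligibleU hA hN') => w /=.
  move=> /not_implyP[_ /negP]; rewrite -ltNge => Zw.
  by have [Nw|Nw] := pselect (N w); [right|left].
move=> /le_trans /(_ EZ); rewrite lee_fin; lra.
Qed.

End NonDegenerate.

(** * Choice of the moment exponent *)

Section Exponents.
Context (R : realType) (b : nat) (sigma : R).
Hypothesis b2 : (2 <= b)%N.
Hypotheses (sigma0 : 0 < sigma) (sigma1 : sigma < Num.sqrt (2 * ln b%:R)).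

(* For u = sigma / sqrt (ln b), the rate is b^(-pD/2) with
   D = (2 / p) (p - 1) (1 - p u^2 / 2); on ]1, 2] this is largest at p = 2 if
   u <= 1 / sqrt 2 and at p = sqrt 2 / u otherwise. *)
Lemma moment_exponent : exists p : R, [/\ 1 < p, p <= 2,
  decay_rate b sigma p = b%:R `^ (- (p * D_sigma b sigma / 2)) & 0 < D_sigma b sigma <= 1].
Proof.
have b_gt0 : 0 < b%:R :> R by rewrite ltr0n ltnW.
have lb : 0 < ln b%:R :> R by rewrite ln_gt0// ltr1n.
pose s := Num.sqrt (ln b%:R : R); have s0 : 0 < s by rewrite sqrtr_gt0.
have sE : ln b%:R = s ^+ 2 :> R by rewrite sqr_sqrtr// ltW.
pose u := sigma / s; have u0 : 0 < u by rewrite divr_gt0.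
have sigmaE : sigma = u * s by rewrite /u mulfVK// gt_eqF.
pose v : R := Num.sqrt 2; have v0 : 0 < v by rewrite sqrtr_gt0.
have vE : v ^+ 2 = 2 by rewrite sqr_sqrtr.
have vsE : Num.sqrt (2 * ln b%:R) = v * s by rewrite sqrtrM.
have uv : u < v by rewrite ltr_pdivrMr// -vsE.
have rate (p D : R) : p - 1 - p * (p - 1) * u ^+ 2 / 2 = p * D / 2 ->
    decay_rate b sigma p = b%:R `^ (- (p * D / 2)).
  move=> <-; rewrite /decay_rate /gbm_kappa /powR (gt_eqF b_gt0) -expRD sE sigmaE.
  by congr expR; field.
have cond : (sigma < v * s / 2) = (u < v / 2) by rewrite mulrAC /u ltr_pdivrMr.
rewrite /D_sigma vsE cond -/s -/u -/v sE.
have -> : sigma ^+ 2 / s ^+ 2 = u ^+ 2 by rewrite -expr_div_n.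
case: ifPn => [uv2|]; last rewrite -leNgt => vu.
  exists 2; split; [lra|by []| |].
    by apply: rate; field.
  have h : u ^+ 2 < 2^-1.
    have -> : 2^-1 = (v / 2) ^+ 2 by rewrite expr_div_n vE; field.
    by rewrite ltr_pXn2r ?nnegrE ?divr_ge0// ?ltW.
  have := sqr_ge0 u; lra.
exists (v / u); split.
- by rewrite ltr_pdivlMr// mul1r.
- by rewrite ler_pdivrMr//; lra.
- apply: rate; have vE' : v * v = 2 by rewrite -vE expr2.
  have -> : v / u - 1 - v / u * (v / u - 1) * u ^+ 2 / 2 =
      v / u - 1 - (v * v) / 2 + v * u / 2 by field; rewrite gt_eqF.
  have -> : v / u * (v - u) ^+ 2 / 2 = v / u * ((v * v) / 2) - v * v + v * u / 2.
    by field; rewrite gt_eqF.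
  by rewrite vE'; field; rewrite gt_eqF.
- rewrite exprn_gt0 ?subr_gt0//=.
  apply: (@le_trans _ _ ((v / 2) ^+ 2)).
    by rewrite lerXn2r ?nnegrE ?subr_ge0 ?divr_ge0// ?(ltW uv) ?(ltW v0)//; lra.
  by rewrite expr_div_n vE; lra.
Qed.

End Exponents.

(** * From grid frequencies to all frequencies *)

Section Lipschitz.
Context (R : realType).

Lemma cos_lipschitz (x y : R) : `|cos x - cos y| <= `|x - y|.
Proof.
wlog xy : x y / x <= y.
  move=> h; have [xy|/ltW yx] := leP x y; first exact: h.
  by rewrite distrC [leRHS]distrC; exact: h.
have [c _ e] := @MVT_segment R cos (fun z => - sin z) x y xy
  (fun z _ => is_derive_cos z)
  (continuous_subspaceT (@continuous_cos R)).
rewrite distrC e normrM normrN [leRHS]distrC ler_piMl//; exact: sin_max.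
Qed.

Variable nu : {finite_measure set (measurableTypeR R) -> \bar R}.

Definition cos_transform (theta x : R) : R :=
  \int[nu]_(t in `[0, 1]) cos (theta + 2 * pi * x * t).

Let mI : measurable (`[0, 1]%classic : set (measurableTypeR R)).
Proof. exact: measurable_itv. Qed.

Lemma integrable_cos_affine theta y :
  nu.-integrable `[0, 1] (EFin \o (fun t : R => cos (theta + y * t))).
Proof.
apply: measurable_bounded_integrable => //.
- by rewrite ltey_eq fin_num_measure.
- apply: measurable_funTS; apply: continuous_measurable_fun.
  exact: continuous_cos_affine.
- exists 1; split; first exact: num_real.
  by move=> M M1 x _ /=; rewrite (le_trans (cos_max _))// ltW.
Qed.

Lemma cos_transform_lipschitz theta x y :
  `|cos_transform theta x - cos_transform theta y|
    <= 2 * pi * `|x - y| * fine (nu setT).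
Proof.
rewrite /cos_transform -RintegralB//; [|exact: integrable_cos_affine..].
have ic : nu.-integrable `[0, 1] (EFin \o (fun t : R =>
    cos (theta + 2 * pi * x * t) - cos (theta + 2 * pi * y * t))).
  have := integrableB mI (integrable_cos_affine theta (2 * pi * x)) (integrable_cos_affine theta (2 * pi * y)).
  by apply: eq_integrable => // t _.
apply: le_trans (le_normr_Rintegral mI ic) _.
have le1 : fine (nu `[0, 1]%classic) <= fine (nu setT).
  apply: fine_le; rewrite ?fin_num_measure//.
  by apply: le_measure; rewrite ?inE//; exact: mI.
apply: le_trans (ler_wpM2l _ le1); last by rewrite !mulr_ge0// pi_ge0.
rewrite -(Rintegral_cst nu mI); apply: le_Rintegral => //.
- have := integrable_norm ic.
  by apply: eq_integrable => // t _.
- exact: finite_measure_integrable_cst.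
move=> t; rewrite /= in_itv/= => /andP[t0 t1].
apply: le_trans (cos_lipschitz _ _) _.
have -> : theta + 2 * pi * x * t - (theta + 2 * pi * y * t) = 2 * pi * (x - y) * t by ring.
rewrite !normrM (ger0_norm t0) (ger0_norm (pi_ge0 R)) normr_nat.
by rewrite ler_piMr// !mulr_ge0// pi_ge0.
Qed.

End Lipschitz.

Section FrequencyGrid.
Context (R : realType) (b : nat).
Hypothesis b2 : (2 <= b)%N.
Variable nu : {finite_measure set (measurableTypeR R) -> \bar R}.

Let b_gt0 : 0 < b%:R :> R. Proof. by rewrite ltr0n ltnW. Qed.
Let b_gt1 : 1 < b%:R :> R. Proof. by rewrite ltr1n. Qed.
Let bX0 k : 0 < b%:R ^+ k :> R. Proof. by rewrite exprn_gt0. Qed.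

Lemma badic_scale (x : R) : 1 <= x -> exists k, b%:R ^+ k <= x < b%:R ^+ k.+1.
Proof.
move=> x1.
have ex : exists n, x < b%:R ^+ n.
  exists (Num.truncn x).+1; apply: (lt_trans (truncnS_gt x)).
  by rewrite -natrX ltr_nat ltn_expl.
case: (ex_minnP ex) => -[|k] hk mink.
  by move: hk; rewrite expr0 ltNge x1.
exists k; rewrite hk andbT leNgt; apply/negP => /mink.
by rewrite ltnn.
Qed.

Lemma exists_freq (k : nat) (x : R) : b%:R ^+ k <= x < b%:R ^+ k.+1 ->
  exists2 i, (i < freq_count b k)%N & `|x - freq R b k i| <= (b%:R ^+ k)^-1.
Proof.
move=> /andP[x1 x2]; set N := freq_count b k.
have N0 : 0 < N%:R :> R by rewrite /N natrX.
have b1 : 0 < b%:R - 1 :> R by rewrite subr_gt0.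
pose y := (x / b%:R ^+ k - 1) / (b%:R - 1).
have y0 : 0 <= y by rewrite divr_ge0 ?(ltW b1)// subr_ge0 ler_pdivlMr// mul1r.
have y1 : y < 1.
  by rewrite ltr_pdivrMr// mul1r ltrD2r ltr_pdivrMr// -exprS.
have yN0 : 0 <= y * N%:R by rewrite mulr_ge0// ltW.
have /andP[i1 i2] := truncn_itv yN0; set i := Num.truncn _ in i1 i2.
exists i.
  by rewrite -(ltr_nat R); apply: le_lt_trans i1 _; rewrite gtr_pMl.
have -> : x - freq R b k i = b%:R ^+ k * (b%:R - 1) / N%:R * (y * N%:R - i%:R).
  by rewrite /freq /y -/N; field; rewrite !gt_eqF.
have c0 : 0 < b%:R ^+ k * (b%:R - 1) / N%:R :> R by rewrite divr_gt0 ?mulr_gt0.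
rewrite normrM (gtr0_norm c0) ger0_norm ?subr_ge0//.
apply: (@le_trans _ _ (b%:R ^+ k * (b%:R - 1) / N%:R)).
  rewrite ler_piMr ?(ltW c0)// lerBlDr addrC; move: i2; rewrite -natr1.
  exact: ltW.
rewrite ler_pdivrMr// ler_pdivlMl//.
have -> : N%:R = b%:R ^+ k * b%:R ^+ k * b%:R :> R.
  by rewrite /N natrX mul2n -addnn exprS exprD mulrC.
by rewrite mulrA ler_pM2l ?mulr_gt0// gerBl.
Qed.

(** Moving x to a grid frequency costs at most A b^-k, and b^-k <= b^(-ek) as e <= 1; replacing b^k
    by x < b^(k+1) costs the factor b^e. *)
Lemma cos_transform_decay (theta e C : R) : 0 <= e <= 1 ->
  (forall k i, (i < freq_count b k)%N ->
    `|cos_transform nu theta (freq R b k i)| <= C * (b%:R `^ (- e)) ^+ k) ->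
  exists2 K : R, 0 <= K &
    forall x, 1 <= x -> `|cos_transform nu theta x| <= K * x `^ (- e).
Proof.
move=> /andP[e0 e1] hC; pose A := 2 * pi * fine (nu setT).
have A0 : 0 <= A by rewrite !mulr_ge0 ?pi_ge0// fine_ge0.
have C0 : 0 <= C.
  have := hC 0 0; rewrite /freq_count expn_gt0 (ltnW b2) expr0 mulr1 => /(_ isT).
  exact: le_trans.
exists ((C + A) * b%:R `^ e); first by rewrite mulr_ge0 ?powR_ge0 ?addr_ge0.
move=> x x1; have x0 : 0 < x by exact: lt_le_trans x1.
have [k kx] := badic_scale x1; have [i ik xi] := exists_freq kx.
have bk0 : 0 <= (b%:R `^ (- e)) ^+ k :> R by rewrite exprn_ge0 ?powR_ge0.
have bkE : (b%:R `^ (- e)) ^+ k = ((b%:R ^+ k) `^ e)^-1 :> R.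
  rewrite powRN exprVn; congr (_^-1).
  rewrite -(powR_mulrn k (powR_ge0 b%:R e)) -(powR_mulrn k (ltW b_gt0)).
  by rewrite -(powRrM b%:R) -(powRrM b%:R) mulrC.
apply: (@le_trans _ _ ((C + A) * (b%:R `^ (- e)) ^+ k)).
  have -> : cos_transform nu theta x = cos_transform nu theta (freq R b k i) +
    (cos_transform nu theta x - cos_transform nu theta (freq R b k i)) by ring.
  rewrite [leRHS]mulrDl; apply: le_trans (ler_normD _ _) _; apply: lerD.
    exact: hC.
  apply: le_trans (cos_transform_lipschitz _ _ _ _) _.
  rewrite /A mulrAC; apply: ler_wpM2l => //.
  apply: le_trans xi _; rewrite bkE lef_pV2 ?posrE ?powR_gt0//.
  by rewrite ler1_powR// exprn_ege1// ltW.
rewrite -mulrA; apply: ler_wpM2l; first exact: addr_ge0.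
have /andP[_ /ltW xk] := kx.
rewrite bkE powRN ler_pdivlMr ?powR_gt0// ler_pdivrMl ?powR_gt0//.
rewrite -powRM ?(ltW (bX0 _)) ?(ltW b_gt0)// -exprSr.
by apply: ge0_ler_powR; rewrite ?nnegrE ?(ltW x0) ?(ltW (bX0 _)).
Qed.

Lemma fourierE (x : R) : 0 <= x ->
  [/\ fourier nu x = Complex (cos_transform nu 0 x) (- cos_transform nu (- (pi / 2)) x)
    & fourier nu (- x) = Complex (cos_transform nu 0 x) (- cos_transform nu (pi / 2) x)].
Proof.
move=> x0; rewrite /fourier /cos_transform; split; congr Complex.
- by apply: eq_Rintegral => t _; rewrite add0r.
- by congr (- _); apply: eq_Rintegral => t _; rewrite addrC cosBpihalf.
- by apply: eq_Rintegral => t _; rewrite add0r mulrN mulNr cosN.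
- congr (- _); apply: eq_Rintegral => t _.
  by rewrite mulrN mulNr sinN addrC cosDpihalf.
Qed.

(* The phases - pi / 2 and pi / 2 give the sine transform at the frequencies x
   and - x. *)
Lemma fourier_decay_of_cos (D : R) :
  (forall theta, theta \in [:: 0; - (pi / 2); pi / 2] -> exists2 K : R, 0 <= K &
    forall x, 1 <= x -> `|cos_transform nu theta x| <= K * x `^ (- (D / 2))) ->
  fourier_decay nu D.
Proof.
move=> h.
have [K0 K00 h0] := h 0 (mem_head _ _).
have [K1 K10 h1] : exists2 K : R, 0 <= K & forall x, 1 <= x ->
    `|cos_transform nu (- (pi / 2)) x| <= K * x `^ (- (D / 2)).
  by apply: h; rewrite !inE eqxx orbT.
have [K2 K20 h2] : exists2 K : R, 0 <= K & forall x, 1 <= x ->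
    `|cos_transform nu (pi / 2) x| <= K * x `^ (- (D / 2)).
  by apply: h; rewrite !inE eqxx !orbT.
have sq (a K x : R) : 0 <= K -> `|a| <= K * x `^ (- (D / 2)) ->
    a ^+ 2 <= K ^+ 2 * x `^ (- D).
  move=> K_ge0 ha; have -> : x `^ (- D) = (x `^ (- (D / 2))) ^+ 2.
    by rewrite -powR_mulrn ?powR_ge0// -powRrM; congr (_ `^ _); field.
  rewrite -exprMn -(real_normK (num_real a)) lerXn2r// nnegrE.
  by rewrite mulr_ge0 ?powR_ge0.
exists (K0 ^+ 2 + K1 ^+ 2 + K2 ^+ 2), 1 => x x1.
set y := `|x| in x1 *; have y0 : 0 <= y by exact: normr_ge0.
have [e1 e2] := fourierE y0.
have pw : 0 <= y `^ (- D) by exact: powR_ge0.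
have s0 := sq _ _ _ K00 (h0 _ x1); have s1 := sq _ _ _ K10 (h1 _ x1).
have s2 := sq _ _ _ K20 (h2 _ x1).
have t1 : 0 <= K1 ^+ 2 * y `^ (- D) by rewrite mulr_ge0// sqr_ge0.
have t2 : 0 <= K2 ^+ 2 * y `^ (- D) by rewrite mulr_ge0// sqr_ge0.
have nE (a c : R) : ComplexField.Normc.normc (Complex a (- c)) ^+ 2 = a ^+ 2 + c ^+ 2.
  by rewrite /= sqr_sqrtr ?sqrrN// addr_ge0// sqr_ge0.
have [xE|xE] : x = y \/ x = - y.
  have [x0|/ltW x0] := leP 0 x; [left|right]; first by rewrite /y ger0_norm.
  by rewrite /y ler0_norm// opprK.
- by rewrite xE e1 nE; lra.
- by rewrite xE e2 nE; lra.
Qed.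

End FrequencyGrid.

(** * Decay and Fourier dimension of the limit measure *)

Section CascadeDecay.
Context (R : realType) (b : nat).
Hypothesis b2 : (2 <= b)%N.
Context d d' (Omega : measurableType d) (Omega' : measurableType d').
Context (P : probability Omega R) (P' : probability Omega' R).
Context (B : R -> Omega' -> R) (WI : cascade_index b -> R -> Omega -> R).
Variable sigma : R.
Hypothesis sigma0 : 0 < sigma.
Hypothesis hB : brownian_motion01 P' B.
Hypothesis hWI : cascade_family P P' (geometric_bm sigma B) WI.
Variable p : R.
Hypotheses (p1 : 1 < p) (p2 : p <= 2).
Variable MC : Omega -> {finite_measure set (measurableTypeR R) -> \bar R}.
Hypothesis hMC : is_cascade_measure P WI MC.

Let osc_int_cvg w theta x :
  weak_limit01 (fun m => cascade_density WI m w) (MC w) ->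
  osc_int WI m theta x w @[m --> \oo] --> cos_transform (MC w) theta x.
Proof.
move=> [_ /(_ (fun t => cos (theta + 2 * pi * x * t)))] h.
apply: (fine_cvg (f := fun m => (\int[lebesgue_measure]_(t in `[0%R, 1%R])
  (cos (theta + 2 * pi * x * t) * cascade_density WI m w t)%:E)%E)).
rewrite fineK.
  by apply: h; apply: continuous_subspaceT; exact: continuous_cos_affine.
apply: (integrable_fin_num _ (integrable_cos_affine (MC w) theta (2 * pi * x))).
exact: measurable_itv.
Qed.

(** The bounds on [osc_int] are uniform in m and pass to the weak limit, tested against continuous
    cosines; three phases suffice, hence three almost sure events. *)
Lemma cascade_fourier_decay (D D' : R) :
  decay_rate b sigma p = b%:R `^ (- (p * D / 2)) -> 0 <= D' -> D' < D -> D <= 1 ->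
  {ae P, forall w, fourier_decay (MC w) D'}.
Proof.
move=> decayE D'0 D'D D1.
(* Even, larger than 2, and such that q (D - D') > 8. *)
pose q := ((Num.truncn (8 / (D - D'))).+2).*2.
have q3 : (2 < q)%N by rewrite /q doubleS.
have qe : ~~ odd q by rewrite odd_double.
have qD : 8 < q%:R * (D - D').
  rewrite -ltr_pdivrMr ?subr_gt0//; apply: (lt_le_trans (truncnS_gt _)).
  by rewrite ler_nat /q -addnn ltnW// ltnS leq_addr.
have dec theta : {ae P, forall w, exists C : R, forall k m i, (i < freq_count b k)%N ->
    `|osc_int WI m theta (freq R b k i) w| <= C * (b%:R `^ (- (D' / 2))) ^+ k}.
  exact: (osc_int_freq_decay b2 sigma0 hB hWI p1 p2 decayE D'0 D'D D1 q3 qe qD).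
have dec3 : {ae P, forall w, forall theta, theta \in [:: 0; - (pi / 2); pi / 2] ->
    exists C : R, forall k m i, (i < freq_count b k)%N ->
    `|osc_int WI m theta (freq R b k i) w| <= C * (b%:R `^ (- (D' / 2))) ^+ k}.
  apply: filterS3 (dec 0) (dec (- (pi / 2))) (dec (pi / 2)) => w d0 d1 d2 theta.
  by rewrite !inE => /or3P[] /eqP ->.
apply: filterS2 dec3 hMC => w hdec hw; apply: (fourier_decay_of_cos) => theta th.
have [C hC] := hdec theta th.
apply: (cos_transform_decay b2 (C := C)) => [|k i ik].
  by rewrite divr_ge0//=; lra.
have cv : `|osc_int WI m theta (freq R b k i) w| @[m --> \oo] -->
    `|cos_transform (MC w) theta (freq R b k i)|.
  by apply: cvg_norm; exact: osc_int_cvg.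
rewrite -(cvg_lim _ cv)//; apply: limr_le; first by apply/cvg_ex; eexists; exact: cv.
by apply: nearW => m; exact: hC.
Qed.

End CascadeDecay.

(** The supremum runs over exponents below 1, and decay is known only strictly below D: the
    exponents D - D / (j + 1) lie in [0, 1[ and tend to D. *)
Lemma fourier_dim_ge (R : realType)
    (nu : {finite_measure set (measurableTypeR R) -> \bar R}) (D : R) :
  0 < D -> D <= 1 -> (forall j : nat, fourier_decay nu (D - D / j.+1%:R)) ->
  D <= fourier_dim nu.
Proof.
move=> D0 D1 h; have DjD (j : nat) : 0 < D / j.+1%:R <= D.
  by rewrite divr_gt0//= ler_pdivrMr// ler_peMr ?(ltW D0)// ler1n.
have hs j : D - D / j.+1%:R <= fourier_dim nu.
  apply: ub_le_sup; first by exists 1 => x [/andP[_ /ltW]].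
  have /andP[d0 dD] := DjD j; split=> //.
  by rewrite subr_ge0 dD (lt_le_trans _ D1)// gtrBl.
apply/ler_addgt0Pr => e e0; pose j := Num.truncn (D / e).
have : D / j.+1%:R <= e.
  rewrite ler_pdivrMr// mulrC -ler_pdivrMr// ltW//; exact: truncnS_gt.
by move=> je; rewrite -[leLHS](subrK (D / j.+1%:R)); apply: lerD.
Qed.

Theorem corollary1p8 (R : realType) (b : nat) (hb : (2 <= b)%N) (sigma : R)
    (hsigma0 : 0 < sigma) (hsigma1 : sigma < Num.sqrt (2 * ln b%:R))
    (d' : measure_display) (Omega' : measurableType d')
    (P' : probability Omega' R) (B : R -> Omega' -> R)
    (hB : brownian_motion01 P' B)
    (d : measure_display) (Omega : measurableType d)
    (P : probability Omega R) (WI : cascade_index b -> R -> Omega -> R)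
    (hWI : cascade_family P P' (geometric_bm sigma B) WI)
    (MC : Omega -> {finite_measure set (measurableTypeR R) -> \bar R})
    (hMC : is_cascade_measure P WI MC) :
  [/\ non_degenerate P MC,
      {ae P, forall w, polynomial_fourier_decay (MC w)}
    & {ae P, forall w, nonzero_measure (MC w) ->
        D_sigma b sigma <= fourier_dim (MC w)}].
Proof.
have [p [p1 p2 decayE /andP[D0 D1]]] := moment_exponent hb hsigma0 hsigma1.
set D := D_sigma b sigma in decayE D0 D1 *.
have decay D' : 0 <= D' -> D' < D -> {ae P, forall w, fourier_decay (MC w) D'}.
  move=> D'0 D'D.
  exact: (cascade_fourier_decay hb hsigma0 hB hWI p1 p2 hMC decayE D'0 D'D D1).
have rate1 : decay_rate b sigma p < 1.
  have b0 : 0 < b%:R :> R by rewrite ltr0n ltnW.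
  rewrite decayE /powR (gt_eqF b0) expR_lt1 nmulr_rlt0 ?ln_gt0 ?ltr1n//.
  by rewrite oppr_lt0 divr_gt0// mulr_gt0// (lt_trans _ p1).
split.
- exact: (cascade_non_degenerate hb hsigma0 hB hWI p1 p2 rate1 hMC).
- have D2 : D / 2 < D by lra.
  apply: filterS (decay _ _ D2) => [w hw|]; last by rewrite divr_ge0// ltW.
  by exists (D / 2); rewrite ?divr_gt0.
(* Countably many exponents, so that a single null set serves for all; j = 0 gives the exponent
   0. *)
have : {ae P, forall w, forall j : nat, fourier_decay (MC w) (D - D / j.+1%:R)}.
  apply/ae_foralln => j; apply: decay.
    by rewrite subr_ge0 ler_pdivrMr// ler_peMr ?(ltW D0)// ler1n.
  by rewrite gtrBl divr_gt0.
by apply: filterS => w hw _; exact: fourier_dim_ge.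
Qed.
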